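(* Let $G$ be a connected simple undirected graph (not necessarily finite) satisfying the interval condition and the local positioning condition, and having at least one vertex with finitely many neighbors. Then the $1$-skeleton of the universal cover $\widetilde{X(G)}$ of the triangle-square complex $X(G)$ of $G$ is (isomorphic to) the basis graph of a matroid. In particular, $\widetilde{X(G)}$ is a finite complex.
   Context: A matroid on a finite set $I$ is a non-empty collection $\mathcal{B}$ of subsets of $I$, called bases, such that for all $A,B\in\mathcal{B}$ and $a\in A\setminus B$ there exists $b\in B\setminus A$ with $(A\setminus\{a\})\cup\{b\}\in\mathcal{B}$. The basis graph of $\mathcal{B}$ is the graph whose vertices are the bases, two bases $A,B$ being adjacent if and only if $|A\Delta B|=2$. For a graph $G$, $d(u,v)$ is the shortest-path distance, and the interval between $u$ and $v$ is $I(u,v)=\{x: d(u,x)+d(x,v)=d(u,v)\}$. A triangle is a 3-cycle and a square is an induced 4-cycle of $G$. A pyramid is the wheel $W_4$ (a 4-cycle plus a vertex adjacent to all four of its vertices). An octahedron is $K_6$ minus a perfect matching. The triangle-square complex $X(G)$ is the 2-dimensional cell complex whose 1-skeleton is $G$ and whose 2-cells are a triangular cell attached along each triangle of $G$ and a square cell attached along each square of $G$. Its universal cover $\widetilde{X(G)}$ is its simply connected covering space, with the lifted cell structure; the $1$-skeleton is viewed as a graph. Interval condition: for any $u,v$ with $d(u,v)=2$, the subgraph induced by $I(u,v)$ is a square, a pyramid, or an octahedron. Local positioning condition: for every square $u_1u_2u_3u_4$ of $G$ (vertices in cyclic order) and every vertex $v$ with $d(v,u_1)=d(v,u_3)=2$,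 one has $d(v,u_2)+d(v,u_4)=4$. *)

(* Defs.v *)
From HB Require Import structures.
From mathcomp Require Import all_boot all_order all_algebra.
From mathcomp Require Import all_classical all_reals all_analysis.

Set Implicit Arguments.
Unset Strict Implicit.
Unset Printing Implicit Defensive.

Import Order.TTheory GRing.Theory Num.Theory.
Import numFieldNormedType.Exports.

Local Open Scope classical_set_scope.
Local Open Scope ring_scope.

Definition connected_graph (V : Type) (e : rel V) : Prop :=
  forall u v, exists2 s : seq V, path e u s & last u s = v.

(* The value is the meaningless default 0 when no path joins u to v; distances
   are only used below in connected graphs. *)
Definition dist (V : Type) (e : rel V) (u v : V) : nat :=
  let walk := [set n | exists s : seq V, [/\ path e u s, last u s = v & size s = n]] in
  xget 0%N [set n | walk n /\ forall m, walk m -> (n <= m)%N].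

Definition interval (V : Type) (e : rel V) (u v : V) : set V :=
  [set x | (dist e u x + dist e x v)%N = dist e u v].

Definition graph_iso (V W : Type) (e : rel V) (f : rel W) : Prop :=
  exists2 h : V -> W, bijective h & forall x y, f (h x) (h y) = e x y.

Definition induced (V : Type) (e : rel V) (A : set V) : rel A :=
  fun x y => e (val x) (val y).

Definition C4 : rel 'I_4 :=
  fun i j => (j == i.+1 %% 4 :> nat)%N || (i == j.+1 %% 4 :> nat)%N.

(* The rim is the 4-cycle 0, 1, 2, 3 and the hub is 4. *)
Definition W4 : rel 'I_5 :=
  fun i j => [|| (i < 4)%N && (j == 4 :> nat), (i == 4 :> nat) && (j < 4)%N |
    [&& (i < 4)%N, (j < 4)%N &
        (j == i.+1 %% 4 :> nat)%N || (i == j.+1 %% 4 :> nat)%N]].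

(* The perfect matching removed from K_6 is {0,3}, {1,4}, {2,5}. *)
Definition octahedron : rel 'I_6 :=
  fun i j => (i != j) && (i != j %[mod 3])%N.

Definition interval_condition (V : Type) (e : rel V) : Prop :=
  forall u v, dist e u v = 2 ->
    [\/ graph_iso (induced e (A := interval e u v)) C4,
        graph_iso (induced e (A := interval e u v)) W4 |
        graph_iso (induced e (A := interval e u v)) octahedron].

Definition is_triangle (V : Type) (e : rel V) (u v w : V) : Prop :=
  [/\ e u v, e v w & e w u].

Definition is_square (V : Type) (e : rel V) (u1 u2 u3 u4 : V) : Prop :=
  [/\ [/\ e u1 u2, e u2 u3, e u3 u4 & e u4 u1],
      u1 <> u3, u2 <> u4, ~~ e u1 u3 & ~~ e u2 u4].

Definition local_positioning_condition (V : Type) (e : rel V) : Prop :=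
  forall u1 u2 u3 u4 v, is_square e u1 u2 u3 u4 ->
    dist e v u1 = 2 -> dist e v u3 = 2 ->
    (dist e v u2 + dist e v u4)%N = 4.

Definition matroid (I : finType) (B : {set {set I}}) : Prop :=
  B != finset.set0 /\
  forall X Y : {set I}, X \in B -> Y \in B ->
    forall a, a \in X :\: Y ->
      exists2 b, b \in Y :\: X & b |: (X :\ a) \in B.

Definition basis_graph (I : finType) (B : {set {set I}}) :
    rel {X : {set I} | X \in B} :=
  fun X Y => #|(val X :\: val Y) :|: (val Y :\: val X)| == 2.

(* A cell is given by an ordering of its vertices (cyclic for a square), so
   the same geometric cell occurs several times, once for each ordering. *)
Inductive cell (V : Type) : Type :=
| CVertex of V
| CEdge of V & V
| CTriangle of V & V & V
| CSquare of V & V & V & V.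

Definition is_cell (V : Type) (e : rel V) (c : cell V) : Prop :=
  match c with
  | CVertex _ => True
  | CEdge u v => e u v
  | CTriangle u v w => is_triangle e u v w
  | CSquare u1 u2 u3 u4 => is_square e u1 u2 u3 u4
  end.

Definition cell_dim (V : Type) (c : cell V) : nat :=
  match c with
  | CVertex _ => 0
  | CEdge _ _ => 1
  | CTriangle _ _ _ | CSquare _ _ _ _ => 2
  end.

(* Model cells, all taken in the plane: a point, a segment, a triangle and
   the unit square. *)
Definition cell_dom (R : realType) (V : Type) (c : cell V) : set (R * R) :=
  match c with
  | CVertex _ => [set (0, 0)]
  | CEdge _ _ => [set z | 0 <= z.1 <= 1 /\ z.2 = 0]
  | CTriangle _ _ _ => [set z | [/\ 0 <= z.1, 0 <= z.2 & z.1 + z.2 <= 1]]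
  | CSquare _ _ _ _ => [set z | 0 <= z.1 <= 1 /\ 0 <= z.2 <= 1]
  end.

Definition vertex_point (R : realType) (V : Type) (v : V) : V -> R :=
  fun w => (`[< w = v >])%:R.

(* Points of the complex are recorded by coordinates indexed by the vertices:
   barycentric coordinates on vertices, edges and triangles, bilinear ones on
   squares.  Each characteristic map is injective on its model cell, and two
   cells meet exactly in the cells spanned by common vertices: the support of
   a point determines the cell whose interior contains it, since a 4-set of
   vertices carries at most one induced 4-cycle. *)
Definition cell_map (R : realType) (V : Type) (c : cell V) (z : R * R) :
    V -> R :=
  let d := @vertex_point R V in
  let: (s, t) := z in
  fun w =>
  match c with
  | CVertex u => d u w
  | CEdge u v => (1 - s) * d u w + s * d v w
  | CTriangle u v x => (1 - s - t) * d u w + s * d v w + t * d x w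
  | CSquare u1 u2 u3 u4 =>
      (1 - s) * (1 - t) * d u1 w + s * (1 - t) * d u2 w +
      s * t * d u3 w + (1 - s) * t * d u4 w
  end.

Record ts_complex (R : realType) (V : Type) (e : rel V) := TSComplex {
  coord :> V -> R ;
  _ : exists2 c, is_cell e c & (cell_map c @` cell_dom c) coord }.

HB.instance Definition _ (R : realType) (V : Type) (e : rel V) :=
  gen_eqMixin (ts_complex R e).
HB.instance Definition _ (R : realType) (V : Type) (e : rel V) :=
  gen_choiceMixin (ts_complex R e).

(* The CW (weak) topology: U is open iff its preimage under every
   characteristic map is relatively open in the model cell. *)
Definition ts_open (R : realType) (V : Type) (e : rel V)
    (U : set (ts_complex R e)) : Prop :=
  forall c, is_cell e c ->
    @open (subspace (@cell_dom R V c))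
      [set z | exists2 x, U x & coord x = cell_map c z].

Lemma coord_inj (R : realType) (V : Type) (e : rel V) :
  injective (@coord R V e).
Proof.
move=> [x hx] [y hy] /= xy; move: hx hy; rewrite xy => hx hy.
by congr TSComplex; exact: Prop_irrelevance.
Qed.

Section ts_topology.
Variables (R : realType) (V : Type) (e : rel V).

Lemma ts_openT : ts_open (@setT (ts_complex R e)).
Proof.
move=> c ec; apply/open_subspaceP; exists setT; first exact: openT.
apply/seteqP; split=> z /= [zc dz]; split=> //.
by exists (TSComplex (ex_intro2 _ _ c ec (ex_intro2 _ _ z dz erefl))).
Qed.

Lemma ts_openI : setI_closed (@ts_open R V e).
Proof.
move=> A B oA oB c ec; rewrite (_ : mkset _ =
  [set z | exists2 x, A x & coord x = cell_map c z] `&`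
  [set z | exists2 x, B x & coord x = cell_map c z]).
  by apply: openI; [exact: oA|exact: oB].
apply/seteqP; split=> z /=; first by case=> x [Ax Bx] xz; split; exists x.
move=> [[x Ax xz] [y By yz]]; exists x => //; split=> //.
by rewrite (_ : x = y) //; apply: coord_inj; rewrite xz yz.
Qed.

Lemma ts_open_bigU (I : Type) (f : I -> set (ts_complex R e)) :
  (forall i, ts_open (f i)) -> ts_open (\bigcup_i f i).
Proof.
move=> of_ c ec; rewrite (_ : mkset _ =
  \bigcup_i [set z | exists2 x, f i x & coord x = cell_map c z]).
  by apply: bigcup_open => i _; exact: of_.
apply/seteqP; split=> z /=; first by move=> [x [i _ fx] xz]; exists i => //; exists x.
by move=> [i _ [x fx xz]]; exists x => //; exists i.
Qed.

HB.instance Definition _ := isOpenTopological.Build (ts_complex R e)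
  ts_openT ts_openI ts_open_bigU.

End ts_topology.

Definition covering_map (E X : topologicalType) (p : E -> X) : Prop :=
  continuous p /\
  forall x : X, exists (U : set X) (S : set (set E)),
    [/\ open U, U x, p @^-1` U = \bigcup_(W in S) W, trivIset S id &
        forall W, S W -> open W /\
          exists q : X -> E,
            [/\ {within U, continuous q},
                forall y, U y -> W (q y) /\ p (q y) = y &
                forall z, W z -> q (p z) = z]].

Definition path_connected (R : realType) (E : topologicalType) : Prop :=
  forall x y : E, exists g : R -> E,
    [/\ {within `[0, 1], continuous g}, g 0 = x & g 1 = y].

Definition simply_connected (R : realType) (E : topologicalType) : Prop :=
  [/\ [set: E] !=set0, path_connected R E &
      forall g : R -> E, {within `[0, 1], continuous g} -> g 0 = g 1 ->
        exists H : R * R -> E,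
          [/\ {within `[0, 1] `*` `[0, 1], continuous H},
              forall s, s \in `[0, 1] -> H (s, 0) = g s,
              forall s, s \in `[0, 1] -> H (s, 1) = g 0 &
              forall t, t \in `[0, 1] -> H (0, t) = g 0 /\ H (1, t) = g 0]].

Section lifted_cells.
Variables (R : realType) (V : Type) (e : rel V).
Variables (E : topologicalType) (p : E -> ts_complex R e).

Definition universal_cover : Prop := covering_map p /\ simply_connected R E.

(* The closed cells of the cell structure lifted along p, as subsets of E. *)
Definition lifted_cells (n : nat) : set (set E) :=
  [set S | exists (c : cell V) (phi : R * R -> E),
    [/\ is_cell e c /\ cell_dim c = n, {within cell_dom c, continuous phi},
        forall z, cell_dom c z -> coord (p (phi z)) = cell_map c z &
        S = phi @` cell_dom c]].

Definition skeleton_vertices : set E := [set y | lifted_cells 0 [set y]].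

(* Two vertices are adjacent iff they are the two ends of a 1-cell. *)
Definition skeleton_graph : rel skeleton_vertices :=
  fun y z => `[< val y <> val z /\
    exists2 S, lifted_cells 1 S & S (val y) /\ S (val z) >].

Definition finite_complex : Prop := finite_set (\bigcup_n lifted_cells n).

End lifted_cells.

(* Main.v *)
Require Import Defs.
From mathcomp Require Import all_boot zify.
From mathcomp Require Import boolp.

(** The vertices of the cover are labelled by subsets of a finite set, one star at a time.

The interval condition is used in the following form: among the common neighbours of two
vertices u, v at distance 2, non-adjacency is a matching with at least one pair, and there
is no triangle (ic_opp_ex, ic_opp_uniq, ic_trifree).  The local positioning condition says
that a vertex adjacent to one corner of a square, and at distance 2 from the two corners
next to it, is at distance 3 from the last corner, and that the converse also holds
(lpc_corner_far, lpc_corner_adj).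

It follows that the link of a vertex contains neither a claw nor a diamond, so it is the
line graph of a graph whose vertices are its maximal cliques, here called sides.  No walk
of odd length over sides closes up: a shortest one, over all vertices of the graph, would
give a walk shorter by two at some neighbour (no_odd_side_walk).  Colour the sides of v
with two colours, number those of each colour, and let a x and c x be the numbers of the
two sides through the neighbour x.  The neighbours of v are then coded by pairs (a x, c x),
two of them being adjacent exactly when one coordinate agrees.  So v can be labelled by a
set, and x by the set where a x is replaced by c x; adjacency in the star of v becomes
exchange of one element (star_labelling_exists).  If v has finitely many neighbours, the
sets live in a finite type.

A labelling of the star of v determines one of the star of each neighbour: the vertices at
distance 2 from v are labelled by the parallelogram rule (carry_labelling).  A labelling
carried around a triangle or a square comes back unchanged (carry_triangle, carry_square).
Hence, by simple connectedness, all stars of the universal cover are labelled coherently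
from a single one, and only one finite neighbourhood is needed (cover_labelling).  Let f y
be the label of the vertex y.  By induction on the distance, the symmetric difference of
f y and f z has 2 d(y,z) elements (at_dist_card).  So f is injective, adjacency is exchange
of one element everywhere, and the first step of a geodesic realizes the exchange axiom.
The labels being subsets of a finite set, the cover is finite.

The topology enters at two points.  The 1-skeleton of the cover is connected,
    as the set of the points whose cell has corners
that can be reached by a walk is open and closed (skeleton_connected).  And a walk that
closes up in the cover acts trivially on every system of states which is unaffected by
triangles and squares (trivial_holonomy): along a null-homotopy, such states are attached
to the vertices that support the image point and are locally constant, and a locally
constant system over the unit square has global sections (solvable_square). *)

Set Implicit Arguments.
Unset Strict Implicit.
Unset Printing Implicit Defensive.

(** * Finite sets at Hamming distance two *)
Section HalfCube.
Variable I : finType.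
Implicit Types A B C D P Q S X Y Z V W : {set I}.

Definition symd X Y : {set I} := (X :\: Y) :|: (Y :\: X).

Lemma in_symd X Y i : (i \in symd X Y) = (i \in X) (+) (i \in Y).
Proof. by rewrite !inE; do 2 case: (_ \in _). Qed.

(** The size of every Boolean combination of four sets is a sum of sizes of atoms.  This turns
statements on the sizes of symmetric differences into linear arithmetic. *)
Lemma venn4 A B C D : exists N : bool -> bool -> bool -> bool -> nat,
  forall S (phi : bool -> bool -> bool -> bool -> bool), (forall i,
      (i \in S) = phi (i \in A) (i \in B) (i \in C) (i \in D)) ->
  #|S| = phi true true true true * N true true true true
       + phi true true true false * N true true true false
       + phi true true false true * N true true false true
       + phi true true false false * N true true false false
       + phi true false true true * N true false true true
       + phi true false true false * N true false true false
       + phi true false false true * N true false false true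
       + phi true false false false * N true false false false
       + phi false true true true * N false true true true
       + phi false true true false * N false true true false
       + phi false true false true * N false true false true
       + phi false true false false * N false true false false
       + phi false false true true * N false false true true
       + phi false false true false * N false false true false
       + phi false false false true * N false false false true
       + phi false false false false * N false false false false.
Proof.
have cE (S : {pred I}) : #|S| = \sum_i (i \in S).
  by rewrite -sum1_card big_mkcond; apply: eq_bigr => i _; case: (i \in S).
exists (fun a b c d => #|[pred i | [&& (i \in A) == a, (i \in B) == b,
                            (i \in C) == c & (i \in D) == d]]|) => S phi Sphi.
rewrite !cE !big_distrr -!big_split; apply: eq_bigr => i _; rewrite Sphi !inE /=.
by do 4 case: (_ \in _); rewrite /= ?muln0 ?muln1 ?addn0 ?add0n.
Qed.

Lemma venn3 A B C : exists N : bool -> bool -> bool -> nat,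
  forall S (phi : bool -> bool -> bool -> bool),
  (forall i, (i \in S) = phi (i \in A) (i \in B) (i \in C)) ->
  #|S| = phi true true true * N true true true
       + phi true true false * N true true false
       + phi true false true * N true false true
       + phi true false false * N true false false
       + phi false true true * N false true true
       + phi false true false * N false true false
       + phi false false true * N false false true
       + phi false false false * N false false false.
Proof.
have [N cN] := venn4 A B C set0.
exists (fun a b c => N a b c false) => S phi Sphi.
rewrite (cN S (fun a b c d => ~~ d && phi a b c)) /= ?mul0n ?add0n ?addn0 //.
by move=> i; rewrite inE.
Qed.

Lemma symdC X Y : symd X Y = symd Y X.
Proof. by apply/setP => i; rewrite !in_symd addbC. Qed.
Lemma symdA : associative symd.
Proof. by move=> X Y Z; apply/setP => i; rewrite !in_symd addbA. Qed.
Lemma symdK X Y : symd X (symd X Y) = Y.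
Proof. by apply/setP => i; rewrite !in_symd addKb. Qed.
Lemma symdd X : symd X X = set0.
Proof. by apply/setP => i; rewrite !in_symd addbb inE. Qed.
Lemma symd0 X : symd X set0 = X.
Proof. by apply/setP => i; rewrite !in_symd inE addbF. Qed.
Lemma symd_trans X Y Z : symd X Y = symd (symd Z X) (symd Z Y).
Proof. by apply/setP => i; rewrite !in_symd; do 3 case: (_ \in _). Qed.
Lemma symd_eq0 X Y : #|symd X Y| = 0 -> X = Y.
Proof.
move/eqP; rewrite cards_eq0 => /eqP h.
by rewrite -[Y](symdK X) h symd0.
Qed.
Lemma symd_inj Z X Y : symd Z X = symd Z Y -> X = Y.
Proof. by move=> h; rewrite -(symdK Z X) h symdK. Qed.

Definition adj2 X Y := #|symd X Y| == 2.
Lemma adj2C X Y : adj2 X Y = adj2 Y X.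
Proof. by rewrite /adj2 symdC. Qed.

End HalfCube.

(** [count4 cN S phi h] records in [h] the size of [S] in terms of the atoms counted by [cN],
for [S] the combination [phi] of the four sets. *)
Tactic Notation "count4" constr(cN) constr(S) uconstr(phi) ident(h) :=
  let f := constr:(phi : bool -> bool -> bool -> bool -> bool) in
  have h := cN S f (ltac:(by move=> ?; rewrite ?(in_symd, inE)));
  rewrite /= ?mul1n ?mul0n in h.
Tactic Notation "count3" constr(cN) constr(S) uconstr(phi) ident(h) :=
  let f := constr:(phi : bool -> bool -> bool -> bool) in
  have h := cN S f (ltac:(by move=> ?; rewrite ?(in_symd, inE)));
  rewrite /= ?mul1n ?mul0n in h.

Section HalfCubeAdj.
Variable I : finType.
Implicit Types P Q S X Y Z V W : {set I}.

Lemma adj2_far P X Q : adj2 P X -> adj2 X Q -> P <> Q -> ~~ adj2 P Q -> #|symd P Q| = 4.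
Proof.
rewrite /adj2 => /eqP h1 /eqP h2 h3 h4.
have h0 : #|symd P Q| <> 0 by move/symd_eq0.
move/eqP: h4 => h4.
have [N cN] := venn3 P Q X.
count3 cN (symd P Q) (fun a b c => a (+) b) k1.
count3 cN (symd P X) (fun a b c => a (+) c) k2.
count3 cN (symd X Q) (fun a b c => c (+) b) k3.
lia.
Qed.

(** On the way from P to Q, the sets Z and Z' change two elements of the four each.  Not being
adjacent, they change complementary pairs. *)
Lemma far_square P Z Q Z' : #|symd P Q| = 4 -> adj2 P Z -> adj2 Z Q -> adj2 Q Z' -> adj2 Z' P ->
  Z <> Z' -> ~~ adj2 Z Z' -> symd P Q = symd Z Z'.
Proof.
rewrite /adj2 => h0 /eqP h1 /eqP h2 /eqP h3 /eqP h4 h5 /eqP h6.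
have h7 : #|symd Z Z'| <> 0 by move/symd_eq0.
apply: symd_eq0.
have [N cN] := venn4 P Q Z Z'.
count4 cN (symd P Q) (fun a b c d => a (+) b) k1.
count4 cN (symd P Z) (fun a b c d => a (+) c) k2.
count4 cN (symd Z Q) (fun a b c d => c (+) b) k3.
count4 cN (symd Q Z') (fun a b c d => b (+) d) k4.
count4 cN (symd Z' P) (fun a b c d => d (+) a) k5.
count4 cN (symd Z Z') (fun a b c d => c (+) d) k6.
count4 cN (symd (symd P Q) (symd Z Z')) (fun a b c d => a (+) b (+) (c (+) d)) k7.
lia.
Qed.

(** Here symd V (symd P Q) is the fourth corner of the parallelogram V, P, Q.  A neighbour of
its three other corners is a neighbour of it as well. *)
Lemma far_apex V P Q X : #|symd P Q| = 4 -> adj2 V P -> adj2 V Q -> adj2 X P -> adj2 X Q ->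
  adj2 X V -> adj2 X (symd V (symd P Q)).
Proof.
rewrite /adj2 => h0 /eqP h1 /eqP h2 /eqP h3 /eqP h4 /eqP h5; apply/eqP.
have [N cN] := venn4 P Q V X.
count4 cN (symd P Q) (fun a b c d => a (+) b) k1.
count4 cN (symd V P) (fun a b c d => c (+) a) k2.
count4 cN (symd V Q) (fun a b c d => c (+) b) k3.
count4 cN (symd X P) (fun a b c d => d (+) a) k4.
count4 cN (symd X Q) (fun a b c d => d (+) b) k5.
count4 cN (symd X V) (fun a b c d => d (+) c) k6.
count4 cN (symd X (symd V (symd P Q))) (fun a b c d => d (+) (c (+) (a (+) b))) k7.
lia.
Qed.

Lemma far_mid V P Q Y : #|symd P Q| = 4 -> adj2 V P -> adj2 V Q -> adj2 Y V ->
  adj2 Y (symd V (symd P Q)) -> [\/ Y = P, Y = Q | adj2 Y P && adj2 Y Q].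
Proof.
rewrite /adj2 => h0 /eqP h1 /eqP h2 /eqP h3 /eqP h4.
have [N cN] := venn4 P Q V Y.
count4 cN (symd P Q) (fun a b c d => a (+) b) k1.
count4 cN (symd V P) (fun a b c d => c (+) a) k2.
count4 cN (symd V Q) (fun a b c d => c (+) b) k3.
count4 cN (symd Y P) (fun a b c d => d (+) a) k4.
count4 cN (symd Y Q) (fun a b c d => d (+) b) k5.
count4 cN (symd Y V) (fun a b c d => d (+) c) k6.
count4 cN (symd Y (symd V (symd P Q))) (fun a b c d => d (+) (c (+) (a (+) b))) k7.
have [/symd_eq0 e|n1] := eqVneq #|symd Y P| 0; first by constructor 1.
have [/symd_eq0 e|n2] := eqVneq #|symd Y Q| 0; first by constructor 2.
constructor 3; lia.
Qed.

(** The pairs P and Q share one element each with V, and their other elements form the fourth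
corner U of the parallelogram V, P, Q.  As W misses V, the elements of W in U are those in
P together with those in Q, and their number is 2, 0 or 1. *)
Lemma disjoint_count V P Q W : #|symd P Q| = 4 -> #|V| = 2 -> #|P| = 2 -> #|Q| = 2 -> #|W| = 2 ->
  #|symd V P| = 2 -> #|symd V Q| = 2 -> #|symd V W| = 4 ->
  [\/ [/\ #|symd W P| = 2, #|symd W Q| = 2 & W = symd V (symd P Q)],
      [/\ #|symd W P| <> 2, #|symd W Q| <> 2, #|symd W (symd V (symd P Q))| <> 2
        & W <> symd V (symd P Q)]
    | [/\ (#|symd W P| = 2 /\ #|symd W Q| <> 2) \/ (#|symd W P| <> 2 /\ #|symd W Q| = 2),
          #|symd W (symd V (symd P Q))| = 2 & W <> symd V (symd P Q)] ].
Proof.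
move=> h0 h1 h2 h3 h4 h5 h6 h7.
have [N cN] := venn4 V P Q W.
count4 cN (symd P Q) (fun a b c d => b (+) c) k0.
count4 cN V (fun a b c d => a) k1.
count4 cN P (fun a b c d => b) k2.
count4 cN Q (fun a b c d => c) k3.
count4 cN W (fun a b c d => d) k4.
count4 cN (symd V P) (fun a b c d => a (+) b) k5.
count4 cN (symd V Q) (fun a b c d => a (+) c) k6.
count4 cN (symd V W) (fun a b c d => a (+) d) k7.
count4 cN (symd W P) (fun a b c d => d (+) b) k8.
count4 cN (symd W Q) (fun a b c d => d (+) c) k9.
count4 cN (symd W (symd V (symd P Q))) (fun a b c d => d (+) (a (+) (b (+) c))) k10.
have k11 : W = symd V (symd P Q) -> #|symd W (symd V (symd P Q))| = 0.
  by move=> {1}->; rewrite symdd cards0.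
have [e|n1] := eqVneq #|symd W (symd V (symd P Q))| 0.
  by constructor 1; split; [lia|lia|exact: symd_eq0].
have k12 : W <> symd V (symd P Q) by move/k11; lia.
have [e|n2] := eqVneq #|symd W (symd V (symd P Q))| 2.
  by constructor 3; split=> //; lia.
constructor 2; split=> //; lia.
Qed.

(** Translation by X turns the sets adjacent to X into pairs. *)
Lemma far_count X V P Q W : #|symd P Q| = 4 -> adj2 X V -> adj2 X P -> adj2 X Q -> adj2 V P ->
  adj2 V Q -> adj2 X W -> #|symd V W| = 4 ->
  [\/ [/\ adj2 W P, adj2 W Q & W = symd V (symd P Q)],
      [/\ ~~ adj2 W P, ~~ adj2 W Q, ~~ adj2 W (symd V (symd P Q)) & W <> symd V (symd P Q)]
    | [/\ adj2 W P != adj2 W Q, adj2 W (symd V (symd P Q)) & W <> symd V (symd P Q)] ].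
Proof.
rewrite /adj2 (symd_trans P Q X) (symd_trans V P X) (symd_trans V Q X) (symd_trans V W X).
rewrite (symd_trans W P X) (symd_trans W Q X) (symd_trans W (symd _ _) X).
have -> : symd X (symd V (symd (symd X P) (symd X Q))) = symd (symd X V) (symd (symd X P) (symd X Q)).
  exact: symdA.
have eqE : (W = symd V (symd (symd X P) (symd X Q))) <->
  (symd X W = symd (symd X V) (symd (symd X P) (symd X Q))).
  by split=> [->|h]; [exact: symdA | apply: (@symd_inj _ X); rewrite h; symmetry; exact: symdA].
move=> h0 /eqP h1 /eqP h2 /eqP h3 /eqP h4 /eqP h5 /eqP h6 h7.
have := disjoint_count h0 h1 h2 h3 h6 h4 h5 h7.
case=> [[/eqP k1 /eqP k2 /eqE k3]|[/eqP k1 /eqP k2 /eqP k3 k4]|[k1 /eqP k2 k3]].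
- by constructor 1.
- by constructor 2; split=> //; move/eqE.
- by constructor 3; split=> //; [by case: k1; lia|move/eqE].
Qed.

(** Sizes, too, are additive along parallelograms. *)
Lemma far_card V P Q : #|symd P Q| = 4 -> adj2 V P -> adj2 V Q ->
  #|symd V (symd P Q)| + #|V| = #|P| + #|Q|.
Proof.
rewrite /adj2 => h0 /eqP h1 /eqP h2.
have [N cN] := venn3 P Q V.
count3 cN (symd P Q) (fun a b c => a (+) b) k1.
count3 cN (symd V P) (fun a b c => c (+) a) k2.
count3 cN (symd V Q) (fun a b c => c (+) b) k3.
count3 cN (symd V (symd P Q)) (fun a b c => c (+) (a (+) b)) k7.
count3 cN V (fun a b c => c) k4.
count3 cN P (fun a b c => a) k5.
count3 cN Q (fun a b c => b) k6.
lia.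
Qed.
End HalfCubeAdj.

(** * Odd closed walks *)

(** The choice depends on P only through its extension, so that classes of an equivalence
relation get well-defined representatives. *)
Definition some_of (T : Type) (P : T -> Prop) (t : T) : T :=
  if pselect (exists b, P b) is left h then sval (cid h) else t.

Lemma some_ofP (T : Type) (P : T -> Prop) t : (exists b, P b) -> P (some_of P t).
Proof. by rewrite /some_of => hP; case: pselect => // h; case: cid. Qed.

Lemma some_of_indep (T : Type) (P : T -> Prop) t t' : (exists b, P b) -> some_of P t = some_of P t'.
Proof. by rewrite /some_of => hP; case: pselect. Qed.

Section OddWalks.
Variables (K : Type) (H : K -> K -> Prop).
Hypothesis H_sym : forall a b, H a b -> H b a.

(** The vertices to be walked over are maximal cliques, given as predicates; there is no
decidable equality on them, hence a relation in Prop. *)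
Fixpoint hwalk n a b :=
  if n is n'.+1 then exists c, H a c /\ hwalk n' c b else a = b.

Lemma hwalk_cat m n a b c : hwalk m a b -> hwalk n b c -> hwalk (m + n) a c.
Proof.
elim: m a => [a -> //|m IHm a [d [ad db]] bc].
by exists d; split=> //; apply: IHm.
Qed.

Lemma hwalk_sym n a b : hwalk n a b -> hwalk n b a.
Proof.
elim: n a b => [a b -> //|n IHn a b [c [ac /IHn cb]]].
by rewrite -addn1; apply: hwalk_cat cb _; exists a; split=> //; apply: H_sym.
Qed.

Lemma hwalk_seq n a b : hwalk n a b ->
  exists k : nat -> K, [/\ k 0 = a, k n = b & forall i, i < n -> H (k i) (k i.+1)].
Proof.
elim: n a => [a <-|n IHn a [c [ac /IHn [k [k0 kn kH]]]]]; first by exists (fun=> a).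
exists (fun i => if i is j.+1 then k j else a); split=> // -[_|i]; first by rewrite k0.
exact: kH.
Qed.

Lemma seq_hwalk (k : nat -> K) i n :
  (forall j, i <= j < i + n -> H (k j) (k j.+1)) -> hwalk n (k i) (k (i + n)).
Proof.
elim: n i => [i _|n IHn i kH]; first by rewrite addn0.
exists (k i.+1); split; first by apply: kH; lia.
by rewrite -addSnnS; apply: IHn => j ij; apply: kH; lia.
Qed.

(** The colour of a vertex is the parity of the walks to it from the representative of its
component. *)
Lemma two_coloring : (forall n a, odd n -> ~ hwalk n a a) ->
  exists col : K -> bool, forall a b, H a b -> col a != col b.
Proof.
move=> noodd; pose conn a b := exists n, hwalk n a b.
have cs a b : conn a b -> conn b a by move=> [n /hwalk_sym h]; exists n.
have ct a b c : conn a b -> conn b c -> conn a c.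
  by move=> [n h] [m h']; exists (n + m); apply: hwalk_cat h h'.
have ex a : exists b, conn a b by exists a, 0.
pose rep a := some_of (conn a) a.
have repP a : conn (rep a) a by apply: cs; apply: some_ofP.
have repE a b : conn a b -> rep a = rep b.
  move=> ab; rewrite /rep (_ : conn a = conn b); first exact: some_of_indep.
  by apply: funext => c; apply: propext; split=> h; [apply: ct h; apply: cs|apply: ct h].
exists (fun a => `[< exists n, odd n /\ hwalk n (rep a) a >]) => a b ab.
have ca := repP a; have rab : rep a = rep b by apply: repE; exists 1, b.
rewrite -rab; apply/eqP; case: asboolP => [[n [on h]]|ha]; case: asboolP => [[m [om h']]|hb] // _.
(* walks to a and b of the same parity close up to an odd walk *)
- apply: (noodd (n + 1 + m) (rep a)); first by rewrite !oddD on om.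
  apply: hwalk_cat (hwalk_sym h'); apply: hwalk_cat h _.
  by exists b.
- case: ca => n h; case: (boolP (odd n)) => on; first by apply: ha; exists n.
  apply: hb; exists (n + 1); split; first by rewrite oddD (negPf on).
  by apply: hwalk_cat h _; exists b.
Qed.

(** A shortcut between two vertices of a shortest odd closed walk would close one of the two
arcs between them to a shorter odd walk. *)
Lemma shortest_odd_isometric n (k : nat -> K) : odd n -> k n = k 0 ->
  (forall i, i < n -> H (k i) (k i.+1)) ->
  (forall m a, odd m -> m < n -> ~ hwalk m a a) ->
  forall m i j, i <= j <= n -> hwalk m (k i) (k j) -> j - i <= m \/ n - (j - i) <= m.
Proof.
move=> on kn kH mn m i j /andP[ij jn] h.
have arc1 : hwalk (j - i) (k i) (k j).
  by rewrite -{2}(subnKC ij); apply: seq_hwalk => l il; apply: kH; lia.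
have arc2 : hwalk (n - j + i) (k j) (k i).
  apply: (@hwalk_cat _ _ _ (k n)).
    by rewrite -{2}(subnKC jn); apply: seq_hwalk => l il; apply: kH; lia.
  by rewrite kn -{2}(add0n i); apply: seq_hwalk => l il; apply: kH; lia.
have w1 := hwalk_cat arc1 (hwalk_sym h).
have w2 := hwalk_cat h arc2.
case: (boolP (odd (j - i + m))) => o1.
  by right; rewrite leqNgt; apply/negP => lt; apply: (mn _ _ o1 _ w1); lia.
left; rewrite leqNgt; apply/negP => lt; apply: (mn _ _ _ _ w2); last by lia.
by move: o1 on; lia.
Qed.
End OddWalks.

(** * From local to global labellings by sets *)
Section LocalToGlobal.
Variables (W : Type) (d : rel W) (I : finType) (f : W -> {set I}).
Hypothesis d_sym : symmetric d.
Hypothesis d_conn : forall u v, exists2 s : seq W, path d u s & last u s = v.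
Hypothesis f_adj : forall x y, d x y -> adj2 (f x) (f y).
Hypothesis f_star : forall u x y, d u x -> d u y -> adj2 (f x) (f y) -> d x y.
Hypothesis f_inj : forall u x y, d u x -> d u y -> f x = f y -> x = y.
Hypothesis f_square : forall u x w, d u x -> d x w -> u <> w -> ~~ d u w ->
  exists p q, [/\ d u p, d p w, d u q, d q w & symd (f u) (f w) = symd (f p) (f q)].

Definition walk n u v := exists s : seq W, [/\ path d u s, last u s = v & size s = n].
Definition at_dist n u v := walk n u v /\ forall m, walk m u v -> n <= m.

Lemma walkS n u x v : d u x -> walk n x v -> walk n.+1 u v.
Proof. by move=> ux [s [ps ls sz]]; exists (x :: s); rewrite /= ux sz. Qed.

Lemma at_dist_ex u v : exists n, at_dist n u v.
Proof.
have [s ps ls] := d_conn u v.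
have h : exists n, `[< walk n u v >] by exists (size s); apply/asboolP; exists s.
exists (ex_minn h); split; first by case: ex_minnP => n /asboolP.
by move=> m hm; case: ex_minnP => n _; apply; apply/asboolP.
Qed.

Lemma at_distS n u v : at_dist n.+1 u v -> exists2 x, d u x & at_dist n x v.
Proof.
case=> -[[|x s] [//= /andP[ux ps] ls [sz]]] h; exists x => //; split; first by exists s.
by move=> m hm; have := h _ (walkS ux hm).
Qed.

Lemma at_dist_pred n u x v : at_dist n.+1 u v -> d u x -> walk n x v -> at_dist n x v.
Proof. by case=> _ h ux hw; split=> // m hm; have := h _ (walkS ux hm). Qed.

(** Induction on the distance n, along a geodesic through a neighbour u' of u.  The two elements
that change from u to u' are not among those that change from u' to v: otherwise such an
element changes in some first step from u' to x, and then u and x are equal or adjacent.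
This needs the second part of the statement, that every element to be changed can be
changed in a first step.  For u that part follows from f_square: an element that changes
in two steps from u changes from u to one of the two opposite vertices in between. *)
Lemma at_dist_card n u v : at_dist n u v -> #|symd (f u) (f v)| = n.*2 /\
  forall i, i \in symd (f u) (f v) ->
    exists x, [/\ d u x, at_dist n.-1 x v & i \in symd (f u) (f x)].
Proof.
elim: n u v => [|n IHn] u v h.
  by case: h => -[[|x s] [//= _ -> _]] _; rewrite symdd cards0; split=> // i; rewrite inE.
have [u' uu' hu'] := at_distS h; have [c' ex'] := IHn _ _ hu'.
have short x : d u' x -> at_dist n.-1 x v -> 0 < n -> u <> x /\ ~~ d u x.
  move=> u'x hx n0; have [_ hmin] := h; have [wx _] := hx; split.
    by move=> ?; subst x; have := hmin _ wx; lia.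
  by apply/negP => ux; have := hmin _ (walkS ux wx); lia.
have pos i : i \in symd (f u') (f v) -> 0 < n.
  move=> ii; case: (posnP n) => // n0; move: c'; rewrite n0 => /eqP.
  by rewrite cards_eq0 => /eqP ii0; rewrite ii0 inE in ii.
have disj i : i \in symd (f u) (f u') -> i \notin symd (f u') (f v).
  move=> iu; apply/negP => iv; have [x [u'x hx ix]] := ex' _ iv.
  have [ux nux] := short x u'x hx (pos _ iv).
  have u'u : d u' u by rewrite d_sym.
  case/negP: nux; apply: (f_star u'u u'x); rewrite /adj2.
  have := f_adj uu'; have := f_adj u'x; rewrite /adj2 => /eqP h1 /eqP h2.
  have h3 : #|symd (f u) (f x)| <> 0 by move/symd_eq0/(f_inj u'u u'x).
  have h4 : 0 < #|symd (f u) (f u') :&: symd (f u') (f x)|.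
    by apply/card_gt0P; exists i; rewrite inE iu ix.
  have [N cN] := venn3 (f u) (f u') (f x).
  count3 cN (symd (f u) (f x)) (fun a b c => a (+) c) k1.
  count3 cN (symd (f u) (f u')) (fun a b c => a (+) b) k2.
  count3 cN (symd (f u') (f x)) (fun a b c => b (+) c) k3.
  count3 cN (symd (f u) (f u') :&: symd (f u') (f x)) (fun a b c => (a (+) b) && (b (+) c)) k4.
  lia.
have mem i : i \in symd (f u) (f v) = (i \in symd (f u) (f u')) || (i \in symd (f u') (f v)).
  have := disj i; rewrite !in_symd; case: (i \in f u); case: (i \in f u');
      case: (i \in f v) => //= /(_ isT) //.
split=> [|i].
  rewrite (_ : symd (f u) (f v) = symd (f u) (f u') :|: symd (f u') (f v)); last first.
    by apply/setP => i; rewrite mem in_setU.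
  rewrite cardsU (_ : _ :&: _ = set0) ?cards0 ?subn0 ?c'.
    by have /eqP -> := f_adj uu'; lia.
  by apply/setP => i; rewrite in_setI in_set0; apply/negbTE/negP => /andP[/disj/negP].
case: (boolP (i \in symd (f u) (f u'))) => [iu _|iu]; first by exists u'.
rewrite mem (negPf iu) /= => iv; have [y [u'y hy iy]] := ex' _ iv.
have n0 := pos _ iv; have [uy nuy] := short y u'y hy n0.
have [p [q [up py uq qy pq]]] := f_square uu' u'y uy nuy.
have : i \in symd (f p) (f q).
  by rewrite -pq; move: iu iy; rewrite !in_symd; do 3 case: (_ \in _).
have ok x : d u x -> d x y -> at_dist n x v.
  move=> ux xy; apply: (at_dist_pred h ux).
  by case: hy => hy _; rewrite -(prednK n0); apply: walkS xy hy.
have : (i \in symd (f p) (f q)) -> (i \in symd (f u) (f p)) || (i \in symd (f u) (f q)).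
  by rewrite !in_symd; do 3 case: (_ \in _).
move=> /[apply] /orP[ip|iq]; [exists p|exists q]; split=> //=; exact: ok.
Qed.

Lemma global_inj x y : f x = f y -> x = y.
Proof.
move=> xy; have [n h] := at_dist_ex x y; have [c _] := at_dist_card h.
move: c h; rewrite xy symdd cards0; case: n => // _ [[s [_ <- /size0nil ->]] _] //.
Qed.

Lemma global_adj x y : d x y = adj2 (f x) (f y).
Proof.
apply/idP/idP => [/f_adj //|]; rewrite /adj2 => /eqP.
have [n h] := at_dist_ex x y; have [-> _] := at_dist_card h.
move=> n1; have {}n1 : n = 1 by lia.
by subst n; have [z xz [[s [_ <- /size0nil ->]] _]] := at_distS h.
Qed.

Hypothesis f_card : forall x y, #|f x| = #|f y|.

(** A first step towards y that changes a removes a and adds one element b, the sizes of the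
sets being equal; b is in f y because the distance to f y drops by two elements. *)
Lemma global_exchange x y a : a \in f x :\: f y ->
  exists2 b, b \in f y :\: f x & exists z, f z = b |: (f x :\ a).
Proof.
rewrite inE => /andP[ay ax]; have [n h] := at_dist_ex x y.
have [c] := at_dist_card h; move=> /(_ a); rewrite in_symd ax (negPf ay) => /(_ isT) [z [xz hz az]].
have [cz _] := at_dist_card hz; have /eqP c2 := f_adj xz; have cc := f_card x z.
have az' : a \in f x :\: f z by move: az; rewrite in_symd inE ax; case: (_ \in _).
have n0 : 0 < n.
  case: (posnP n) => // n0; move: c; rewrite n0 => /eqP; rewrite cards_eq0 => /eqP c0.
  by have := in_symd (f x) (f y) a; rewrite c0 inE ax (negPf ay).
have [N cN] := venn3 (f x) (f y) (f z).
count3 cN (symd (f x) (f y)) (fun a b c => a (+) b) k1.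
count3 cN (symd (f z) (f y)) (fun a b c => c (+) b) k2.
count3 cN (symd (f x) (f z)) (fun a b c => a (+) c) k3.
count3 cN (f x) (fun a b c => a) k4.
count3 cN (f z) (fun a b c => c) k5.
count3 cN (f x :\: f z) (fun a b c => ~~ c && a) k6.
count3 cN (f z :\: f x) (fun a b c => ~~ a && c) k7.
count3 cN ((f z :\: f x) :\: f y) (fun a b c => ~~ b && (~~ a && c)) k9.
have /eqP/cards1P [a' A] : #|f x :\: f z| = 1 by lia.
have /eqP/cards1P [b B] : #|f z :\: f x| = 1 by lia.
have /eqP C : #|(f z :\: f x) :\: f y| = 0 by lia.
have aE : a = a' by apply/set1P; rewrite -A.
subst a'.
have bzx : b \in f z :\: f x by rewrite B inE.
have := bzx; rewrite inE => /andP[bx bz].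
exists b.
  rewrite inE bx /=; move: C; rewrite cards_eq0 => /eqP C.
  have : b \notin (f z :\: f x) :\: f y by rewrite C inE.
  by rewrite inE bzx andbT negbK.
exists z; apply/setP => i; rewrite !inE.
have Ai : (i \in f x :\: f z) = (i == a) by rewrite A inE.
have Bi : (i \in f z :\: f x) = (i == b) by rewrite B inE.
rewrite -Ai -Bi !inE; do 2 case: (_ \in _) => //=.
Qed.
End LocalToGlobal.

(** * Links in a graph with small intervals *)
Section LocalStructure.
Variables (V : Type) (e : rel V).
Hypotheses (e_sym : symmetric e) (e_irr : irreflexive e).

(** For vertices with a common neighbour this means distance 2. *)
Definition nadj u v := u <> v /\ ~~ e u v.

Definition sq a b c d :=
  [/\ e a b, e b c, e c d, e d a & nadj a c /\ nadj b d].

Hypothesis opp_ex : forall u v x, nadj u v -> e u x -> e v x ->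
  exists p q, [/\ e u p, e v p, e u q, e v q & nadj p q].
Hypothesis opp_uniq : forall u v p q r, nadj u v ->
  e u p -> e v p -> e u q -> e v q -> e u r -> e v r ->
  nadj p q -> nadj p r -> q = r.
Hypothesis com_trifree : forall u v p q r, nadj u v ->
  e u p -> e v p -> e u q -> e v q -> e u r -> e v r ->
  e p q -> e q r -> e p r -> False.
Hypothesis corner_far : forall a b c d z, sq a b c d -> e z b -> nadj z a -> nadj z c ->
  nadj z d /\ forall t, e z t -> e t d -> False.
Hypothesis corner_adj : forall a b c d z s t, sq a b c d -> nadj z a -> e z s -> e s a ->
  nadj z c -> e z t -> e t c ->
  nadj z b -> (forall t, e z t -> e t b -> False) -> e z d.

Lemma nadjC u v : nadj u v -> nadj v u.
Proof. by case=> h1; rewrite e_sym => h2; split=> // h3; apply: h1. Qed.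

Lemma adj_cases u v : [\/ u = v, e u v | nadj u v].
Proof.
have [->|h] := pselect (u = v); first by constructor 1.
by case h' : (e u v); [constructor 2|constructor 3; rewrite /nadj h'].
Qed.

(** [clash] ends an impossible case of adjacency, [edge] proves an adjacency or a non-adjacency
up to symmetry, [square] proves that a list of four edges and two non-edges is an induced
square, and [nlia] is arithmetic on indices with the graph hypotheses removed. *)
Ltac clash := exfalso; match goal with
 | H : is_true (e ?a ?a) |- _ => by rewrite e_irr in H
 | H : nadj ?a ?a |- _ => by case: H
 | H : ?a <> ?a |- _ => by case: H
 | H : nadj ?a ?b, H' : is_true (e ?a ?b) |- _ => by case: H => _; rewrite H'
 | H : nadj ?a ?b, H' : is_true (e ?b ?a) |- _ => by case: H => _; rewrite e_sym H'
 end.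
Ltac edge := solve [ assumption | (rewrite e_sym; assumption) | (apply: nadjC; assumption) | clash
  | (by move=> ?; subst; clash) ].
Ltac square := solve [split; [edge|edge|edge|edge|split; edge]].

Ltac nlia := repeat match goal with H : is_true (e _ _) |- _ => clear H |
    H : nadj _ _ |- _ => clear H end; lia.

Lemma sq_rot a b c d : sq a b c d -> sq b c d a.
Proof. by case=> ? ? ? ? [? ?]; square. Qed.
Lemma sq_rev a b c d : sq a b c d -> sq a d c b.
Proof. by case=> ? ? ? ? [? ?]; square. Qed.

(** Otherwise q and r would both be opposite to p. *)
Lemma opp_adj u v p q r : nadj u v -> e u p -> e v p -> e u q -> e v q -> e u r -> e v r ->
  nadj p q -> e r p -> e r q.
Proof.
move=> uv up vp uq vq ur vr pq rp; case: (adj_cases r q) => [rq|//|rq]; first by subst; clash.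
by have ? := opp_uniq uv uq vq up vp ur vr (nadjC pq) (nadjC rq); subst; clash.
Qed.

(** The basic alternative of this part: a common neighbour x of u and v either has an opposite
one, or it is the apex of a pyramid over a square through u and v. *)
Lemma opp_or_apex u v x : nadj u v -> e u x -> e v x ->
  (exists y, sq u x v y) \/
  (exists y1 y2, [/\ sq u y1 v y2, e x y1 & e x y2]).
Proof.
move=> uv ux vx; have [p [q [up vp uq vq pq]]] := opp_ex uv ux vx.
case: (adj_cases x p) => [?|xp|xp].
- by subst; left; exists q; square.
- right; exists p, q; split=> //; first by square.
  exact: (opp_adj uv up vp uq vq ux vx pq xp).
- by left; exists p; square.
Qed.

Lemma diamond_free v x y p q : e v x -> e v y -> e v p -> e v q -> e x y ->
  e x p -> e x q -> e y p -> e y q -> nadj p q -> False.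
Proof. by move=> *; apply: (com_trifree (u := p) (v := q) (p := v) (q := x) (r := y)); edge. Qed.

(** The link of v has no claw centred at c: if t closes a square x v y t, then z is adjacent to v
but not to x and y, so z is far from t, although c is a common neighbour of z and t.  If v is the apex
of a pyramid through x and y instead, this applies with other vertices in place of v, c and t. *)
Lemma claw_free v c x y z : e v c -> e v x -> e v y -> e v z -> e c x -> e c y -> e c z ->
  nadj x y -> nadj x z -> nadj y z -> False.
Proof.
have main v' c' t : e v' c' -> e v' x -> e v' y -> e v' z -> e c' x -> e c' y -> e c' z ->
  nadj x y -> nadj x z -> nadj y z -> sq x v' y t -> False.
  move=> vc vx vy vz cx cy cz xy xz yz s.
  have [xv vy' yt tx [xy' vt]] := s.
  have ct : e c' t by apply: (opp_adj (u := x) (v := y) (p := v') (q := t)); edge.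
  have zv : e z v' by edge.
  have zx : nadj z x by edge.
  have zy : nadj z y by edge.
  have [_ /(_ c')] := corner_far s zv zx zy; apply; edge.
move=> vc vx vy vz cx cy cz xy xz yz.
have xv : e x v by edge.
have yv : e y v by edge.
case: (opp_or_apex xy xv yv) => [[t s]|[p [q [[xp py yq qx [_ pq]] vp vq]]]].
  exact: (main v c t).
case: (adj_cases c p) => [?|cp|cp].
- by subst; apply: (main p v q); try edge; square.
- by apply: (com_trifree (u := x) (v := y) (p := v) (q := c) (r := p)); edge.
- by apply: (main c v p); try edge; square.
Qed.

(** The form in which claws are excluded below: z is on the side of x or on that of y. *)
Lemma two_sides v c x y z : e v c -> e v x -> e v y -> e v z -> e c x -> e c y -> e c z ->
  nadj x y -> x <> z -> y <> z -> e z x \/ e z y.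
Proof.
move=> vc vx vy vz cx cy cz xy xz yz.
case: (adj_cases z x) => [?|?|zx]; [by subst|by left|].
case: (adj_cases z y) => [?|?|zy]; [by subst|by right|].
by exfalso; apply: (claw_free vc vx vy vz); edge.
Qed.

(** Squares without an apex.  Around the others, transport is the composition of transports
around triangles. *)
Definition pure_square v x w y := sq v x w y /\ forall z, e z v -> e z x -> e z w -> e z y -> False.

Lemma pure_swap v x w y : pure_square v x w y -> pure_square v y w x.
Proof. by case=> s h; split; [exact: sq_rev|move=> z *; apply: (h z)]. Qed.
Lemma pure_rot v x w y : pure_square v x w y -> pure_square x w y v.
Proof. by case=> s h; split; [exact: sq_rot|move=> z *; apply: (h z)]. Qed.

Lemma pure_common v x w y z : pure_square v x w y -> e v z -> e w z -> z = x \/ z = y.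
Proof.
case=> -[vx xw wy yv [vw xy]] h vz wz.
case: (adj_cases z x) => [?|zx|zx]; [by left| |right].
- exfalso; apply: (h z); try edge.
  by apply: (opp_adj (u := v) (v := w) (p := x) (q := y)); edge.
- by apply: (opp_uniq (u := v) (v := w) (p := x)); edge.
Qed.

(** Pushing the triangle v x q across the square gives the triangle y w w1. *)
Lemma prism v x w y q : pure_square v x w y -> e v q -> e x q -> exists w1, sq x q w1 w /\ e y w1.
Proof.
move=> P vq xq; have [[vx xw wy yv [vw xy]] h] := P.
have qw : nadj q w.
  by case: (adj_cases q w) => [?|qw|//]; [subst; clash|have [?|?] : q = x \/
      q = y by [apply: (pure_common P); edge|]; subst; clash].
have qx : e q x by edge.
have wx : e w x by edge.
have qy : nadj q y.
  by case: (adj_cases q y) => [?|qy|//]; [subst; clash|have [?|?] : q = w \/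
      q = v by [apply: (pure_common (pure_rot P)); edge|]; subst; clash].
case: (opp_or_apex qw qx wx) => [[w1 [_ _ ww1 w1q [_ xw1]]]|
    [r1 [r2 [[qr1 r1w wr2 r2q [_ r12]] xr1 xr2]]]].
  have s : sq x q w1 w by square.
  exists w1; split=> //.
  case: (adj_cases y w1) => [?|//|yw1]; first by subst; clash.
  have yw : e y w by edge.
  have s2 : sq x w w1 q by square.
  by have [_ /(_ v)] := corner_far s2 yw (nadjC xy) yw1; case; edge.
have nv r : e r w -> e r x -> e r q -> v <> r -> e v r -> False.
  by move=> ? ? ? ? ?; have [?|?] : r = x \/ r = y by [apply: (pure_common P); edge|]; subst; clash.
exfalso; have [] : e v r1 \/ e v r2.
  by apply: (two_sides (v := x) (c := q)); edge.
- by apply: nv; edge.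
- by apply: nv; edge.
Qed.

(** Pushing the triangle x w u across the square gives the triangle v y t. *)
Lemma near_square v x w y u : pure_square v x w y -> e w u -> e x u ->
  exists t, sq y w u t /\ sq v x u t.
Proof.
move=> P wu xu; have [[vx xw wy yv [vw xy]] h] := P.
have vu : nadj v u.
  by case: (adj_cases v u) => [?|vu|//]; [subst; clash|have [?|?] : u = x \/
      u = y by [apply: (pure_common P); edge|]; subst; clash].
have yu : nadj y u.
  by case: (adj_cases y u) => [?|yu|//]; [subst; clash|have [?|?] : u = w \/
      u = v by [apply: (pure_common (pure_rot P)); edge|]; subst; clash].
have yw : e y w by edge.
have uw : e u w by edge.
case: (opp_or_apex yu yw uw) => [[t s]|[r1 [r2 [[yr1 r1u ur2 r2y [_ r12]] wr1 wr2]]]].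
  exists t; split=> //; have [_ _ ut ty [_ wt]] := s.
  have tv : e t v.
    case: (adj_cases v t) => [?|?|vt]; [by subst; clash|by edge|].
    have s2 : sq w y t u by square.
    have vy : e v y by edge.
    by have [_ /(_ x)] := corner_far s2 vy vw vt; case; edge.
  suff xt : nadj x t by square.
  case: (adj_cases x t) => [?|xt|//]; first by subst; clash.
  by have [?|?] : t = w \/ t = v by [apply: (pure_common (pure_rot P)); edge|]; subst; clash.
have nx r : e r y -> e r w -> e x r -> False.
  by move=> ? ? ?; have [?|?] : r = w \/ r = v by [apply: (pure_common (pure_rot P)); edge|]; subst;
      clash.
exfalso; have [] : e x r1 \/ e x r2.
  by apply: (two_sides (v := w) (c := u)); edge.
- by apply: nx; edge.
- by apply: nx; edge.
Qed.

(** For a common neighbour w of x and u: it is the apex of a pyramid. *)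
Definition apex_of w x u := exists t1 t2, [/\ sq x t1 u t2, e w t1 & e w t2].

(** What local positioning says around a square x w u s that meets the given one in the edge
x w only. *)
Lemma opp_far v x w y u s : pure_square v x w y -> e w u -> nadj x u -> nadj y u -> sq x w u s ->
  [/\ nadj v u, forall t, e v t -> e t u -> False,
      nadj y s, forall t, e y t -> e t s -> False & nadj v s].
Proof.
move=> P wu xu yu s0; have [[vx xw wy yv [vw xy]] h] := P.
have [_ _ us sx [_ ws]] := s0.
have yw : e y w by edge.
have vu : nadj v u.
  by case: (adj_cases v u) => [?|vu|//]; [subst; clash|have [?|?] : u = x \/
      u = y by [apply: (pure_common P); edge|]; subst; clash].
have [ys ys'] := corner_far s0 yw (nadjC xy) yu.
have vs : nadj v s.
  case: (adj_cases v s) => [?|vs|//]; first by subst; clash.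
  by exfalso; apply: (ys' v); edge.
have s2 : sq w x s u by square.
have [_ vu'] := corner_far s2 vx vw vs.
by [].
Qed.

(** Pushing the triangles v x q1 and v x q2 of a pyramid at x across the square v x w y gives a
pyramid at w, through y and u. *)
Lemma apex_transfer v x w y u s q1 q2 : pure_square v x w y -> e w u -> nadj x u -> nadj y u ->
  sq x w u s -> sq v q1 s q2 -> e x q1 -> e x q2 -> apex_of w y u.
Proof.
move=> P wu xu yu s0 sv xq1 xq2; have [[vx xw wy yv [vw xy]] h] := P.
have [_ _ us sx [_ ws]] := s0.
have [vu vu' ys ys' vs] := opp_far P wu xu yu s0.
have [vq1 q1s sq2 q2v [_ q12]] := sv.
have step q : e v q -> e q s -> e x q -> exists w1, [/\ sq x q w1 w, e y w1 & e u w1].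
  move=> vq qs xq; have [w1 [s1 yw1]] := prism P vq xq.
  exists w1; split=> //; have [_ qw1 w1w _ [xw1 qw]] := s1.
  have uq : nadj u q.
    case: (adj_cases u q) => [?|uq|//]; first by subst; clash.
    by exfalso; apply: (vu' q); edge.
  have uw : e u w by edge.
  case: (adj_cases u w1) => [?|//|uw1]; first by subst; clash.
  by have [_ /(_ s)] := corner_far (sq_rev s1) uw (nadjC xu) uw1; case; edge.
have vq2 : e v q2 by edge.
have [w1 [s1 yw1 uw1]] := step q1 vq1 q1s xq1.
have [w2 [s2 yw2 uw2]] := step q2 vq2 (ltac:(edge) : e q2 s) xq2.
have [_ q1w1 w1w _ [xw1 q1w]] := s1; have [_ q2w2 w2w _ [xw2 q2w]] := s2.
exists w1, w2; split; [|edge|edge].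
suff w12 : nadj w1 w2 by square.
case: (adj_cases w1 w2) => [?|w12|//].
- subst w2; have vw1 : e v w1.
    by apply: (opp_adj (u := q1) (v := q2) (p := x) (q := w1)); edge.
  have [?|?] : w1 = x \/ w1 = y by apply: (pure_common P); edge.
  + by subst; clash.
  + by subst; clash.
- by exfalso; apply: (com_trifree (u := y) (v := u) (p := w) (q := w1) (r := w2)); edge.
Qed.

(** The neighbours u of w that see neither x nor y.  Apart from apices, the three squares at w
given by v, x, y and u complete to a cube, in which q is opposite to w. *)
Lemma cube v x w y u : pure_square v x w y -> e w u -> nadj x u -> nadj y u ->
  [\/ apex_of w x u, apex_of w y u |
    exists s s' q, [/\ sq x w u s, sq y w u s', sq v x s q & sq v y s' q]].
Proof.
move=> P wu xu yu; have [[vx xw wy yv [vw xy]] h] := P.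
have uw : e u w by edge.
have vy : e v y by edge.
have yw : e y w by edge.
have P' := pure_swap P.
have [Ax|nAx] := pselect (apex_of w x u); first by constructor 1.
have [Ay|nAy] := pselect (apex_of w y u); first by constructor 2.
constructor 3.
case: (opp_or_apex xu xw uw) => [[s s0]|[t1 [t2 [? ? ?]]]]; last by exfalso; apply: nAx; exists t1, t2.
case: (opp_or_apex yu yw uw) => [[s' s0']|[t1 [t2 [? ? ?]]]]; last by exfalso; apply: nAy; exists t1, t2.
have [vu vu' ys ys' vs] := opp_far P wu xu yu s0.
have [_ _ xs xs' vs'] := opp_far P' wu yu xu s0'.
have [_ _ us sx [_ ws]] := s0; have [_ _ us' s'y [_ ws']] := s0'.
case: (opp_or_apex vs vx sx) => [[q s1]|[q1 [q2 [s1 xq1 xq2]]]]; last first.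
  by exfalso; apply: nAy; apply: (apex_transfer P wu xu yu s0 s1).
case: (opp_or_apex vs' vy s'y) => [[q' s1']|[q1 [q2 [s1' yq1 yq2]]]]; last first.
  by exfalso; apply: nAx; apply: (apex_transfer P' wu yu xu s0' s1').
exists s, s', q; split=> //.
(* q and q' complete the squares v x s and v y s': they are the same vertex *)
suff -> : q = q' by [].
have [_ _ sq' qv [_ xq]] := s1; have [_ _ sq1' qv' [_ yq']] := s1'.
have qs : e q s by edge.
have yq : nadj y q.
  case: (adj_cases y q) => [?|yq|//]; first by subst; clash.
  by exfalso; apply: (ys' q); edge.
have [qw0 qw] : nadj q w /\ forall t, e q t -> e t w -> False.
  have s2 : sq x v y w by square.
  by apply: (corner_far s2); edge.
have qu : nadj q u.
  case: (adj_cases q u) => [?|qu|//]; first by subst; clash.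
  by exfalso; apply: (vu' q); edge.
case: (opp_or_apex qu qs us) => [[m sm]|[m1 [m2 [sm sm1 sm2]]]].
  have [_ _ um mq [_ sm']] := sm.
  have ym : e y m.
    by apply: (corner_adj (a := q) (b := s) (c := u) (d := m) (z := y) (s := v) (t := w)); edge.
  have mw : nadj w m.
    case: (adj_cases w m) => [?|wm|//]; first by subst; clash.
    by exfalso; apply: (qw m); edge.
  have ? : m = s' by apply: (opp_uniq (u := y) (v := u) (p := w)); edge.
  subst m.
  by apply: (opp_uniq (u := v) (v := s') (p := y)); edge.
have [qm1 m1u um2 m2q [_ m12]] := sm.
(* s would be an apex over a square through q and u; then w is one through x and u *)
have key m m' : sq q m u m' -> e s m -> e s m' ->
    exists k, [/\ e s k, e x k, e u k & e m k].
  move=> smm' sm' smm''; have [qm mu um' m'q [_ mm']] := smm'.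
  have xm : nadj x m.
    case: (adj_cases x m) => [?|xm|//]; first by subst; clash.
    by have [_ /(_ s)] := corner_far smm' xm xq xu; case; edge.
  have xs0 : e x s by edge.
  have ms : e m s by edge.
  case: (opp_or_apex xm xs0 ms) => [[z [_ _ mz zx [_ sz]]]|
      [k1 [k2 [[xk1 k1m mk2 k2x [_ k12]] sk1 sk2]]]].
    exfalso; have sz' : sq s x z m by square.
    have wm : nadj w m.
      case: (adj_cases w m) => [?|wm|//]; first by subst; clash.
      by exfalso; apply: (qw m); edge.
    have wx : e w x by edge.
    have wz : e w z.
      case: (adj_cases w z) => [?|//|wz]; first by subst; clash.
      by have [_ /(_ u)] := corner_far sz' wx ws wz; case; edge.
    have vz : nadj v z.
      case: (adj_cases v z) => [?|vz|//]; first by subst; clash.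
      by have [?|?] : z = x \/ z = y by [apply: (pure_common P); edge|]; subst; clash.
    by have [_ /(_ q)] := corner_far sz' vx vs vz; case; edge.
  have [] : e u k1 \/ e u k2.
    by apply: (two_sides (v := s) (c := m)); edge.
  - by move=> uk; exists k1; split; edge.
  - by move=> uk; exists k2; split; edge.
have [k1 [sk1 xk1 uk1 mk1]] := key m1 m2 sm sm1 sm2.
have [k2 [sk2 xk2 uk2 mk2]] := key m2 m1 (sq_rev sm) sm2 sm1.
exfalso; apply: nAx; exists k1, k2.
have k12 : nadj k1 k2.
  case: (adj_cases k1 k2) => [?|k12|//].
  - subst k2.
    by exfalso; apply: (com_trifree (u := m1) (v := m2) (p := s) (q := u) (r := k1)); edge.
  - by exfalso; apply: (com_trifree (u := x) (v := u) (p := s) (q := k1) (r := k2)); edge.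
split; first by square.
- by rewrite e_sym; apply: (opp_adj (u := x) (v := u) (p := s) (q := w)); edge.
- by rewrite e_sym; apply: (opp_adj (u := x) (v := u) (p := s) (q := w)); edge.
Qed.

(** In the next three lemmas two squares on a common edge v x behave as translates of each other:
the corners next to v are equal, adjacent or apart together with those next to x. *)
Lemma parallel_far v x w1 y1 w2 y2 : sq v x w1 y1 -> sq v x w2 y2 -> w1 <> w2 -> nadj w1 y2.
Proof.
move=> [? ? ? ? [? ?]] [? ? ? ? [? ?]] n12.
case: (adj_cases w1 y2) => [?|h|//]; first by subst; clash.
have ? : y1 = y2 by apply: (opp_uniq (u := v) (v := w1) (p := x)); edge.
by subst; case: n12; apply: (opp_uniq (u := x) (v := y2) (p := v)); edge.
Qed.

Lemma parallel_eq v x w y w' y' : sq v x w y -> sq v x w' y' -> y = y' -> w = w'.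
Proof.
move=> [? ? ? ? [? ?]] [? ? ? ? [? ?]] ?; subst y'.
by apply: (opp_uniq (u := x) (v := y) (p := v)); edge.
Qed.

Lemma parallel_adj v x w y w' y' : sq v x w y -> sq v x w' y' -> e w w' = e y y'.
Proof.
move=> s s'; have [vx xw wy yv [vw xy]] := s; have [_ xw' wy' y'v [vw' xy']] := s'.
apply/idP/idP => h.
- have ww' : w <> w' by edge.
  have := parallel_far s s' ww'; have := parallel_far s' s (nesym ww').
  case: (adj_cases y y') => [/(parallel_eq s s') //|//|yy].
  have s2 : sq x v y' w' by square.
  by exfalso; have [_ /(_ w)] := corner_far s2 yv (nadjC xy) yy; apply; edge.
- case: (adj_cases w w') => [?|//|ww'].
    have ? : y = y' by subst w'; apply: (opp_uniq (u := v) (v := w) (p := x)); edge.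
    by subst; clash.
  have wx : e w x by edge.
  by have [_ /(_ y)] := corner_far s' wx (nadjC vw) ww'; case; edge.
Qed.

(** * Sides: the maximal cliques of a link *)

(** Since the link of v has no diamond, each edge x y of it is in just one maximal clique, made
of x, y and their common neighbours in the link. *)
Definition side v x y : V -> Prop := fun z => [/\ e v z, z = x \/ e z x & z = y \/ e z y].
Definition is_side v (k : V -> Prop) :=
  exists x y, [/\ e v x, e v y, e x y & k = side v x y].
Definition side_adj v k k' :=
  [/\ is_side v k, is_side v k', k <> k' & exists z, k z /\ k' z].

Lemma side_adj_sym v k k' : side_adj v k k' -> side_adj v k' k.
Proof. by case=> h1 h2 h3 [z [h4 h5]]; split=> //; [move=> h; apply: h3|exists z]. Qed.

Lemma sideC v x y : side v x y = side v y x.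
Proof. by apply: funext => z; apply: propext; split; case. Qed.

Lemma side_clique v x y z t : e v x -> e v y -> e x y -> side v x y z -> side v x y t ->
  z = t \/ e z t.
Proof.
move=> vx vy xy [vz zx zy] [vt tx ty].
case: (adj_cases z t) => [?|?|zt]; [by left|by right|exfalso].
case: zx => [?|zx]; first by subst; case: tx => ?; subst; clash.
case: zy => [?|zy]; first by subst; case: ty => ?; subst; clash.
case: tx => [?|tx]; first by subst; clash.
case: ty => [?|ty]; first by subst; clash.
by apply: (diamond_free vx vy vz vt xy); edge.
Qed.

Lemma side_base v x y z : e v x -> e v y -> e x y -> side v x y z -> x <> z ->
  side v x y = side v x z.
Proof.
move=> vx vy xy kz xz; have [vz zx zy] := kz.
have {}zx : e x z by case: zx => h; [subst; clash|edge].
have ky : side v x z y by split=> //; [right; edge|case: zy => h; [left|right; edge]].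
apply: funext => t; apply: propext; split=> ht; have [vt tx ty] := ht; split=> //.
- by apply: (side_clique vx vy xy).
- by apply: (side_clique vx vz zx).
Qed.

Lemma side_at v k z : is_side v k -> k z -> exists t, [/\ e v z, e v t, e z t & k = side v z t].
Proof.
move=> [x [y [vx vy xy ->]]] kz; have [vz _ _] := kz.
have [?|xz] := pselect (x = z); first by subst; exists y.
exists x; rewrite (side_base vx vy xy kz xz) sideC; split=> //.
by case: kz => _ [?|?] _; [subst; clash|].
Qed.

Lemma side_eq v k z t : is_side v k -> k z -> k t -> z <> t ->
  [/\ e v z, e v t, e z t & k = side v z t].
Proof.
move=> sk kz kt zt; have [x [vz vx zx kE]] := side_at sk kz.
have [vt _ _] : side v z x t by rewrite -kE.
rewrite kE (side_base vz vx zx _ zt) -?kE //; split=> //.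
by move: kt; rewrite kE => -[_ [?|?] _]; [subst; case: zt|edge].
Qed.

Lemma side_inj v k k' z t : is_side v k -> is_side v k' -> k z -> k t -> k' z -> k' t ->
  z <> t -> k = k'.
Proof.
move=> sk sk' kz kt kz' kt' zt.
by have [_ _ _ ->] := side_eq sk kz kt zt; have [_ _ _ ->] := side_eq sk' kz' kt' zt.
Qed.

Lemma side_refl v x y : e v x -> e v y -> e x y -> side v x y x /\ side v x y y.
Proof. by move=> *; split; split=> //; try (by left); right; edge. Qed.

(** Neighbours of x on three different sides would be the leaves of a claw. *)
Lemma side_two v k1 k2 k x : is_side v k1 -> is_side v k2 -> is_side v k ->
  k1 x -> k2 x -> k x -> k1 <> k2 -> k = k1 \/ k = k2.
Proof.
move=> s1 s2 s h1 h2 h n12.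
have [y1 [vx vy1 xy1 E1]] := side_at s1 h1; have [y2 [_ vy2 xy2 E2]] := side_at s2 h2.
have [y [_ vy xy E]] := side_at s h; subst.
have [] : side v x y1 y \/ side v x y2 y.
  have y12 : nadj y1 y2.
    case: (adj_cases y1 y2) => [?|y12|//]; [by subst|exfalso; apply: n12].
    apply: (side_base vx vy1 xy1); last by move=> ?; subst; clash.
    by split=> //; right; edge.
  have [?|n1] := pselect (y1 = y); first by subst; left; apply: (proj2 (side_refl vx vy xy)).
  have [?|n2] := pselect (y2 = y); first by subst; right; apply: (proj2 (side_refl vx vy xy)).
  have [] : e y y1 \/ e y y2 by apply: (two_sides (v := v) (c := x)); edge.
  - by left; split=> //; right; edge.
  - by right; split=> //; right; edge.
- by left; symmetry; apply: side_base => // ?; subst; clash.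
- by right; symmetry; apply: side_base => // ?; subst; clash.
Qed.

Lemma square_of_nadj v x y : e v x -> e v y -> nadj x y ->
  (forall p q, e v p -> e v q -> e x p -> e y p -> e x q -> e y q -> p = q) ->
  exists w, sq x v y w.
Proof.
move=> vx vy xy h.
case: (opp_or_apex (x := v) xy) => [|||[p [q [[xp py yq qx [_ pq]] vp vq]]]]; try by edge.
  by [].
have ? : p = q by apply: h; edge.
by subst; clash.
Qed.

(** * A shortest odd closed walk of sides *)

(** The sides k 0, ..., k n = k 0 are at v, and n is the least odd length of a closed walk of
sides at any vertex.  The vertices x i where k i meets k (i+1) form an induced cycle in the
link of v. *)
Section ShortestOdd.
Variables (v : V) (n : nat) (k : nat -> V -> Prop).
Hypotheses (n_odd : odd n) (kn : k n = k 0).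
Hypothesis kH : forall i, i < n -> side_adj v (k i) (k i.+1).
Hypothesis k_min : forall u m a, odd m -> m < n -> ~ hwalk (side_adj u) m a a.

Let iso := shortest_odd_isometric (@side_adj_sym v) n_odd kn kH (@k_min v).

Lemma shortest_corners : exists x : nat -> V, forall i, i < n -> k i (x i) /\ k i.+1 (x i).
Proof.
have [|x xP] := @choice nat V (fun i z => i < n -> k i z /\ k i.+1 z); last by exists x.
move=> i; have [ii|ii] := boolP (i < n).
  by have [_ _ _ [z [h1 h2]]] := kH ii; exists z.
by have [_ _ _ [z _]] := kH (odd_gt0 n_odd); exists z.
Qed.

Variable x : nat -> V.
Hypothesis xP : forall i, i < n -> k i (x i) /\ k i.+1 (x i).

Lemma k_side i : i <= n -> is_side v (k i).
Proof.
rewrite leq_eqVlt => /orP[/eqP->|/kH [] //].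
by rewrite kn; have [] := kH (odd_gt0 n_odd).
Qed.

Lemma x_nb i : i < n -> e v (x i).
Proof.
move=> ii; have [h _] := xP ii; have [z [z' [_ _ _ kE]]] := k_side (ltnW ii).
by move: h; rewrite kE => -[].
Qed.

Lemma k_eq i j : i <= j <= n -> k i = k j -> i = j \/ (i = 0 /\ j = n).
Proof.
by move=> ij h; have [] := iso (m := 0) ij h; [left|right]; nlia.
Qed.

(** By minimality the walk is isometric, so two of its sides meet only if they are consecutive. *)
Lemma k_adj i j z : i <= j <= n -> k i z -> k j z ->
  [\/ i = j, j = i.+1, i = 0 /\ n.-1 <= j | i = 1 /\ j = n].
Proof.
move=> ij iz jz; have [h|h] := pselect (k i = k j).
  by case: (k_eq ij h) => ?; [constructor 1|constructor 3; nlia].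
have a : hwalk (side_adj v) 1 (k i) (k j).
  exists (k j); split=> //; split=> //; [| |by exists z]; apply: k_side; nlia.
have [h'|h'] := iso ij a.
  have [?|?] : i = j \/ j = i.+1 by nlia.
    by constructor 1.
  by constructor 2.
have [?|?] : i = 0 /\ n.-1 <= j \/ i = 1 /\ j = n by nlia.
  by constructor 3.
by constructor 4.
Qed.

Lemma x_side s i : i < n -> is_side v s -> s (x i) -> s = k i \/ s = k i.+1.
Proof.
move=> ii ss sx; have [h1 h2] := xP ii; have [s1 s2 n12 _] := kH ii.
exact: (side_two s1 s2 ss h1 h2 sx n12).
Qed.

Lemma n_gt1 : 1 < n.
Proof.
case: n n_odd kn kH => [//|[_|//]] h /(_ 0 isT) [_ _]; by rewrite h.
Qed.

Lemma common_side i j s : i < j < n -> is_side v s -> s (x i) -> s (x j) ->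
  j = i.+1 \/ (i = 0 /\ j = n.-1).
Proof.
move=> /andP[ij jn] ss si sj; have iN := ltn_trans ij jn.
have := n_gt1.
have [E1|E1] := x_side iN ss si; have [E2|E2] := x_side jn ss sj; move: E2; rewrite E1 => E2.
- by have := k_eq (i := i) (j := j) _ E2; nlia.
- by have := k_eq (i := i) (j := j.+1) _ E2; nlia.
- by have := k_eq (i := i.+1) (j := j) _ E2; nlia.
- by have := k_eq (i := i.+1) (j := j.+1) _ E2; nlia.
Qed.

(** Three sides meeting pairwise in three vertices would contain the triangle of these vertices,
which lies on a single side. *)
Lemma n_ge5 : 4 < n.
Proof.
have n1 := n_gt1; have [n3|?] := eqVneq n 3; last by move: n_odd; nlia.
have x0 : 0 < n by nlia.
have x1 : 1 < n by nlia.
have x2 : 2 < n by nlia.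
have kE i j : i < j <= n -> j - i < n -> k i <> k j.
  by move=> ij ji h; have := k_eq (i := i) (j := j) _ h; nlia.
have [a0 a1] := xP x0; have [b1 b2] := xP x1; have [c2 c3] := xP x2.
have n01 : x 0 <> x 1.
  move=> h; rewrite -h in b1 b2.
  have [] := x_side x0 (k_side x1) b2; [move/esym|move/esym]; apply: kE; nlia.
have [_ va1 ab E1] : [/\ True, e v (x 1), e (x 0) (x 1) & k 1 = side v (x 0) (x 1)].
  by have [] := side_eq (k_side x0) a1 b1 n01.
have k30 : k 3 = k 0 by rewrite -n3.
have c0 : k 0 (x 2) by rewrite -k30.
have : k 1 (x 2).
  rewrite E1; split; first exact: x_nb.
  - have [?|h] := pselect (x 2 = x 0); first by left.
    by right; have [_ _ ? _] := side_eq (k_side (leq0n n)) c0 a0 h.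
  - have [?|h] := pselect (x 2 = x 1); first by left.
    by right; have [_ _ ? _] := side_eq (k_side x1) c2 b2 h.
move/(x_side x2 (k_side x0)) => [] h.
- by case: (kE 1 2 ltac:(nlia) ltac:(nlia) h).
- by rewrite k30 in h; case: (kE 0 1 ltac:(nlia) ltac:(nlia) (esym h)).
Qed.

Lemma x_neq i j : i < j < n -> x i <> x j.
Proof.
move=> ij h; have n5 := n_ge5; have [ii jj] : i < n /\ j < n by nlia.
have [i1 i2] := xP ii; have [j1 j2] := xP jj.
rewrite -h in j1 j2.
have [e1|e1] := x_side ii (k_side jj) j2.
  by have := k_eq (i := i) (j := j.+1) _ (esym e1); have := x_side ii (k_side (ltnW jj)) j1; case=> e2;
    [have := k_eq (i := i) (j := j) _ (esym e2)|have := k_eq (i := i.+1) (j := j) _ (esym e2)]; nlia.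
by have := k_eq (i := i.+1) (j := j.+1) _ (esym e1); nlia.
Qed.

Lemma x_adj i j : i < j < n -> e (x i) (x j) -> j = i.+1 \/ (i = 0 /\ j = n.-1).
Proof.
move=> ij xx; have [ii jj] : i < n /\ j < n by nlia.
have [h1 h2] := side_refl (x_nb ii) (x_nb jj) xx.
apply: common_side h1 h2 => //.
by exists (x i), (x j); split=> //; exact: x_nb.
Qed.

Lemma x_nadj i j : i < j < n -> j <> i.+1 -> ~ (i = 0 /\ j = n.-1) -> nadj (x i) (x j).
Proof.
move=> ij h1 h2; split; first exact: x_neq.
by apply/negP => /(x_adj ij) [].
Qed.

Lemma x_next i : i.+1 < n -> e (x i) (x i.+1).
Proof.
move=> ii; have [_ h] := xP (ltnW ii); have [h' _] := xP ii.
have xx : x i <> x i.+1 by apply: x_neq; nlia.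
by have [] := side_eq (k_side (ltnW ii)) h h' xx.
Qed.

Lemma x_last : e (x n.-1) (x 0).
Proof.
have n5 := n_ge5; have l : n.-1 < n by nlia.
have [_ h] := xP l; have [h' _] := xP (odd_gt0 n_odd).
have xx : x n.-1 <> x 0 by apply: nesym; apply: x_neq; nlia.
by move: h; rewrite prednK ?kn; [move=> h; have [] := side_eq (k_side (leq0n n)) h h' xx|nlia].
Qed.

(** Two vertices of the cycle have at most one common neighbour in the link of v, hence v is not
the apex of a pyramid through them. *)
Lemma x_square i j : i < j < n -> nadj (x i) (x j) -> exists w, sq (x i) v (x j) w.
Proof.
move=> ij xx; have [ii jj] : i < n /\ j < n by nlia.
have n5 := n_ge5.
have ji1 : j <> i.+1 by move=> ?; subst j; have [_] := xx; rewrite x_next.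
have jn1 : ~ (i = 0 /\ j = n.-1) by case=> ? ?; subst; have [_] := xx; rewrite e_sym x_last.
apply: square_of_nadj (x_nb ii) (x_nb jj) xx _.
have main p : e v p -> e (x i) p -> e (x j) p ->
    (j = i.+2 /\ p = x i.+1) \/ (j - i = n.-2 /\ (i = 0 /\ p = x n.-1 \/ i = 1 /\ p = x 0)).
  move=> vp ip jp.
  have [hi hip] := side_refl (x_nb ii) vp ip; have [hj hjp] := side_refl (x_nb jj) vp jp.
  have si : is_side v (side v (x i) p) by exists (x i), p; split=> //; exact: x_nb.
  have sj : is_side v (side v (x j) p) by exists (x j), p; split=> //; exact: x_nb.
  have uniq a b q : a < b <= n -> b - a < n -> k a p -> k b p -> k a q -> k b q -> p = q.
    move=> ab ba ap bp aq bq; have [//|pq] := pselect (p = q).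
    have := side_inj (k_side _) (k_side _) ap aq bp bq pq.
    by move=> h; have := k_eq (i := a) (j := b) _ (h _ _); nlia.
  have [Ei|Ei] := x_side ii si hi; have [Ej|Ej] := x_side jj sj hj;
    rewrite Ei in hip; rewrite Ej in hjp.
  - by case: (k_adj (i := i) (j := j) _ hip hjp); nlia.
  - have jn : j.+1 <= n by [].
    have [] : i = 0 /\ j = n.-2 \/ i = 1 /\ j = n.-1.
      by case: (k_adj (i := i) (j := j.+1) _ hip hjp); nlia.
    + case=> i0 jE; right; split; [nlia|left; split=> //].
      subst i; apply: (uniq 0 j.+1) => //; try nlia.
      * by have [_] := xP (ltac:(nlia) : n.-1 < n); rewrite prednK ?kn //; nlia.
      * by rewrite (_ : j.+1 = n.-1); [have [] := xP (ltac:(nlia) : n.-1 < n)|nlia].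
    + case=> i1 jE; right; split; [nlia|right; split=> //].
      have x0 := xP (odd_gt0 n_odd).
      subst i; apply: (uniq 1 j.+1) => //; try nlia; try by case: x0.
      by rewrite (_ : j.+1 = n) ?kn; [case: x0|nlia].
  - have [] : j = i.+2 \/ i = 0 /\ j = n.-1 by case: (k_adj (i := i.+1) (j := j) _ hip hjp); nlia.
      move=> jE; left; split=> //; subst j.
      have [h1 h2] := xP (ltac:(nlia) : i.+1 < n).
      by apply: (uniq i.+1 i.+2) => //; nlia.
    by [].
  - by case: (k_adj (i := i.+1) (j := j.+1) _ hip hjp); nlia.
by move=> p q vp vq ip jp iq jq; case: (main p vp ip jp) => [[? ->]|[? h]];
  case: (main q vq iq jq) => [[? ->]|[? h']] //; [nlia|nlia|];
  case: h => -[? ->]; case: h' => -[? ->] //; nlia.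
Qed.

(** Move to the neighbour x 0 of v.  For 1 < j < n - 1 let w j be opposite to v in a square
through x 0 and x j, and let y be opposite to v in a square through x 1 and x (n-1).  The w j
form a path, parallel to that of the x j.  Its ends w 2 and w (n-2) are adjacent to y, and
the other w j are not.  If n = 5, then y, w 2, w 3 and x 1 make a diamond in the link of x 0.
Otherwise y and the w j are an induced cycle of length n - 2 in this link, and its edges are
on the sides of a closed walk of that length. *)
Lemma shortest_odd_false : False.
Proof.
have n5 := n_ge5.
have [l0 l1] : 0 < n /\ 1 < n by nlia.
have ll : n.-1 < n by nlia.
have [y sy] : exists y, sq (x 1) v (x n.-1) y.
  by apply: x_square; [nlia|apply: x_nadj; nlia].
have [w wP] : exists w : nat -> V, forall j, 1 < j < n.-1 -> sq (x 0) v (x j) (w j).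
  have [|w wP] := @choice nat V (fun j z => 1 < j < n.-1 -> sq (x 0) v (x j) z); last by exists w.
  move=> j; have [jj|jj] := boolP (1 < j < n.-1); last by exists v.
  by have [z zP] : exists w, sq (x 0) v (x j) w by [apply: x_square; [nlia|apply: x_nadj; nlia]|];
      exists z.
have vx i : i < n -> e v (x i) by exact: x_nb.
have v0 := vx _ l0; have v1 := vx _ l1; have vl := vx _ ll.
have x01 : e (x 0) (x 1) by exact: x_next.
have xl0 := x_last.
have [_ _ xly yx1 [x1l vy]] := sy.
have x0y : e (x 0) y by apply: (opp_adj (u := x 1) (v := x n.-1) (p := v) (q := y)); edge.
have wS j : 1 < j < n.-1 -> sq v (x 0) (w j) (x j).
  by move=> /wP s; exact: sq_rot (sq_rot (sq_rot (sq_rev s))).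
have ww i j : 1 < i < n.-1 -> 1 < j < n.-1 -> e (w i) (w j) = e (x i) (x j).
  by move=> hi hj; apply: parallel_adj (wS _ hi) (wS _ hj).
have wn i j : 1 < i < n.-1 -> 1 < j < n.-1 -> w i = w j -> x i = x j.
  move=> hi hj h; apply: (parallel_eq (v := x 0) (x := v)) h.
  - exact: wP.
  - exact: wP.
have xw j i : 1 < j < n.-1 -> i < n -> e (x i) (x 0) -> e (x i) (w j) -> x i = x j \/ e (x i) (x j).
  move=> hj hi xi0 xiw; have [a b c d [f h]] := wS _ hj.
  have [?|ij] := pselect (x i = x j); first by left.
  right; apply: (opp_adj (u := v) (v := w j) (p := x 0) (q := x j)); try edge.
  exact: vx.
have yx j : 1 < j < n.-1 -> nadj y (x j).
  move=> hj; have jn : j < n by nlia.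
  have vj := vx _ jn.
  have n1 : x 1 <> x j by apply: x_neq; nlia.
  have nl : x j <> x n.-1 by apply: x_neq; nlia.
  case: (adj_cases y (x j)) => [?|yj|//]; first by subst; clash.
  have [j1|j1] := boolP (j == 2).
    have jl : nadj (x j) (x n.-1) by apply: x_nadj; nlia.
    have : e (x j) (x n.-1).
      apply: (opp_adj (u := v) (v := y) (p := x 1) (q := x n.-1)); try edge.
      by rewrite e_sym (eqP j1); apply: x_next; nlia.
    by move=> h; clash.
  have xj1 : nadj (x 1) (x j) by apply: x_nadj; nlia.
  by have := opp_uniq (u := v) (v := y) (p := x 1) (q := x n.-1) (r := x j); move=> h; case: nl;
      rewrite h //; edge.
have yw1 j i : 1 < j < n.-1 -> i < n -> e (x i) y -> e (x i) (x 0) -> e (x i) (x j) -> e y (w j).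
  move=> hj hi xiy xi0 xij; have s := wS _ hj; have [a b c d [f h]] := s.
  have yj := yx _ hj.
  case: (adj_cases y (w j)) => [?|//|yw]; first by subst; clash.
  have s2 : sq v (x 0) (w j) (x j) by [].
  have y0 : e y (x 0) by edge.
  by exfalso; have [_ /(_ (x i))] := corner_far s2 y0 (nadjC vy) yw; apply; edge.
have x0w j : 1 < j < n.-1 -> e (x 0) (w j) by move=> /wS [].
have x0l : e (x 0) (x n.-1) by edge.
have y2 : e y (w 2).
  by apply: (yw1 2 1) => //; [nlia|edge|edge|apply: x_next; nlia].
have yl : e y (w n.-2).
  apply: (yw1 n.-2 n.-1) => //; [nlia|].
  by rewrite e_sym (_ : n.-1 = n.-2.+1); [apply: x_next; nlia|nlia].
have yw j : 2 < j < n.-2 -> nadj y (w j).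
  move=> hj; have hj' : 1 < j < n.-1 by nlia.
  have [a b c d [f h]] := wS _ hj'; have jn : j < n by nlia.
  have yj := yx _ hj'.
  case: (adj_cases y (w j)) => [?|yw|//]; first by subst; clash.
  have x1w : x 1 <> w j by move=> hh; have [_] := f; rewrite -hh v1.
  have xlw : x n.-1 <> w j by move=> hh; have [_] := f; rewrite -hh vl.
  have [] : e (w j) (x 1) \/ e (w j) (x n.-1).
    by apply: (two_sides (v := x 0) (c := y)); edge.
  - move=> h1; have [||h2|] := xw j 1 hj' l1; [edge|edge|by have := x_neq (i := 1) (j := j) _ h2; nlia|].
    by move/(x_adj (ltac:(nlia) : 1 < j < n)); nlia.
  - move=> h1; have [||h2|] := xw j n.-1 hj' ll; [edge|edge|
      by have := x_neq (i := j) (j := n.-1) _ (esym h2); nlia|].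
    by rewrite e_sym; move/(x_adj (ltac:(nlia) : j < n.-1 < n)); nlia.
(* for n = 5 the cycle of y and the w j is a triangle, excluded by a diamond *)
have [n5'|n5'] := eqVneq n 5.
  have h2 : 1 < 2 < n.-1 by nlia.
  have h3 : 1 < 3 < n.-1 by nlia.
  have l2 : 2 < n by nlia.
  have l3 : 3 < n by nlia.
  have [_ _ _ _ [vw2 _]] := wS _ h2; have [_ _ _ _ [vw3 _]] := wS _ h3.
  have w23 : e (w 2) (w 3) by rewrite ww //; apply: x_next.
  have yw3 : e y (w 3) by move: yl; rewrite n5'.
  have x1w3 : nadj (x 1) (w 3).
    case: (adj_cases (x 1) (w 3)) => [hh|h|//]; first by have [_] := vw3; rewrite -hh v1.
    have [||h1|/(x_adj (ltac:(nlia) : 1 < 3 < n))] := xw 3 1 h3 l1; [edge|edge| |nlia].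
    by have := x_neq (i := 1) (j := 3) _ h1; nlia.
  have x1w2 : e (x 1) (w 2).
    have [a b c d [f h]] := wS _ h2.
    have x12 : e (x 1) (x 2) by apply: x_next; nlia.
    by apply: (opp_adj (u := x 0) (v := x 2) (p := v) (q := w 2)); edge.
  have a2 := x0w 2 h2; have a3 := x0w 3 h3.
  by apply: (diamond_free (v := x 0) (x := y) (y := w 2) (p := x 1) (q := w 3)); edge.
(* the closed cycle y, w 2, ..., w (n-2), continued by two steps past its end *)
pose c i := if i is 0 then y else w i.+1.
pose c' i := if i < n.-2 then c i else c (i - n.-2).
have cw i : 0 < i -> c i = w i.+1 by case: i.
have c'1 i : i < n.-2 -> c' i = c i by rewrite /c' => ->.
have c'2 i : i < n.-2 -> c' (i + n.-2) = c i.
  by move=> ii; rewrite /c' ltnNge leq_addl /= addnK.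
have x0c i : i < n -> e (x 0) (c' i).
  move=> ii; rewrite /c'; case: ifP => h.
    by case: i ii h => [|i] ii h //=; apply: x0w; nlia.
  have [->|->] : i - n.-2 = 0 \/ i - n.-2 = 1 by nlia.
    by [].
  by apply: x0w; nlia.
have cadj i : i < n.-2 -> e (c' i) (c' i.+1).
  move=> ii; rewrite c'1 //; have [i0|i0] := posnP i.
    by subst i; rewrite c'1 //; nlia.
  have [il|il] := eqVneq i (n - 3).
    rewrite (_ : i.+1 = 0 + n.-2); last by nlia.
    by rewrite c'2 /=; [rewrite cw // (_ : i.+1 = n.-2); [rewrite e_sym|nlia]|nlia].
  rewrite c'1; last by nlia.
  by rewrite !cw // ww; [apply: x_next|..]; nlia.
have cnadj i : i < n.-2 -> nadj (c' i) (c' i.+2).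
  move=> ii; rewrite c'1 //; have [i0|i0] := posnP i.
    by subst i; rewrite c'1 /=; [apply: yw|]; nlia.
  have wna a b : 1 < a -> a.+1 < b < n.-1 -> nadj (w a) (w b).
    move=> h1 h2; split.
      by move/wn => h; apply: (@x_neq a b); [nlia|apply: h; nlia].
    rewrite ww; [|nlia|nlia]; apply/negP => /x_adj; nlia.
  have [il|il] := eqVneq i (n - 3).
    rewrite (_ : i.+2 = 1 + n.-2); last by nlia.
    rewrite c'2; last by nlia.
    by rewrite !cw //; apply: nadjC; apply: wna; nlia.
  have [il'|il'] := eqVneq i (n - 4).
    rewrite (_ : i.+2 = 0 + n.-2); last by nlia.
    rewrite c'2; last by nlia.
    by rewrite cw //; apply: nadjC; apply: yw; nlia.
  rewrite c'1; last by nlia.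
  by rewrite !cw //; apply: wna; nlia.
pose s i := side (x 0) (c' i) (c' i.+1).
apply: (@k_min (x 0) n.-2 (s 0)); [move: n_odd; nlia|nlia|].
have e1 : c' n.-2 = c' 0.
  by rewrite -{1}[n.-2]add0n c'2 ?c'1 //; nlia.
have e2 : c' n.-2.+1 = c' 1.
  by rewrite -add1n c'2 ?c'1 //; nlia.
have sE : s n.-2 = s 0 by rewrite /s e1 e2.
rewrite -{2}sE -[n.-2]add0n; apply: seq_hwalk => i /andP[_ ii].
have i1 : i < n by nlia.
have i2 : i.+1 < n by nlia.
have [a b] : e (c' i) (c' i.+1) /\ e (c' i.+1) (c' i.+2).
  split; first by apply: cadj; nlia.
  have [h|h] := eqVneq i.+1 n.-2; last by apply: cadj; nlia.
  by rewrite h e1 e2; apply: cadj; nlia.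
have ac : nadj (c' i) (c' i.+2) by apply: cnadj; nlia.
have x0i := x0c _ i1; have x0i1 := x0c _ i2.
have x0i2 : e (x 0) (c' i.+2).
  have [h|h] := ltnP i.+2 n; first exact: x0c.
  by exfalso; nlia.
split.
- by exists (c' i), (c' i.+1).
- by exists (c' i.+1), (c' i.+2).
- move=> h; have [h1 _] := side_refl x0i x0i1 a; have [_ h2] := side_refl x0i1 x0i2 b.
  rewrite -/(s i.+1) -h in h2; case: ac => n1 n2.
  by case: (side_clique x0i x0i1 a h1 h2) => [/n1 //|hh]; rewrite hh in n2.
- exists (c' i.+1); split; first by have [_] := side_refl x0i x0i1 a.
  by have [] := side_refl x0i1 x0i2 b.
Qed.
End ShortestOdd.

Lemma no_odd_side_walk v n k : odd n -> ~ hwalk (side_adj v) n k k.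
Proof.
move=> on h; pose P m := `[< odd m /\ exists u a, hwalk (side_adj u) m a a >].
have exP : exists m, P m by exists n; apply/asboolP; split=> //; exists v, k.
case: (ex_minnP exP) => m /asboolP[om [u [a ha]]] mmin.
have [s [s0 sm sH]] := hwalk_seq ha.
have kmin u' m' a' : odd m' -> m' < m -> ~ hwalk (side_adj u') m' a' a'.
  move=> om' lt h'; have /mmin : P m' by apply/asboolP; split=> //; exists u', a'.
  by rewrite leqNgt lt.
have smE : s m = s 0 by rewrite s0 sm.
have [x xP] := shortest_corners om sH.
exact: (shortest_odd_false om smE sH kmin xP).
Qed.

(** * Labellings of stars and how they are carried along edges *)
Section Labels.
Variable I : finType.
Implicit Types lam mu : V -> {set I}.

Definition in_star v x := x = v \/ e v x.

(** Equal sizes ensure that adjacent vertices differ by an exchange of one element, rather than by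
two insertions or two removals. *)
Definition star_labelling v lam := forall x y, in_star v x -> in_star v y ->
  [/\ e x y = adj2 (lam x) (lam y), lam x = lam y -> x = y & #|lam x| = #|lam y|].

Lemma labelling_adj v lam x y : star_labelling v lam -> in_star v x -> in_star v y ->
    e x y = adj2 (lam x) (lam y).
Proof. by move=> gv vx vy; case: (gv x y vx vy). Qed.
Lemma labelling_inj v lam x y : star_labelling v lam -> in_star v x -> in_star v y -> lam x = lam y ->
    x = y.
Proof. by move=> gv vx vy; case: (gv x y vx vy). Qed.

Lemma labelling_far v lam x y : star_labelling v lam -> in_star v x -> in_star v y -> nadj x y ->
  #|symd (lam x) (lam y)| = 4.
Proof.
move=> gv vx vy xy.
have vv : in_star v v by left.
have vx' : e v x by case: vx => // ?; subst; case: vy => ?; subst; clash.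
have vy' : e v y by case: vy => // ?; subst; clash.
apply: (@adj2_far _ _ (lam v)).
- by rewrite -(labelling_adj gv vx vv); edge.
- by rewrite -(labelling_adj gv vv vy); edge.
- by move/(labelling_inj gv vx vy) => ?; subst; clash.
- by rewrite -(labelling_adj gv vx vy); case: xy.
Qed.

Lemma labelling_sq v lam p z q z' : star_labelling v lam -> sq p z q z' ->
  in_star v p -> in_star v q -> in_star v z -> in_star v z' ->
  symd (lam p) (lam q) = symd (lam z) (lam z').
Proof.
move=> gv [pz zq qz' z'p [pq zz']] vp vq vz vz'.
apply: far_square; rewrite -?(labelling_adj gv) //.
- exact: labelling_far gv vp vq pq.
- by move/(labelling_inj gv vz vz') => ?; subst; clash.
- by case: zz'.
Qed.

(** Extension to the vertices at distance 2 by the parallelogram rule.  The square that is chosen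
does not matter (extend_sq). *)
Definition extend v lam u : {set I} :=
  if `[< in_star v u >] then lam u else
  match pselect (exists pq : V * V, sq v pq.1 u pq.2) with
  | left h => let pq := sval (cid h) in symd (lam v) (symd (lam pq.1) (lam pq.2))
  | right _ => set0
  end.

Lemma extend_in v lam u : in_star v u -> extend v lam u = lam u.
Proof. by rewrite /extend => h; case: asboolP. Qed.
Lemma extend_id v lam : extend v lam v = lam v.
Proof. by apply: extend_in; left. Qed.
Lemma extend_nb v lam u : e v u -> extend v lam u = lam u.
Proof. by move=> h; apply: extend_in; right. Qed.

Lemma extend_sq v lam p u q : star_labelling v lam -> sq v p u q ->
  extend v lam u = symd (lam v) (symd (lam p) (lam q)).
Proof.
move=> gv s; have [vp pu uq qv [vu pq]] := s.
rewrite /extend; case: asboolP => [[?|?]|_]; [by subst; clash|by clash|].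
case: pselect => [h|h]; last by exfalso; apply: h; exists (p, q).
case: (cid h) => -[p' q'] /= [vp' p'u uq' q'v [_ p'q']]; congr (symd (lam v) _).
case: (adj_cases p p') => [?|pp'|pp'].
- subst p'; congr (symd _ (lam _)); symmetry.
  by apply: (opp_uniq (u := v) (v := u) (p := p)); edge.
- have qp' : e q p'.
    by rewrite e_sym; apply: (opp_adj (u := v) (v := u) (p := p) (q := q)); edge.
  have p'q : e p' q by edge.
  have pq'' : e p q' by apply: (opp_adj (u := v) (v := u) (p := p') (q := q')); edge.
  have qq' : e q q' by apply: (opp_adj (u := v) (v := u) (p := p') (q := q')); edge.
  apply: (labelling_sq gv); [by square|right; edge..].
- have ? : p' = q by apply: (opp_uniq (u := v) (v := u) (p := p)); edge.
  subst p'.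
  have ? : q' = p by apply: (opp_uniq (u := v) (v := u) (p := q)); edge.
  by subst q'; rewrite symdC.
Qed.

(** The value outside the star of x is fixed to be empty, so that labellings that agree on the star
are equal. *)
Definition carry v x lam u : {set I} := if `[< in_star x u >] then extend v lam u else set0.

Lemma carry_in v x lam u : in_star x u -> carry v x lam u = extend v lam u.
Proof. by rewrite /carry => h; case: asboolP. Qed.
Lemma carry_id v x lam : carry v x lam x = extend v lam x.
Proof. by apply: carry_in; left. Qed.
Lemma carry_nb v x lam u : e x u -> carry v x lam u = extend v lam u.
Proof. by move=> h; apply: carry_in; right. Qed.

Lemma in_star_cases v x a : e v x -> in_star x a -> in_star v a \/ exists p q, sq v p a q.
Proof.
move=> vx [->|xa]; first by left; right.
case: (adj_cases v a) => [->|va|va]; [by left; left|by left; right|right].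
have ax : e a x by edge.
case: (opp_or_apex va vx ax) => [[y s]|[p [q [s _ _]]]]; first by exists x, y.
by exists p, q.
Qed.

Lemma extend_far v lam p w q : star_labelling v lam -> sq v p w q ->
  symd (lam v) (extend v lam w) = symd (lam p) (lam q) /\
  #|symd (lam p) (lam q)| = 4.
Proof.
move=> gv s; rewrite (extend_sq gv s) symdK; split=> //.
have [vp _ _ qv [_ pq]] := s.
by apply: (labelling_far gv _ _ pq); right; edge.
Qed.

Lemma extend_card v lam p w q : star_labelling v lam -> sq v p w q -> #|extend v lam w| = #|lam v|.
Proof.
move=> gv s; have [_ f] := extend_far gv s.
have [vp _ _ qv [_ pq]] := s.
have vv : in_star v v by left.
have vp' : in_star v p by right; edge.
have vq' : in_star v q by right; edge.
rewrite (extend_sq gv s).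
have := far_card f (V := lam v); rewrite -!(labelling_adj gv) //.
have [_ _ <-] := gv v p vv vp'; have [_ _ <-] := gv v q vv vq'.
by rewrite vp (e_sym v q) qv => /(_ isT isT); lia.
Qed.

Lemma extend_adj v lam p w q y : star_labelling v lam -> sq v p w q -> e v y ->
  e y w = adj2 (lam y) (extend v lam w).
Proof.
move=> gv s vy; have [_ f] := extend_far gv s.
have [vp pw wq qv [vw pq]] := s.
have vv : in_star v v by left.
have vp' : in_star v p by right; edge.
have vq' : in_star v q by right; edge.
have vy' : in_star v y by right; edge.
have a1 : adj2 (lam v) (lam p) by rewrite -(labelling_adj gv).
have a2 : adj2 (lam v) (lam q) by rewrite -(labelling_adj gv) // e_sym.
have a3 : adj2 (lam y) (lam v) by rewrite -(labelling_adj gv) // e_sym.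
rewrite (extend_sq gv s); apply/idP/idP => [yw|].
- case: (adj_cases y p) => [?|yp|yp].
  + subst y; rewrite /adj2 (_ : symd (lam p) _ = symd (lam v) (lam q)) //.
    by apply/setP => i; rewrite !in_symd; do 3 case: (_ \in _).
  + have yq : e y q by apply: (opp_adj (u := v) (v := w) (p := p) (q := q)); edge.
    by apply: far_apex; rewrite // -(labelling_adj gv).
  + have ? : y = q by apply: (opp_uniq (u := v) (v := w) (p := p)); edge.
    subst y; rewrite /adj2 (_ : symd (lam q) _ = symd (lam v) (lam p)) //.
    by apply/setP => i; rewrite !in_symd; do 3 case: (_ \in _).
- case/(far_mid f a1 a2 a3) => [/(labelling_inj gv vy' vp')|/(labelling_inj gv vy' vq')|];
    [by move=> ->|by move=> ->; edge|].
  rewrite -!(labelling_adj gv) // => /andP[yp yq].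
  apply: (opp_adj (u := p) (v := q) (p := v) (q := w)); edge.
Qed.

(** The labels of w and w' are compared through far_count, where the neighbour x of v is the
centre.  Local positioning at w' rules out the adjacencies that the count excludes. *)
Lemma extend_apex_pair v lam x w y1 y2 w' p q : star_labelling v lam -> e v x -> e x w -> e x w' ->
  sq v y1 w y2 -> e x y1 -> e x y2 -> sq v p w' q ->
  e w w' = adj2 (extend v lam w) (extend v lam w') /\
  (extend v lam w = extend v lam w' -> w = w').
Proof.
move=> gv vx xw xw' s xy1 xy2 s'.
have [f1 f2] := extend_far gv s'.
have [_ f] := extend_far gv s.
have [vy1 y1w wy2 y2v [vw y12]] := s; have [_ _ _ _ [vw' _]] := s'.
have vv : in_star v v by left.
have vx' : in_star v x by right.
have v1 : in_star v y1 by right; edge.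
have v2 : in_star v y2 by right; edge.
have h : #|symd (lam v) (extend v lam w')| = 4 by rewrite f1.
have xw'' : adj2 (lam x) (extend v lam w') by rewrite -(extend_adj gv s').
have := far_count f _ _ _ _ _ xw'' h.
rewrite -(extend_sq gv s) -!(labelling_adj gv) // vy1 xy1 xy2 (e_sym v y2) y2v (e_sym x v) vx.
rewrite ![adj2 (extend v lam w') _]adj2C -!(extend_adj gv s') //; last by edge.
rewrite (adj2C (extend v lam w)).
move=> /(_ isT isT isT isT isT) [[h1 h2 h3]|[h1 h2 h3 h4]|[h1 h2 h3]].
- have ? : w = w'.
    by apply: (opp_uniq (u := y1) (v := y2) (p := v)); edge.
  by subst w'; rewrite e_irr /adj2 symdd cards0.
- split; last by move=> hh; case: h4.
  rewrite (negPf h3); apply/negP => ww'.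
  have n1 : nadj w' y1 by split; [move=> ?; subst; clash|rewrite e_sym].
  have n2 : nadj w' y2 by split; [move=> ?; subst; clash|rewrite e_sym].
  have s2 : sq y1 w y2 v by square.
  have w'w : e w' w by edge.
  by have [_ /(_ x)] := corner_far s2 w'w n1 n2; apply; edge.
- split; last by move=> hh; case: h3.
  rewrite h2.
  case: (adj_cases w w') => [?|//|ww'].
    by exfalso; apply: h3; congr (extend v lam _).
  exfalso; move: h1; case h1 : (e y1 w'); case h2' : (e y2 w') => // _.
  + have n2 : nadj w' y2 by split; [move=> ?; subst; clash|rewrite e_sym h2'].
    have w'y : e w' y1 by edge.
    by have [_ /(_ x)] := corner_far s w'y (nadjC vw') (nadjC ww'); apply; edge.
  + have n2 : nadj w' y1 by split; [move=> ?; subst; clash|rewrite e_sym h1].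
    have w'y : e w' y2 by edge.
    by have [_ /(_ x)] := corner_far (sq_rev s) w'y (nadjC vw') (nadjC ww'); apply; edge.
Qed.

(** Squares on the edge v x are parallel, and the parallelogram rule translates the labels of y
and y' to those of w and w'. *)
Lemma extend_square_pair v lam x w y w' y' : star_labelling v lam -> sq v x w y -> sq v x w' y' ->
  e w w' = adj2 (extend v lam w) (extend v lam w') /\
  (extend v lam w = extend v lam w' -> w = w').
Proof.
move=> gv s s'; have [vx xw wy yv [vw xy]] := s; have [_ xw' wy' y'v [vw' xy']] := s'.
have vy : in_star v y by right; edge.
have vy' : in_star v y' by right; edge.
have E : symd (extend v lam w) (extend v lam w') = symd (lam y) (lam y').
  rewrite (extend_sq gv s) (extend_sq gv s').
  by apply/setP => i; rewrite !in_symd; do 4 case: (_ \in _).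
rewrite {1}/adj2 E -/(adj2 (lam y) (lam y')) -(labelling_adj gv) //.
split; last first.
  by move=> h; apply: (parallel_eq s s'); apply: (labelling_inj gv) => //; apply: symd_eq0;
      rewrite -E h symdd cards0.
exact: parallel_adj s s'.
Qed.

(** Two neighbours of x at distance 2 from v are each either opposite to v in a square on the edge
v x or part of a pyramid with apex x: the two preceding lemmas cover all combinations. *)
Lemma carry_labelling v x lam : e v x -> star_labelling v lam -> star_labelling x (carry v x lam).
Proof.
move=> vx gv a b xa xb; rewrite !carry_in //.
have half a' b' p q : in_star v a' -> sq v p b' q -> e x b' ->
  [/\ e a' b' = adj2 (extend v lam a') (extend v lam b'),
    extend v lam a' = extend v lam b' -> a' = b' & #|extend v lam a'| = #|extend v lam b'|].
  move=> va s xb'; have [f1 f2] := extend_far gv s; rewrite (extend_card gv s) (extend_in lam va).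
  have [_ _ _ _ [vb _]] := s.
  case: va => [?|va].
    subst a'; split=> //.
      by rewrite /adj2 f1 f2; case: vb => _ /negPf ->.
    by move=> h; move: f2; rewrite -f1 -h symdd cards0.
  have [h1 h2 h3] : [/\ e v a' = adj2 (lam v) (lam a'), lam v = lam a' -> v = a' & #|lam v| = #|lam a'|].
    by apply: (gv v a'); [left|right].
  split=> //; first exact: extend_adj s va.
  by move=> h; move: h1; rewrite h /adj2 f1 f2 va.
case: (in_star_cases vx xa) => [va|[p [q s]]]; case: (in_star_cases vx xb) => [vb|[p' [q' s']]].
- by rewrite !extend_in //; apply: gv.
- apply: (half a b p' q' va s').
  by case: xb => // ?; subst b; case: s' => ? ? ? ? [? ?]; clash.
- have [|h1 h2 h3] := half b a p q vb s.
    by case: xa => // ?; subst a; case: s => ? ? ? ? [? ?]; clash.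
  by rewrite e_sym adj2C; split=> // /esym /h2.
- have va : nadj v a by case: s => _ _ _ _ [].
  have vb : nadj v b by case: s' => _ _ _ _ [].
  rewrite (extend_card gv s) (extend_card gv s').
  have {}xa : e x a by case: xa => // ?; subst; clash.
  have {}xb : e x b by case: xb => // ?; subst; clash.
  have ax : e a x by edge.
  have bx : e b x by edge.
  case: (opp_or_apex va vx ax) => [[y t]|[y1 [y2 [t xy1 xy2]]]]; last first.
    by have [] := extend_apex_pair gv vx xa xb t xy1 xy2 s'.
  case: (opp_or_apex vb vx bx) => [[y' t']|[y1 [y2 [t' xy1 xy2]]]]; last first.
    have [h1 h2] := extend_apex_pair gv vx xb xa t' xy1 xy2 s.
    by rewrite e_sym adj2C; split=> // /esym /h2.
  by have [] := extend_square_pair gv t t'.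
Qed.

Lemma extend_carry_back v x lam u : star_labelling v lam -> e v x -> e v u ->
    extend x (carry v x lam) u = lam u.
Proof.
move=> gv vx vu; have gx := carry_labelling vx gv.
case: (adj_cases x u) => [?|xu|xu].
- by subst; rewrite extend_id carry_id extend_nb.
- by rewrite extend_nb // carry_nb // extend_nb.
have xv : e x v by edge.
have uv : e u v by edge.
case: (opp_or_apex xu xv uv) => [[w s]|[y1 [y2 [s vy1 vy2]]]].
- have [_ _ uw wx [_ vw]] := s.
  have s' : sq v x w u by square.
  rewrite (extend_sq gx s) carry_id !carry_nb //; try by edge.
  rewrite (extend_nb lam vx) extend_id (extend_sq gv s').
  by apply/setP => i; rewrite !in_symd; do 3 case: (_ \in _).
- have [? ? ? ? [? ?]] := s.
  rewrite (extend_sq gx s) carry_id !carry_nb //; try by edge.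
  rewrite !extend_nb // -(labelling_sq gv s) ?symdK //; right; edge.
Qed.

(** The fourth corner of a square is determined by the parallelogram rule. *)
Lemma labelling_rigid v lam mu p z q z' : star_labelling v lam -> star_labelling v mu -> sq p z q z' ->
  in_star v p -> in_star v q -> in_star v z -> in_star v z' ->
  lam p = mu p -> lam z = mu z -> lam z' = mu z' -> lam q = mu q.
Proof.
move=> gl gm s ? ? ? ? h1 h2 h3; apply: (@symd_inj _ (lam p)).
by rewrite {2}h1 (labelling_sq gl s) // (labelling_sq gm s) // h2 h3.
Qed.

(** The two labellings of the star of y agree on the neighbours of v and of x.  On the other u they
agree by rigidity if y is the apex of a pyramid through u and v or x.  Otherwise both values
are given by squares on the edges y v and y x, which fit together to a triangular prism. *)
Lemma carry_triangle v x y lam : star_labelling v lam -> e v x -> e x y -> e v y ->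
  carry x y (carry v x lam) = carry v y lam.
Proof.
move=> gv vx xy vy; set nu := carry x y _; set mu := carry v y lam.
have gx := carry_labelling vx gv; have gy := carry_labelling vy gv.
have gn : star_labelling y nu := carry_labelling xy gx.
have nuE u : in_star y u -> nu u = extend x (carry v x lam) u by exact: carry_in.
have muE u : in_star y u -> mu u = extend v lam u by exact: carry_in.
have nmv u : in_star y u -> e v u -> nu u = mu u.
  by move=> yu vu; rewrite nuE // muE // extend_carry_back // extend_nb.
have nmx u : in_star y u -> in_star x u -> nu u = mu u.
  by move=> yu xu; rewrite nuE // muE // (extend_in _ xu) carry_in.
have nmV : nu v = mu v by apply: nmx; right; edge.
have nmX : nu x = mu x by apply: nmx; [right; edge|left].
apply: funext => u; have [yu|yu] := pselect (in_star y u); last first.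
  by rewrite /nu /mu /carry; case: asboolP.
case: (adj_cases v u) => [?|vu|vu]; [by subst|exact: nmv|].
case: (adj_cases x u) => [?|xu|xu]; [by subst|by apply: nmx => //; right|].
have yu' : e y u by case: yu => // ?; subst; clash.
have uy : e u y by edge.
case: (opp_or_apex vu vy uy) => [[q s]|[q1 [q2 [s yq1 yq2]]]]; last first.
  have [? ? ? ? [? ?]] := s.
  symmetry; apply: (labelling_rigid gy gn s); try (by right; edge); first by symmetry.
  - by symmetry; apply: nmv => //; right; edge.
  - by symmetry; apply: nmv; [right; edge|edge].
case: (opp_or_apex xu xy uy) => [[q' s']|[q1 [q2 [s' yq1 yq2]]]]; last first.
  have [? ? ? ? [? ?]] := s'.
  symmetry; apply: (labelling_rigid gy gn s'); try (by right; edge); first by symmetry.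
  - by symmetry; apply: nmx => //; right; edge.
  - by symmetry; apply: nmx; right; edge.
have [_ _ uq qv [_ yq]] := s; have [_ _ uq' q'x [_ yq']] := s'.
have vneq q0 v0 x0 : e v0 x0 -> e v0 y -> e x0 y -> nadj v0 u -> nadj x0 u -> e u q0 ->
    nadj y q0 -> e q0 v0 -> nadj x0 q0.
  move=> ? ? ? ? ? ? ? ?; case: (adj_cases x0 q0) => [?|h|//]; first by subst; clash.
  have h' : e x0 u by apply: (opp_adj (u := y) (v := q0) (p := v0) (q := u)); edge.
  clash.
have xq : nadj x q by apply: (vneq q v x); edge.
have vq' : nadj v q' by apply: (vneq q' x v); edge.
have qq' : e q q'.
  case: (adj_cases q q') => [?|//|h]; first by subst; clash.
  have s2 : sq y u q' x by square.
  have qu : e q u by edge.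
  by have [_ /(_ v)] := corner_far s2 qu (nadjC yq) h; case; edge.
have s3 : sq v x q' q by square.
rewrite nuE // muE // (extend_sq gx s') (extend_sq gv s) carry_id !carry_nb //; try by edge.
rewrite (extend_nb lam vx) (extend_nb lam vy) (extend_sq gv s3).
by apply/setP => i; rewrite !in_symd; do 4 case: (_ \in _).
Qed.

Lemma carry_square_near v x w y u lam : star_labelling v lam -> pure_square v x w y -> e w u -> e x u ->
  carry x w (carry v x lam) u = carry y w (carry v y lam) u.
Proof.
move=> gv P wu xu; have [[vx xw wy yv [vw xy]] h] := P.
have vy : e v y by edge.
have gx := carry_labelling vx gv; have gy := carry_labelling vy gv.
have [t [s1 s2]] := near_square P wu xu.
have [_ _ _ ty [_ _]] := s1; have [_ _ _ tv [_ _]] := s2.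
have s3 := pure_swap P; case: s3 => s3 _.
have vt : e v t by edge.
rewrite !(carry_nb _ _ wu) (extend_nb _ xu) (carry_nb _ _ xu) (extend_sq gv s2).
rewrite (extend_sq gy s1) carry_id !carry_nb; try by edge.
rewrite (extend_nb _ vy) (extend_nb _ vt) (extend_sq gv s3).
by apply/setP => i; rewrite !in_symd; do 4 case: (_ \in _).
Qed.

(** If the square has an apex z, go through z and apply carry_triangle to the four triangles.  If
not, near_square and cube describe the neighbours u of w, and in each case the two labels of
u are the same combination of labels around v. *)
Lemma carry_square v x w y lam : star_labelling v lam -> sq v x w y ->
  carry x w (carry v x lam) = carry y w (carry v y lam).
Proof.
move=> gv s; have [vx xw wy yv [vw xy]] := s.
have vy : e v y by edge.
have yw : e y w by edge.
have gx := carry_labelling vx gv; have gy := carry_labelling vy gv.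
have [[z [zv zx zw zy]]|npure] := pselect (exists z, [/\ e z v, e z x, e z w & e z y]).
  have vz : e v z by edge.
  have gz := carry_labelling vz gv.
  by rewrite -(carry_triangle gv vz zx vx) -(carry_triangle gv vz zy vy) !(carry_triangle gz).
have P : pure_square v x w y.
  by split=> // z *; apply: npure; exists z.
have P' := pure_swap P; have s' := proj1 P'.
set m1 := carry x w _; set m2 := carry y w _.
have g1 : star_labelling w m1 := carry_labelling xw gx.
have g2 : star_labelling w m2 := carry_labelling yw gy.
have near1 u : e w u -> e x u -> m1 u = m2 u by exact: carry_square_near.
have near2 u : e w u -> e y u -> m1 u = m2 u.
  by move=> wu yu; symmetry; exact: carry_square_near gv P' wu yu.
have atw : m1 w = m2 w.
  by rewrite /m1 /m2 !carry_id (extend_nb _ xw) (extend_nb _ yw) !carry_nb.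
have atx : m1 x = m2 x.
  rewrite /m1 /m2 !carry_nb; try by edge.
  by rewrite extend_id carry_id extend_carry_back ?extend_nb.
have aty : m1 y = m2 y.
  rewrite /m1 /m2 !carry_nb; try by edge.
  by rewrite extend_id carry_id extend_carry_back ?extend_nb.
apply: funext => u; have [wu|wu] := pselect (in_star w u); last first.
  by rewrite /m1 /m2 /carry; case: asboolP.
case: wu => [->//|wu].
case: (adj_cases x u) => [?|xu|xu]; [by subst|exact: near1|].
case: (adj_cases y u) => [?|yu|yu]; [by subst|exact: near2|].
case: (cube P wu xu yu) => [[t1 [t2 [st wt1 wt2]]]|[t1 [t2 [st wt1 wt2]]]|[t [t' [q [st st' sq1 sq2]]]]].
- have [? ? ? ? [? ?]] := st.
  apply: (labelling_rigid g1 g2 st _ _ _ _ atx); try (by right; edge).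
  + apply: near1; edge.
  + apply: near1; edge.
- have [? ? ? ? [? ?]] := st.
  apply: (labelling_rigid g1 g2 st _ _ _ _ aty); try (by right; edge).
  + apply: near2; edge.
  + apply: near2; edge.
- have [? ? ? ? [? ?]] := st; have [? ? ? ? [? ?]] := st'.
  rewrite /m1 /m2 !(carry_nb _ _ wu) (extend_sq gx st) (extend_sq gy st') !carry_id !carry_nb;
      try by edge.
  rewrite (extend_nb _ vx) (extend_nb _ vy) (extend_sq gv s) (extend_sq gv sq1) (extend_sq gv sq2).
  by apply/setP => i; rewrite !in_symd; do 4 case: (_ \in _).
Qed.

End Labels.

(** * Existence of a star labelling *)

(** Each class of E, a partial equivalence on the neighbours of v, is numbered by r at a
representative; this is where finitely many neighbours are needed. *)
Lemma class_index v m (r : V -> 'I_m) (E : V -> V -> Prop) :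
  (forall x y, e v x -> e v y -> r x = r y -> x = y) ->
  (forall x, e v x -> E x x) ->
  (forall x y, E x y -> e v x /\ E y x) -> (forall x y z, E x y -> E y z -> E x z) ->
  exists a : V -> 'I_m, forall x y, e v x -> e v y -> a x = a y <-> E x y.
Proof.
move=> rI Er Es Et; exists (fun x => r (some_of (E x) x)) => x y vx vy.
have ex : exists z, E x z by exists x; exact: Er.
have ey : exists z, E y z by exists y; exact: Er.
have hx := some_ofP x ex; have hy := some_ofP y ey; split.
- have v1 := proj1 (Es _ _ (proj2 (Es _ _ hx))).
  have v2 := proj1 (Es _ _ (proj2 (Es _ _ hy))).
  move=> /(rI _ _ v1 v2) h; rewrite h in hx.
  by apply: Et hx _; apply: (proj2 (Es _ _ hy)).
- move=> xy; rewrite (_ : E x = E y); first by congr r; exact: some_of_indep.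
  apply: funext => z; apply: propext; split=> h; last exact: Et xy h.
  by apply: Et h; apply: (proj2 (Es _ _ xy)).
Qed.

(** With the set B0 of all left copies as label of v, the neighbour x is labelled by exchanging the
left copy of a x for the right copy of c x, where a x and c x number the sides through x of the
two colours.  A side consisting of x alone is allowed for, since the classes of E b are those
of equality or being on a common side of colour b. *)
Lemma star_labelling_exists v m (r : V -> 'I_m) :
  (forall x y, e v x -> e v y -> r x = r y -> x = y) ->
  exists lam : V -> {set 'I_m + 'I_m}, star_labelling v lam.
Proof.
move=> rI; have [col colP] := two_coloring (@side_adj_sym v) (@no_odd_side_walk v).
pose E b x y := [/\ e v x, e v y & x = y \/ e x y /\ col (side v x y) = b].
have Es b x y : E b x y -> e v x /\ E b y x.
  move=> [vx vy h]; split=> //; split=> //; case: h => [->|[xy c]]; first by left.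
  by right; rewrite e_sym sideC.
have Et b x y z : E b x y -> E b y z -> E b x z.
  move=> [vx vy [<- //|[xy c1]]] [_ vz [<-|[yz c2]]]; first by split=> //; right.
  split=> //; have [?|xz] := pselect (x = z); [by left|right].
  have [_ hy] := side_refl vx vy xy; have [hy' hz] := side_refl vy vz yz.
  have sxy : is_side v (side v x y) by exists x, y.
  have syz : is_side v (side v y z) by exists y, z.
  have sE : side v x y = side v y z.
    have [//|ns] := pselect (side v x y = side v y z).
    by have := colP _ _ (And4 sxy syz ns (ex_intro _ y (conj hy hy'))); rewrite c1 c2 eqxx.
  have [hx _] := side_refl vx vy xy; rewrite -sE in hz.
  by have [_ _ ? <-] := side_eq sxy hx hz xz.
have Er b x : e v x -> E b x x by move=> vx; split=> //; left.
have [a aP] := class_index rI (Er true) (Es true) (Et true).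
have [c cP] := class_index rI (Er false) (Es false) (Et false).
pose B0 : {set 'I_m + 'I_m} := [set i | if i is inl _ then true else false].
have xpair_inl (i j : 'I_m) : (inl i == inl j :> 'I_m + 'I_m) = (i == j) by [].
have xpair_inr (i j : 'I_m) : (inr i == inr j :> 'I_m + 'I_m) = (i == j) by [].
have xlr (i j : 'I_m) : (inl i == inr j :> 'I_m + 'I_m) = false by [].
have xrl (i j : 'I_m) : (inr i == inl j :> 'I_m + 'I_m) = false by [].
pose D x : {set 'I_m + 'I_m} := [set inl (a x); inr (c x)].
pose lam u := if `[< u = v >] then B0 else symd B0 (D u).
have lamv : lam v = B0 by rewrite /lam; case: asboolP.
have lamx x : e v x -> lam x = symd B0 (D x).
  by rewrite /lam => vx; case: asboolP => // ?; subst; clash.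
have cD x : #|D x| = 2 by rewrite cards2.
have c0 x : e v x -> #|symd B0 (lam x)| = 2 by move=> vx; rewrite lamx // symdK.
have cB x : e v x -> #|lam x| = #|lam v|.
  move=> vx; rewrite lamv (lamx x) // (_ : symd B0 (D x) = inr (c x) |: (B0 :\ inl (a x))).
    by rewrite cardsU1 !inE /= (cardsD1 (inl (a x)) B0) inE.
  by apply/setP => -[i|i]; rewrite in_symd !inE /= ?orbF ?andbT //= (inj_eq (@inl_inj _ _)).
have cxy x y : e v x -> e v y -> #|symd (lam x) (lam y)| = (a x != a y).*2 + (c x != c y).*2.
  move=> vx vy; rewrite !lamx // -(symd_trans (D x) (D y) B0).
  rewrite (_ : symd (D x) (D y) = (if a x == a y then set0 else [set inl (a x); inl (a y)])
      :|: (if c x == c y then set0 else [set inr (c x); inr (c y)])); last first.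
    apply/setP => -[i|i]; rewrite in_symd /D.
    - case: (eqVneq (a x) (a y)) => [h|h]; case: (c x == c y);
        rewrite !inE !xpair_inl ?xlr ?h ?addbb //=;
        by rewrite ?orbF; have [->|_] := eqVneq i (a x); rewrite ?(negPf h).
    - case: (a x == a y); case: (eqVneq (c x) (c y)) => [h|h];
        rewrite !inE !xpair_inr ?xrl ?h ?addbb //=;
        by rewrite ?orbF; have [->|_] := eqVneq i (c x); rewrite ?(negPf h).
  case: eqP => [ha|/eqP ha]; case: eqP => [hc|/eqP hc] /=; rewrite ?setU0 ?set0U ?cards0 //.
  - by rewrite cards2 (inj_eq (@inr_inj _ _)) hc.
  - by rewrite cards2 (inj_eq (@inl_inj _ _)) ha.
  - rewrite cardsU !cards2 (inj_eq (@inr_inj _ _)) (inj_eq (@inl_inj _ _)) ha hc.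
    by rewrite (_ : _ :&: _ = set0) ?cards0 //; apply/setP => -[i|i]; rewrite !inE ?andbF.
exists lam => x y [->|vx] [->|vy].
- by rewrite e_irr /adj2 symdd cards0.
- rewrite cB // vy /adj2 {1}lamv c0 //; split=> //.
  by rewrite lamv => h; have := c0 _ vy; rewrite -h symdd cards0.
- rewrite cB // e_sym vx /adj2 {1}lamv symdC c0 //; split=> //.
  by rewrite lamv => h; have := c0 _ vx; rewrite h symdd cards0.
rewrite !cB //; split=> //.
- rewrite /adj2 cxy //; apply/idP/idP => [xy|].
    have nxy : x <> y by edge.
    case cE : (col (side v x y)).
    + have -> : a x = a y by apply/(aP x y vx vy); split=> //; right.
      have -> : c x != c y; last by rewrite eqxx.
      by apply/eqP => /(cP x y vx vy) [_ _ [//|[_]]]; rewrite cE.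
    + have -> : c x = c y by apply/(cP x y vx vy); split=> //; right.
      have -> : a x != a y; last by rewrite eqxx.
      by apply/eqP => /(aP x y vx vy) [_ _ [//|[_]]]; rewrite cE.
  have [/(aP x y vx vy) [_ _ [xy|[]//]]|na] := eqVneq (a x) (a y).
    by rewrite xy eqxx => /eqP.
  have [/(cP x y vx vy) [_ _ [xy|[]//]]|_ /eqP//] := eqVneq (c x) (c y).
  by rewrite xy eqxx in na.
- move=> h; have := cxy x y vx vy; rewrite h symdd cards0.
  have [/(aP x y vx vy) ha|_] := eqVneq (a x) (a y); last by case: (c x == c y).
  have [/(cP x y vx vy) hc|//] := eqVneq (c x) (c y).
  by case: ha => _ _ [//|[_ c1]]; case: hc => _ _ [//|[_ c2]]; rewrite c1 in c2.
Qed.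
End LocalStructure.

(** * Systems of states over a graph *)
Section Transport.
Variables (V : Type) (e : rel V).
Hypothesis e_sym : symmetric e.

(** A combinatorial form of a covering of the complex: states over the vertices, moved along
edges, such that going around a triangle or a square has no effect.  The vertices of a cover
are one instance, the labellings of stars another. *)
Definition transport_system (Z : Type) (pi : Z -> V) (step : Z -> V -> Z) :=
  [/\ forall z x, e (pi z) x -> pi (step z x) = x,
      forall z x, e (pi z) x -> step (step z x) (pi z) = z,
      forall z x y, e (pi z) x -> e x y -> e (pi z) y -> step (step z x) y = step z y &
      forall z x w y, sq e (pi z) x w y -> step (step z x) w = step (step z y) w].

Fixpoint back (v : V) (s : seq V) : seq V :=
  if s is x :: s' then rcons (back x s') v else [::].

Lemma back_path v s : path e v s -> path e (last v s) (back v s) /\ last (last v s) (back v s) = v.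
Proof.
elim: s v => [//|x s IHs] v /= /andP[vx /IHs [ps ls]].
by rewrite rcons_path last_rcons ps ls e_sym vx.
Qed.

Section System.
Variables (Z : Type) (pi : Z -> V) (step : Z -> V -> Z).
Hypothesis T : transport_system pi step.

Lemma pi_foldl z s : path e (pi z) s -> pi (foldl step z s) = last (pi z) s.
Proof.
have [T1 _ _ _] := T; elim: s z => [//|x s IHs] z /= /andP[zx ps].
by rewrite IHs ?T1.
Qed.

Lemma foldl_back z s : path e (pi z) s -> foldl step z (s ++ back (pi z) s) = z.
Proof.
have [T1 T2 _ _] := T; elim: s z => [//|x s IHs] z /= /andP[zx ps].
have := IHs (step z x); rewrite T1 // => /(_ ps) h.
by rewrite -cats1 catA foldl_cat h /= T2.
Qed.

Lemma foldl_inj z z' s : pi z = pi z' -> path e (pi z) s -> foldl step z s = foldl step z' s -> z = z'.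
Proof.
have [T1 T2 _ _] := T; elim: s z z' => [//|x s IHs] z z' zz /= /andP[zx ps] h.
have zx' : e (pi z') x by rewrite -zz.
have {}h : step z x = step z' x by apply: IHs h; rewrite ?T1.
by rewrite -(T2 _ _ zx) h zz T2.
Qed.
End System.
End Transport.

(** * The labelling of a cover without holonomy *)
Section Cover.
Variables (V : Type) (e : rel V).
Hypotheses (e_sym : symmetric e) (e_irr : irreflexive e).
Hypothesis opp_ex : forall u v x, nadj e u v -> e u x -> e v x ->
  exists p q, [/\ e u p, e v p, e u q, e v q & nadj e p q].
Hypothesis opp_uniq : forall u v p q r, nadj e u v ->
  e u p -> e v p -> e u q -> e v q -> e u r -> e v r ->
  nadj e p q -> nadj e p r -> q = r.
Hypothesis com_trifree : forall u v p q r, nadj e u v ->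
  e u p -> e v p -> e u q -> e v q -> e u r -> e v r ->
  e p q -> e q r -> e p r -> False.
Hypothesis corner_far : forall a b c d z, sq e a b c d -> e z b -> nadj e z a -> nadj e z c ->
  nadj e z d /\ forall t, e z t -> e t d -> False.
Hypothesis corner_adj : forall a b c d z s t, sq e a b c d -> nadj e z a -> e z s -> e s a ->
  nadj e z c -> e z t -> e t c ->
  nadj e z b -> (forall t, e z t -> e t b -> False) -> e z d.

Section Labellings.
Variable I : finType.

(** The labelling is empty outside the star, so that equality of functions is equality on the star. *)
Definition labelled := {zl : V * (V -> {set I}) |
  star_labelling e zl.1 zl.2 /\ forall u, ~ in_star e zl.1 u -> zl.2 u = set0}.

Lemma labelled_eq (z z' : labelled) : sval z = sval z' -> z = z'.
Proof. by case: z z' => [z hz] [z' hz'] /= h; subst z'; congr exist; exact: Prop_irrelevance. Qed.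

Definition star_of (z : labelled) : V := (sval z).1.
Definition label (z : labelled) : V -> {set I} := (sval z).2.

Lemma label_star z : star_labelling e (star_of z) (label z).
Proof. by case: z => [[v l] []]. Qed.
Lemma label_off z u : ~ in_star e (star_of z) u -> label z u = set0.
Proof. by case: z u => [[v l] []]. Qed.

Lemma carry_labelled z x : e (star_of z) x ->
  star_labelling e (x, carry e (star_of z) x (label z)).1 (x, carry e (star_of z) x (label z)).2 /\
  forall u, ~ in_star e (x, carry e (star_of z) x (label z)).1 u ->
    (x, carry e (star_of z) x (label z)).2 u = set0.
Proof.
move=> zx; split=> /=; first by have := carry_labelling e_sym e_irr opp_ex opp_uniq corner_far zx
    (@label_star z).
by move=> u; rewrite /carry; case: asboolP.
Qed.

Definition relabel (z : labelled) (x : V) : labelled :=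
  if pselect (e (star_of z) x) is left h then exist _ _ (carry_labelled h) else z.

Lemma relabelE z x : e (star_of z) x ->
  sval (relabel z x) = (x, carry e (star_of z) x (label z)).
Proof. by rewrite /relabel; case: pselect. Qed.

Lemma star_relabel z x : e (star_of z) x -> star_of (relabel z x) = x.
Proof. by move=> h; rewrite /star_of relabelE. Qed.
Lemma label_relabel z x : e (star_of z) x -> label (relabel z x) = carry e (star_of z) x (label z).
Proof. by move=> h; rewrite /label relabelE. Qed.

Lemma relabel_system : transport_system e star_of relabel.
Proof.
have extend z z' : star_of z = star_of z' -> label z = label z' -> z = z'.
  move=> h1 h2; apply: labelled_eq; move: h1 h2; rewrite /star_of /label.
  by case: (sval z) => ? ?; case: (sval z') => ? ? /= -> ->.
split=> [z x zx|z x zx|z x y zx xy zy|z x w y s]; first exact: star_relabel.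
- have xz : e (star_of (relabel z x)) (star_of z) by rewrite star_relabel // e_sym.
  apply: extend; first by rewrite star_relabel.
  rewrite label_relabel // label_relabel // star_relabel //.
  apply: funext => u; rewrite /carry; case: asboolP => [zu|zu]; last by rewrite label_off.
  rewrite -/(carry e (star_of z) x (label z)).
  case: zu => [->|zu]; last by apply: (extend_carry_back e_sym e_irr opp_ex opp_uniq corner_far) =>
      //; exact: label_star.
  by rewrite extend_nb ?carry_nb ?extend_id // e_sym.
- have xy' : e (star_of (relabel z x)) y by rewrite star_relabel.
  apply: extend; first by do ?rewrite star_relabel //.
  rewrite label_relabel // label_relabel // star_relabel // label_relabel //.
  exact: (carry_triangle e_sym e_irr opp_ex opp_uniq corner_far (@label_star z)).
- have [zx xw wy yz _] := s; have zy : e (star_of z) y by rewrite e_sym.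
  have xw' : e (star_of (relabel z x)) w by rewrite star_relabel.
  have yw' : e (star_of (relabel z y)) w by rewrite star_relabel // e_sym.
  apply: extend; first by do ?rewrite star_relabel //.
  rewrite (label_relabel xw') (label_relabel yw') !label_relabel // !star_relabel //.
  exact: (carry_square e_sym e_irr opp_ex opp_uniq com_trifree corner_far corner_adj (@label_star z)).
Qed.
End Labellings.

Variables (W : Type) (d : rel W) (q : W -> V) (follow : W -> V -> W).
Hypothesis followT : transport_system e q follow.
Hypothesis dE : forall y y', d y y' <-> e (q y) (q y') /\ follow y (q y') = y'.
Hypothesis conn : forall y y', exists2 s, path e (q y) s & foldl follow y s = y'.
(** The only consequence of simple connectedness that is used. *)
Hypothesis hol : forall (Z : Type) (pi : Z -> V) (step : Z -> V -> Z), transport_system e pi step ->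
  forall y s z, path e (q y) s -> foldl follow y s = y -> pi z = q y -> foldl step z s = z.

(** Two walks with the same end are compared through the closed walk made of one and the reverse of
the other. *)
Lemma cover_hol (Z : Type) (pi : Z -> V) (step : Z -> V -> Z) y s t z : transport_system e pi step ->
  path e (q y) s -> path e (q y) t -> foldl follow y s = foldl follow y t -> pi z = q y ->
  foldl step z s = foldl step z t.
Proof.
move=> T ps pt st zy; have [pb lb] := back_path e_sym pt.
have ls : last (q y) s = last (q y) t.
  by rewrite -(pi_foldl followT ps) st (pi_foldl followT pt).
apply: (foldl_inj T (s := back (q y) t)); rewrite ?(pi_foldl T) ?zy ?ls //.
rewrite -!foldl_cat -{2}zy (foldl_back T) ?zy //.
apply: (hol T (y := y)) => //; first by rewrite cat_path ps ls.
by rewrite foldl_cat st -foldl_cat (foldl_back followT).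
Qed.

Variables (y0 : W) (m : nat) (r : V -> 'I_m).
Hypothesis r_inj : forall x y, e (q y0) x -> e (q y0) y -> r x = r y -> x = y.

Lemma d_sym : symmetric d.
Proof.
have [T1 T2 _ _] := followT.
have main y y' : d y y' -> d y' y.
  case/dE => yy' h; apply/dE; rewrite e_sym yy'; split=> //.
  by rewrite -h T2.
by move=> y y'; apply/idP/idP; exact: main.
Qed.

Lemma d_follow y x : e (q y) x -> d y (follow y x).
Proof. by have [T1 _ _ _] := followT; move=> yx; apply/dE; rewrite T1. Qed.

Lemma d_conn y y' : exists2 s, path d y s & last y s = y'.
Proof.
have [T1 _ _ _] := followT.
have [s ps <-] := conn y y'; elim: s y ps => [y _|x s IHs y /= /andP[yx ps]]; first by exists [::].
have [] := IHs (follow y x); first by rewrite T1.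
by move=> t pt <-; exists (follow y x :: t); rewrite //= d_follow.
Qed.

(** The state at y is obtained by carrying a labelling of the star below y0 along any walk from y0 to
y; by cover_hol the walk does not matter.  As d is the adjacency of the graph on each star, the
local hypotheses of global_inj, global_adj and global_exchange hold. *)
Theorem cover_labelling : exists f : W -> {set 'I_m + 'I_m},
  [/\ forall x y, f x = f y -> x = y, forall x y, d x y = adj2 (f x) (f y)
   & forall x y a, a \in f x :\: f y ->
     exists2 b, b \in f y :\: f x & exists z, f z = b |: (f x :\ a)].
Proof.
have [T1 T2 T3 T4] := followT.
have [lam0 g0] := star_labelling_exists e_sym e_irr opp_ex opp_uniq com_trifree corner_far r_inj.
pose lam u := if `[< in_star e (q y0) u >] then lam0 u else set0.
have lamP : star_labelling e (q y0, lam).1 (q y0, lam).2 /\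
    forall u, ~ in_star e (q y0, lam).1 u -> (q y0, lam).2 u = set0.
  rewrite /lam /=; split=> [x y hx hy|u hu]; last by case: asboolP.
  by case: asboolP => // _; case: asboolP => // _; exact: g0.
pose z0 : labelled ('I_m + 'I_m)%type := exist _ (q y0, lam) lamP.
have LT := relabel_system ('I_m + 'I_m)%type.
have [L LP] : {L : W -> labelled ('I_m + 'I_m)%type &
    forall s, path e (q y0) s -> L (foldl follow y0 s) = foldl (@relabel _) z0 s}.
  exists (fun y => foldl (@relabel _) z0 (sval (cid2 (conn y0 y)))) => s ps.
  by case: cid2 => t pt /= h; apply: (cover_hol LT pt ps h).
have star_L y : star_of (L y) = q y.
  by have [s ps <-] := conn y0 y; rewrite LP // (pi_foldl LT) // (pi_foldl followT).
have stepL y x : e (q y) x -> L (follow y x) = relabel (L y) x.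
  have [s ps <-] := conn y0 y => sx; rewrite LP // -!foldl_rcons LP // rcons_path ps.
  by rewrite -(pi_foldl followT).
have gL y : star_labelling e (q y) (label (L y)) by rewrite -star_L; exact: label_star.
have labS y x : e (q y) x -> label (L (follow y x)) = carry e (q y) x (label (L y)).
  by move=> yx; rewrite stepL // label_relabel star_L.
pose f y := label (L y) (q y).
have fE y x : d y x -> f x = label (L y) (q x).
  by case/dE => yx <-; rewrite /f T1 // labS // carry_id extend_nb.
have qq y : in_star e (q y) (q y) by left.
have dN y x : d y x -> in_star e (q y) (q x) by case/dE => ? _; right.
have fadj x y : d x y -> adj2 (f x) (f y).
  by move=> xy; rewrite (fE _ _ xy) -(labelling_adj (gL x)) //; [case/dE: xy|exact: dN].
have fstar u x y : d u x -> d u y -> adj2 (f x) (f y) -> d x y.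
  move=> ux uy; rewrite (fE _ _ ux) (fE _ _ uy) -(labelling_adj (gL u)); try exact: dN.
  case/dE: ux => ux hx; case/dE: uy => uy hy xy; apply/dE; split=> //.
  by rewrite -hx T3.
have finj u x y : d u x -> d u y -> f x = f y -> x = y.
  move=> ux uy; rewrite (fE _ _ ux) (fE _ _ uy) => /(labelling_inj (gL u) (dN _ _ ux) (dN _ _ uy)) h.
  by case/dE: ux => ux <-; case/dE: uy => uy <-; rewrite h.
have fsq u x w : d u x -> d x w -> u <> w -> ~~ d u w ->
    exists p p', [/\ d u p, d p w, d u p', d p' w & symd (f u) (f w) = symd (f p) (f p')].
  move=> /dE [ux hx] /dE [xw hw] uw nuw.
  have n : nadj e (q u) (q w).
    split=> [h|]; first by apply: uw; rewrite -hw -h -hx T2.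
    apply/negP => h; case/negP: nuw; apply/dE; split=> //.
    by rewrite -(T3 _ _ _ ux xw h) hx.
  have wx : e (q w) (q x) by rewrite e_sym.
  have [p [p' [up wp up' wp' pp]]] := opp_ex n ux wx.
  have s : sq e (q u) p (q w) p' by split=> //; rewrite e_sym.
  (* the lift at u of any corner of a square through u and w is adjacent to w, because the
     path through x ends at w *)
  have close a b : sq e (q u) a (q w) b -> e (q u) a -> e (q w) a -> e (q w) b -> d (follow u a) w.
    move=> sab ua wa wb; have [_ aw _ bu [_ ab]] := sab.
    apply/dE; rewrite T1 //; split=> //.
    case: (adj_cases e (q x) a) => [<-|xa|xa]; first by rewrite hx.
    - have ax : e a (q x) by rewrite e_sym.
      have := T3 u a (q x) ua ax ux; rewrite hx => h.
      have := T3 (follow u a) (q x) (q w); rewrite T1 // h => /(_ ax xw aw) <-; exact: hw.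
    - have ub : e (q u) b by rewrite e_sym.
      have xb : q x = b.
        by apply: (opp_uniq n ua wa); rewrite // ; apply: nadjC.
      by rewrite (T4 _ _ _ _ sab) -xb hx.
  have [p1 p2] : d u (follow u p) /\ d u (follow u p') by split; exact: d_follow.
  have c1 : d (follow u p) w by exact: close s up wp wp'.
  have c2 : d (follow u p') w by apply: (close p' p) => //; exact: (sq_rev e_sym).
  exists (follow u p), (follow u p'); split=> //.
  rewrite (fE _ _ p1) (fE _ _ p2) !T1 // (fE _ _ c1) labS // carry_nb; last first.
    by case/dE: c1; rewrite T1.
  by rewrite (extend_sq e_sym e_irr opp_uniq (gL u) s) symdK.
have fcard x y : #|f x| = #|f y|.
  have [s ps <-] := d_conn x y; elim: s x ps => [//|z s IHs] x /= /andP[xz /IHs <-].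
  by rewrite (fE _ _ xz); case: (gL x (q x) (q z) (qq x) (dN _ _ xz)).
exists f; split.
- exact: (global_inj d_sym d_conn fadj fstar finj fsq).
- exact: (global_adj d_sym d_conn fadj fstar finj fsq).
- exact: (global_exchange d_sym d_conn fadj fstar finj fsq fcard).
Qed.
End Cover.

From mathcomp Require Import all_order all_algebra.
From mathcomp Require Import all_classical all_reals all_analysis.
From mathcomp Require Import lra ring.

(** * Consequences of the two metric conditions *)
Section Distances.
Variables (V : Type) (e : rel V).
Hypotheses (e_sym : symmetric e) (e_irr : irreflexive e) (e_conn : connected_graph e).

Lemma dist_walk u v : (exists s : seq V, [/\ path e u s, last u s = v & size s = dist e u v]) /\
  forall s, path e u s -> last u s = v -> (dist e u v <= size s)%N.
Proof.
pose W n := exists s : seq V, [/\ path e u s, last u s = v & size s = n].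
have [s0 p0 l0] := e_conn u v.
have hW : exists n, `[< W n >] by exists (size s0); apply/asboolP; exists s0.
rewrite /dist; case: xgetP => [n _ [h1 h2]|h].
  by split=> // s ps ls; apply: h2; exists s.
exfalso; apply: (h (ex_minn hW)); case: ex_minnP => n /asboolP h1 h2; split=> // m hm.
by apply: h2; apply/asboolP.
Qed.

Lemma dist_eq0 u v : dist e u v = 0 -> u = v.
Proof. by have [[s [ps <- sz]] _] := dist_walk u v => h; move: sz; rewrite h => /size0nil ->. Qed.

Lemma dist_eq1 u v : dist e u v = 1 -> e u v.
Proof.
have [[s [ps ls sz]] _] := dist_walk u v => h; move: sz ps ls; rewrite h.
by case: s => [|x [|y s]] //= _; rewrite andbT => ? <-.
Qed.

Lemma dist_adj u v : e u v -> dist e u v = 1.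
Proof.
move=> uv; have [_ /(_ [:: v])] := dist_walk u v; rewrite /= uv => /(_ isT erefl).
case h : (dist e u v) => [|[|]] // _.
by move: uv; rewrite (dist_eq0 h) e_irr.
Qed.

Lemma dist_refl u : dist e u u = 0.
Proof. by have [_ /(_ [::] isT erefl)] := dist_walk u u; case: dist. Qed.

Lemma dist_two u v x : nadj e u v -> e u x -> e x v -> dist e u v = 2.
Proof.
move=> [uv nuv] ux xv; have [_ /(_ [:: x; v])] := dist_walk u v; rewrite /= ux xv => /(_ isT erefl).
case h : (dist e u v) => [|[|[|]]] // _; first by case: uv; exact: dist_eq0.
by rewrite (dist_eq1 h) in nuv.
Qed.

Lemma dist_far u v : (2 < dist e u v)%N -> nadj e u v /\ forall t, e u t -> e t v -> False.
Proof.
have [_ h] := dist_walk u v => lt; split=> [|t ut tv]; first split.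
- by move=> uv; have := h [::] isT uv; rewrite leqNgt (leq_trans _ lt).
- by apply/negP => uv; have := h [:: v]; rewrite /= uv => /(_ isT erefl); lia.
- by have := h [:: t; v]; rewrite /= ut tv => /(_ isT erefl); lia.
Qed.

Lemma far_dist u v : nadj e u v -> (forall t, e u t -> e t v -> False) -> (2 < dist e u v)%N.
Proof.
move=> [uv nuv] h; have [[s [ps ls <-]] _] := dist_walk u v.
case: s ps ls => [|x [|y [|z s]]] //=; rewrite ?andbT.
- by move=> ux E; rewrite -E ux in nuv.
- by move=> /andP[ux xy] E; rewrite E in xy; case: (h x).
Qed.

Section Interval.
Hypothesis IC : interval_condition e.

(** The three properties of intervals are decided on the model graphs, with vertices numbered from
0 to n - 1, instead of being proved by cases on their vertices. *)
Definition interval_check n (f : rel nat) :=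
  all (fun i => all (fun j => (i != j) && ~~ f i j ==>
    let C := [seq k <- iota 0 n | f i k && f j k] in
    has (fun k => has (fun l => (k != l) && ~~ f k l) C) C &&
    all (fun k => all (fun l => all (fun m =>
      ([&& k != l, ~~ f k l, k != m & ~~ f k m] ==> (l == m)) &&
      ~~ [&& f k l, f l m & f k m]) C) C) C) (iota 0 n)) (iota 0 n).

Definition C4n i j := ((j == i.+1 %% 4) || (i == j.+1 %% 4))%N.
Definition W4n i j := [|| (i < 4)%N && (j == 4), (i == 4) && (j < 4)%N |
    [&& (i < 4)%N, (j < 4)%N & (j == i.+1 %% 4)%N || (i == j.+1 %% 4)%N]].
Definition octn i j := ((i != j) && (i != j %[mod 3]))%N.

Lemma interval_model u v : dist e u v = 2 -> exists n (f : rel nat), interval_check n f /\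
  exists2 h : Defs.interval e u v -> 'I_n, bijective h &
    forall x y, f (h x) (h y) = e (val x) (val y).
Proof.
case/IC => -[h bh hE].
- by exists 4, C4n; split; [vm_compute|exists h].
- by exists 5, W4n; split; [vm_compute|exists h].
- by exists 6, octn; split; [vm_compute|exists h].
Qed.

Lemma interval_transfer u v x : nadj e u v -> e u x -> e v x ->
  (exists p q, [/\ e u p, e v p, e u q, e v q & nadj e p q]) /\
  forall p q r, e u p -> e v p -> e u q -> e v q -> e u r -> e v r ->
    (nadj e p q -> nadj e p r -> q = r) /\ (e p q -> e q r -> e p r -> False).
Proof.
move=> uv ux vx; have d2 : dist e u v = 2 by apply: (dist_two uv ux); rewrite e_sym.
have [n [f [chk [h bh hE]]]] := interval_model d2.
have comI p : e u p -> e v p -> Defs.interval e u v p.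
  by move=> up vp; rewrite /Defs.interval /= d2 !dist_adj // e_sym.
have uI : Defs.interval e u v u by rewrite /Defs.interval /= dist_refl d2.
have vI : Defs.interval e u v v by rewrite /Defs.interval /= dist_refl d2.
have Icom (p : Defs.interval e u v) : e u (val p) -> e v (val p) = e (val p) v by rewrite e_sym.
pose el p (hp : Defs.interval e u v p) : Defs.interval e u v := exist _ p (mem_set hp).
have hi p : h p \in 'I_n by [].
have hinj : injective h by exact: bij_inj.
have io (p : Defs.interval e u v) : (h p : nat) \in iota 0 n by rewrite mem_iota ltn_ord.
move/allP: chk => /(_ _ (io (el u uI))) /allP /(_ _ (io (el v vI))).
rewrite hE /= (negPf (proj2 uv)) andbT.
have -> : (h (el u uI) != h (el v vI) :> nat).
  by apply/eqP => /val_inj /hinj /(congr1 val) /= E; case: uv.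
set C := [seq k <- _ | _] => /andP[hC aC].
have Cin p (hp : Defs.interval e u v p) : e u p -> e v p -> (h (el p hp) : nat) \in C.
  by move=> up vp; rewrite mem_filter io !hE /= up vp.
have Cout k : k \in C -> exists p (hp : Defs.interval e u v p), [/\ k = h (el p hp), e u p & e v p].
  rewrite mem_filter mem_iota /= => /andP[/andP[f1 f2] kn].
  have [g gK hK] := bh; pose z := g (Ordinal kn).
  have hz : Defs.interval e u v (val z) by apply: set_mem; exact: valP.
  have zE : z = el (val z) hz by apply: val_inj.
  have kE : k = h z by rewrite /z hK.
  by exists (val z), hz; rewrite -zE; move: f1 f2; rewrite kE !hE.
split.
  case/hasP: hC => k /Cout [p [hp [-> up vp]]] /hasP [l /Cout [q [hq [-> uq vq]]]].
  rewrite hE /= => /andP[npq nf]; exists p, q; split=> //; split=> // E; subst q.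
  by case/eqP: npq; congr (nat_of_ord (h _)); apply: val_inj.
move=> p q r up vp uq vq ur vr.
have [hp hq hr] := And3 (comI p up vp) (comI q uq vq) (comI r ur vr).
move/allP: aC => /(_ _ (Cin p hp up vp)) /allP /(_ _ (Cin q hq uq vq)) /allP /(_ _ (Cin r hr ur vr)).
rewrite !hE /= => /andP[/implyP h1 h2]; have neq a b (ha : Defs.interval e u v a) (hb : Defs.interval
    e u v b) :
    a <> b -> h (el a ha) != h (el b hb) :> nat.
  by move=> ab; apply/eqP => /val_inj /hinj /(congr1 val).
split=> [[pq npq] [pr npr]|pq qr pr]; last by move: h2; rewrite pq qr pr.
have : (h (el q hq) == h (el r hr) :> nat).
  by apply: h1; rewrite (neq p q) // (neq p r) // npq npr.
by move/eqP/val_inj/hinj/(congr1 val).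
Qed.

Lemma ic_opp_ex u v x : nadj e u v -> e u x -> e v x ->
  exists p q, [/\ e u p, e v p, e u q, e v q & nadj e p q].
Proof. by move=> uv ux vx; have [] := interval_transfer uv ux vx. Qed.

Lemma ic_opp_uniq u v p q r : nadj e u v ->
  e u p -> e v p -> e u q -> e v q -> e u r -> e v r ->
  nadj e p q -> nadj e p r -> q = r.
Proof.
move=> uv up vp uq vq ur vr; have [_ /(_ p q r)] := interval_transfer uv up vp.
by move=> /(_ up vp uq vq ur vr) [].
Qed.

Lemma ic_trifree u v p q r : nadj e u v ->
  e u p -> e v p -> e u q -> e v q -> e u r -> e v r ->
  e p q -> e q r -> e p r -> False.
Proof.
move=> uv up vp uq vq ur vr; have [_ /(_ p q r)] := interval_transfer uv up vp.
by move=> /(_ up vp uq vq ur vr) [].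
Qed.
End Interval.

Section LocalPositioning.
Hypothesis LPC : local_positioning_condition e.

Lemma sq_is_square a b c d : sq e a b c d -> is_square e a b c d.
Proof. by case=> ? ? ? ? [[? ?] [? ?]]; split. Qed.
Lemma is_square_rot a b c d : is_square e a b c d -> is_square e b c d a.
Proof. by case=> [[? ? ? ?] ? ? ? ?]; split=> //; [exact: nesym|rewrite e_sym]. Qed.
Lemma is_square_sq a b c d : is_square e a b c d -> sq e a b c d.
Proof. by case=> [[? ? ? ?] ? ? ? ?]; split=> //; split. Qed.

(** The distances from z to b and d have sum 4, and the first is 1. *)
Lemma lpc_corner_far a b c d z : sq e a b c d -> e z b -> nadj e z a -> nadj e z c ->
  nadj e z d /\ forall t, e z t -> e t d -> False.
Proof.
move=> s zb za zc; have [ab bc _ _ _] := s.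
have ba : e b a by rewrite e_sym.
have := LPC (sq_is_square s) (dist_two za zb ba) (dist_two zc zb bc).
by rewrite dist_adj // add1n => -[h]; apply: dist_far; rewrite h.
Qed.

(** The distances from z to b and d have sum 4, and the first is at least 3. *)
Lemma lpc_corner_adj a b c d z s t : sq e a b c d -> nadj e z a -> e z s -> e s a ->
  nadj e z c -> e z t -> e t c ->
  nadj e z b -> (forall t, e z t -> e t b -> False) -> e z d.
Proof.
move=> sq0 za zs sa zc zt tc zb nzb; have [ab bc cd da _] := sq0.
have := LPC (sq_is_square sq0) (dist_two za zs sa) (dist_two zc zt tc).
have := far_dist zb nzb.
case h : (dist e z d) => [|[|k]]; [|by move: h => /dist_eq1|by lia].
by have E := dist_eq0 h; subst z; case: za; rewrite da.
Qed.
End LocalPositioning.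
End Distances.

Import Order.TTheory GRing.Theory Num.Theory.
Import numFieldNormedType.Exports.
Local Open Scope classical_set_scope.
Local Open Scope ring_scope.

(** * Locally constant systems over the unit square *)
Section Cousin.
Variable R : realType.

Lemma min_gt0 (a b : R) : 0 < a -> 0 < b -> exists2 d, 0 < d & d <= a /\ d <= b.
Proof. by move=> a0 b0; exists (Num.min a b); rewrite ?lt_min ?a0 // !ge_min !lexx orbT. Qed.

(** Cousin's form of compactness: an additive property of intervals that holds for the small intervals
around each point holds for [0,1]. *)
Lemma cousin (Q : R -> R -> Prop) :
  (forall x, 0 <= x <= 1 -> exists2 d, 0 < d & forall s t, 0 <= s -> s <= x -> x <= t -> t <= 1 ->
     x - d < s -> t < x + d -> Q s t) ->
  (forall r s t, 0 <= r -> r <= s -> s <= t -> t <= 1 -> Q r s -> Q s t -> Q r t) -> Q 0 1.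
Proof.
move=> loc add; pose S := [set t : R | 0 <= t <= 1 /\ Q 0 t]%classic.
have Q00 : Q 0 0.
  by have [|d d0 h] := loc 0; [lra|apply: h; lra].
have S0 : S 0 by split=> //; lra.
have Sub : has_sup S by split; [exists 0|exists 1 => t [/andP[]]].
have s0 : 0 <= sup S by apply: ub_le_sup S0; case: Sub.
have s1 : sup S <= 1 by apply: ge_sup => [|t [/andP[]]] //; case: Sub.
have [|d d0 h] := loc (sup S); first by rewrite s0.
have [t St lt] := sup_adherent d0 Sub; have [/andP[t0 t1] Qt] := St.
have ts : t <= sup S by apply: ub_le_sup St; case: Sub.
(* if the supremum were less than 1, the property would hold up to a larger b *)
pose b := Num.min 1 (sup S + d / 2).
have [b1 [bs bd]] : b <= 1 /\ sup S <= b /\ b < sup S + d.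
  by rewrite /b; case: (lerP 1 (sup S + d / 2)); lra.
have Qb : Q 0 b.
  by apply: (add 0 t b) => //; [lra|apply: h; lra].
have Sb : S b by split=> //; lra.
have bS : b <= sup S by apply: ub_le_sup Sb; case: Sub.
have bE : b = 1 by move: bS; rewrite /b; case: (lerP 1 (sup S + d / 2)) => //; lra.
by rewrite -bE.
Qed.

Lemma cousin_const (P : R -> Prop) :
  (forall x, 0 <= x <= 1 -> exists2 d, 0 < d & forall s, 0 <= s <= 1 -> `|s - x| < d -> (P s <-> P x)) ->
  P 0 -> P 1.
Proof.
move=> loc; suff [] : P 0 <-> P 1 by [].
apply: (@cousin (fun s t => P s <-> P t)) => [x xi|r s t _ _ _ _ h1 h2].
  have [d d0 h] := loc x xi; exists d => // s t s0 sx xt t1 ds dt.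
  have := h s; have := h t; rewrite !ltr_norml => ht hs.
  have {}hs : P s <-> P x by apply: hs; lra.
  have {}ht : P t <-> P x by apply: ht; lra.
  by rewrite hs ht.
by rewrite h1.
Qed.
End Cousin.

Section LocalSystem.
Variable R : realType.
Implicit Types w : (R * R)%type.

Definition close w w' (d : R) := `|w'.1 - w.1| < d /\ `|w'.2 - w.2| < d.
Definition unit_square w := 0 <= w.1 <= 1 /\ 0 <= w.2 <= 1.

Lemma close_refl w d : 0 < d -> close w w d.
Proof. by rewrite /close !subrr normr0. Qed.
Lemma close_le w w' d d' : d <= d' -> close w w' d -> close w w' d'.
Proof. by move=> dd' [h1 h2]; split; [apply: lt_le_trans h1 _|apply: lt_le_trans h2 _]. Qed.

(** States in fib w over each point w of the square; chi w t is the name of the state t in the chart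
of radius eps w around w.  Charts are bijective on fibres and locally compatible. *)
Variables (T L : Type) (fib : R * R -> T -> Prop) (eps : R * R -> R) (chi : R * R -> T -> L).
Hypothesis eps_gt0 : forall w, unit_square w -> 0 < eps w.
Hypothesis chart_ex : forall w w1 w2 t1, unit_square w -> unit_square w1 -> unit_square w2 ->
  close w w1 (eps w) -> close w w2 (eps w) -> fib w1 t1 -> exists2 t2, fib w2 t2 & chi w t2 = chi w t1.
Hypothesis chart_inj : forall w w1 t t', unit_square w -> unit_square w1 -> close w w1 (eps w) ->
  fib w1 t -> fib w1 t' -> chi w t = chi w t' -> t = t'.
Hypothesis chart_compat : forall w w' w1 t1, unit_square w -> unit_square w' -> unit_square w1 ->
  close w w1 (eps w) -> close w' w1 (eps w') -> fib w1 t1 ->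
  exists2 d, 0 < d & forall w2 t2, unit_square w2 -> close w1 w2 d -> fib w2 t2 ->
    chi w t2 = chi w t1 -> chi w' t2 = chi w' t1.

Definition sect (A : set (R * R)) (sg : R * R -> T) := forall w, A w -> fib w (sg w) /\
  exists2 d, 0 < d & forall w', A w' -> close w w' d -> chi w (sg w') = chi w (sg w).

Definition convex_in (A : set (R * R)) := (forall w, A w -> unit_square w) /\
  forall w w' (s : R), A w -> A w' -> 0 <= s <= 1 ->
    A (w.1 + s * (w'.1 - w.1), w.2 + s * (w'.2 - w.2)).

Lemma sect_sub (A B : set (R * R)) sg : (forall w, B w -> A w) -> sect A sg -> sect B sg.
Proof. by move=> BA h w /BA /h [h1 [d d0 h2]]; split=> //; exists d => // w' /BA; exact: h2. Qed.

(** Agreement is locally constant along the segment from w to w'. *)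
Lemma sect_agree A sg sg' w w' : convex_in A -> sect A sg -> sect A sg' -> A w -> A w' ->
  sg w = sg' w -> sg w' = sg' w'.
Proof.
move=> [Aq cA] h h' Aw Aw'; pose pt (s : R) := (w.1 + s * (w'.1 - w.1), w.2 + s * (w'.2 - w.2)).
have p0 : pt 0 = w by rewrite /pt !mul0r !addr0 -surjective_pairing.
have p1 : pt 1 = w' by rewrite /pt !mul1r !subrKC -surjective_pairing.
rewrite -{1 2}p0 -{1 2}p1; apply: (@cousin_const _ (fun s => sg (pt s) = sg' (pt s))) => x xi.
have Ax : A (pt x) by exact: cA.
have [f1 [d1 d10 g1]] := h _ Ax; have [f2 [d2 d20 g2]] := h' _ Ax.
have e0 := eps_gt0 (Aq _ Ax).
pose d := Num.min d1 (Num.min d2 (eps (pt x))).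
have d0 : 0 < d by rewrite /d !lt_min d10 d20 e0.
have [dd1 dd2 dd3] : [/\ d <= d1, d <= d2 & d <= eps (pt x)] by rewrite /d !ge_min !lexx ?orbT.
pose M := 1 + `|w'.1 - w.1| + `|w'.2 - w.2|.
have M1 : `|w'.1 - w.1| < M by rewrite /M; have := normr_ge0 (w'.2 - w.2); lra.
have M2 : `|w'.2 - w.2| < M by rewrite /M; have := normr_ge0 (w'.1 - w.1); lra.
have M0 : 0 < M by apply: le_lt_trans M1.
exists (d / M); first by rewrite divr_gt0.
move=> s si sx; have cl : close (pt x) (pt s) d.
  have aux (a b : R) : `|b| < M -> `|(a + s * b) - (a + x * b)| < d.
    move=> bM; rewrite (_ : _ - _ = (s - x) * b); last by lra.
    rewrite normrM; have [b0|b0] := eqVneq `|b| 0; first by rewrite b0 mulr0.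
    apply: lt_trans (_ : d / M * `|b| < _).
      by rewrite ltr_pM2r // lt_neqAle eq_sym b0 normr_ge0.
    by rewrite mulrAC ltr_pdivrMr // ltr_pM2l.
  by split; exact: aux.
have As : A (pt s) by exact: cA.
have [f3 _] := h _ As; have [f4 _] := h' _ As.
have k1 := g1 _ As (close_le dd1 cl); have k2 := g2 _ As (close_le dd2 cl).
split=> E.
- apply: (chart_inj (w := pt x) (w1 := pt x)) => //; try exact: Aq.
    exact: close_refl.
  by rewrite -k1 -k2 E.
- apply: (chart_inj (w := pt x) (w1 := pt s)) => //; try exact: Aq.
    exact: close_le cl.
  by rewrite k1 k2 E.
Qed.

(** Every state extends to a section over A. *)
Definition solvable (A : set (R * R)) :=
  forall w t, A w -> fib w t -> exists2 sg, sect A sg & sg w = t.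

(** Within one chart, take at each point the state with the same name. *)
Lemma solvable_small (A : set (R * R)) w : (forall w', A w' -> unit_square w') -> unit_square w ->
  (forall w', A w' -> close w w' (eps w)) -> solvable A.
Proof.
move=> Aq qw cl w1 t1 Aw1 f1.
have ex w2 : exists t2, A w2 -> (fib w2 t2 /\ chi w t2 = chi w t1) /\ (w2 = w1 -> t2 = t1).
  have [Aw2|nA] := pselect (A w2); last by exists t1.
  have [t2 f2 c2] := chart_ex qw (Aq _ Aw1) (Aq _ Aw2) (cl _ Aw1) (cl _ Aw2) f1.
  exists t2 => _; split=> // ?; subst w2.
  by apply: (chart_inj (w := w) (w1 := w1)) => //; [exact: Aq|exact: cl].
have [sg sgP] := choice ex; exists sg; last by case: (sgP w1 Aw1) => _; exact.
move=> w2 Aw2; have [[f2 c2] _] := sgP _ Aw2; split=> //.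
have [|d d0 h] := chart_compat qw (Aq _ Aw2) (Aq _ Aw2) (cl _ Aw2) _ f2.
  by apply: close_refl; apply: eps_gt0; exact: Aq.
exists d => // w3 Aw3 cl3; have [[f3 c3] _] := sgP _ Aw3.
by apply: (h w3) => //; [exact: Aq|rewrite c3 c2].
Qed.

(** A section over one part is continued through the common point w0 to the other part; the two
agree on the convex intersection. *)
Lemma solvable_glue (A A1 A2 : set (R * R)) w0 : convex_in A1 -> convex_in A2 ->
  (forall w, A w <-> A1 w \/ A2 w) -> A1 w0 -> A2 w0 ->
  (forall w, A w -> ~ A1 w -> exists2 d, 0 < d & forall w', A1 w' -> ~ close w w' d) ->
  (forall w, A w -> ~ A2 w -> exists2 d, 0 < d & forall w', A2 w' -> ~ close w w' d) ->
  solvable A1 -> solvable A2 -> solvable A.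
Proof.
move=> c1 c2 AE w01 w02 cl1 cl2 s1 s2.
have main s1' s2' : sect A1 s1' -> sect A2 s2' -> s1' w0 = s2' w0 ->
    exists2 sg, sect A sg & (forall w, A1 w -> sg w = s1' w) /\ (forall w, A2 w -> sg w = s2' w).
  move=> h1 h2 E0; pose sg w := if pselect (A1 w) then s1' w else s2' w.
  have agree w : A1 w -> A2 w -> s1' w = s2' w.
    move=> a1 a2; apply: (@sect_agree (A1 `&` A2)%classic s1' s2' w0 w) => //.
    - split=> [u [/(proj1 c1)]|u u' s [u1 u2] [v1 v2] si] //.
      by split; [exact: (proj2 c1)|exact: (proj2 c2)].
    - by apply: sect_sub h1 => u [].
    - by apply: sect_sub h2 => u [].
  have sg1 w : A1 w -> sg w = s1' w by rewrite /sg; case: pselect.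
  have sg2 w : A2 w -> sg w = s2' w by rewrite /sg; case: pselect => // a1 a2; exact: agree.
  exists sg => // w Aw.
  have [a1|a1] := pselect (A1 w); have [a2|a2] := pselect (A2 w).
  - have [f1 [d1 d10 k1]] := h1 _ a1; have [f2 [d2 d20 k2]] := h2 _ a2.
    rewrite {1}sg1 //; split=> //; have [m m0 [dd1 dd2]] := min_gt0 d10 d20; exists m => //.
    move=> w' /AE [a'|a'] cl; first by rewrite !sg1 //; apply: k1 => //; exact: close_le cl.
    by rewrite !sg2 //; apply: k2 => //; exact: close_le cl.
  - have [f1 [d1 d10 k1]] := h1 _ a1; have [d2 d20 k2] := cl2 _ Aw a2.
    rewrite {1}sg1 //; split=> //; have [m m0 [dd1 dd2]] := min_gt0 d10 d20; exists m => //.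
    move=> w' /AE [a'|a'] cl; first by rewrite !sg1 //; apply: k1 => //; exact: close_le cl.
    by case: (k2 _ a'); exact: close_le cl.
  - have [f1 [d1 d10 k1]] := h2 _ a2; have [d2 d20 k2] := cl1 _ Aw a1.
    rewrite {1}sg2 //; split=> //; have [m m0 [dd1 dd2]] := min_gt0 d10 d20; exists m => //.
    move=> w' /AE [a'|a'] cl; last by rewrite !sg2 //; apply: k1 => //; exact: close_le cl.
    by case: (k2 _ a'); exact: close_le cl.
  - by case/AE: Aw.
move=> w t /AE [a|a] ft.
- have [s1' h1 E1] := s1 w t a ft; have [f0 _] := h1 _ w01.
  have [s2' h2 E2] := s2 w0 (s1' w0) w02 f0.
  by have [sg hs [g1 _]] := main _ _ h1 h2 (esym E2); exists sg => //; rewrite g1.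
- have [s2' h2 E2] := s2 w t a ft; have [f0 _] := h2 _ w02.
  have [s1' h1 E1] := s1 w0 (s2' w0) w01 f0.
  by have [sg hs [_ g2]] := main _ _ h1 h2 E1; exists sg => //; rewrite g2.
Qed.

Definition rect (a b c d : R) : set (R * R) := [set w | a <= w.1 <= b /\ c <= w.2 <= d]%classic.

Lemma rect_convex a b c d : 0 <= a -> b <= 1 -> 0 <= c -> d <= 1 -> convex_in (rect a b c d).
Proof.
move=> a0 b1 c0 d1; split=> [w [/andP[? ?] /andP[? ?]]|
    w w' s [/andP[? ?] /andP[? ?]] [/andP[? ?] /andP[? ?]] /andP[? ?]].
  by split; lra.
by split=> /=; nra.
Qed.

Lemma rect_glue1 a b b' c d : 0 <= a -> a <= b -> b <= b' -> b' <= 1 -> 0 <= c -> c <= d -> d <= 1 ->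
  solvable (rect a b c d) -> solvable (rect b b' c d) -> solvable (rect a b' c d).
Proof.
move=> a0 ab bb b1 c0 cd d1; apply: (@solvable_glue _ _ _ (b, c)); try apply: rect_convex; try lra.
- by move=> w; rewrite /rect /=; case: (lerP w.1 b) => h; split=> [[? ?]|[[? ?]|[? ?]]]; try (split;
    lra); [left|right]; split; lra.
- by split=> /=; lra.
- by split=> /=; lra.
- move=> w [h1 h2] nw; have bw : b < w.1 by rewrite ltNge; apply/negP => h; apply: nw; split; lra.
  exists (w.1 - b); first by lra.
  by move=> w' [h3 h4] [+ _]; rewrite ltr_norml; lra.
- move=> w [h1 h2] nw; have bw : w.1 < b by rewrite ltNge; apply/negP => h; apply: nw; split; lra.
  exists (b - w.1); first by lra.
  by move=> w' [h3 h4] [+ _]; rewrite ltr_norml; lra.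
Qed.

Lemma rect_glue2 a b c d d' : 0 <= a -> a <= b -> b <= 1 -> 0 <= c -> c <= d -> d <= d' -> d' <= 1 ->
  solvable (rect a b c d) -> solvable (rect a b d d') -> solvable (rect a b c d').
Proof.
move=> a0 ab b1 c0 cd dd d1; apply: (@solvable_glue _ _ _ (a, d)); try apply: rect_convex; try lra.
- by move=> w; rewrite /rect /=; case: (lerP w.2 d) => h; split=> [[? ?]|[[? ?]|[? ?]]]; try (split;
    lra); [left|right]; split; lra.
- by split=> /=; lra.
- by split=> /=; lra.
- move=> w [h1 h2] nw; have bw : d < w.2 by rewrite ltNge; apply/negP => h; apply: nw; split; lra.
  exists (w.2 - d); first by lra.
  by move=> w' [h3 h4] [_ +]; rewrite ltr_norml; lra.
- move=> w [h1 h2] nw; have bw : w.2 < d by rewrite ltNge; apply/negP => h; apply: nw; split; lra.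
  exists (d - w.2); first by lra.
  by move=> w' [h3 h4] [_ +]; rewrite ltr_norml; lra.
Qed.

(** The lemma of Cousin is used twice.  Vertically, it shows that each thin enough strip around the
line of abscissa x can be solved; horizontally, it glues the strips. *)
Theorem solvable_square : solvable unit_square.
Proof.
suff : solvable (rect 0 1 0 1) by [].
apply: (@cousin _ (fun a b => solvable (rect a b 0 1))) => [x xi|r s t *];
    last exact: (@rect_glue1 r s t).
have : exists2 d, 0 < d & forall s t, 0 <= s -> s <= x -> x <= t -> t <= 1 -> x - d < s -> t < x + d ->
    solvable (rect s t 0 1).
  apply: (@cousin _ (fun a b => exists2 d, 0 < d & forall s t, 0 <= s -> s <= x -> x <= t -> t <= 1 ->
      x - d < s -> t < x + d -> solvable (rect s t a b))) => [y yi|r s t r0 rs st t1].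
    have qxy : unit_square (x, y) by split.
    have e0 := eps_gt0 qxy; exists (eps (x, y)) => // c d c0 cy yd d1 ec ed.
    exists (eps (x, y)) => // a b a0 ax xb b1 ea eb.
    apply: (@solvable_small _ (x, y)) => // w [/andP[? ?] /andP[? ?]]; first by split; lra.
    by split=> /=; rewrite ltr_norml; lra.
  move=> [d1 d10 h1] [d2 d20 h2]; have [m m0 [dd1 dd2]] := min_gt0 d10 d20; exists m => //.
  move=> a b a0 ax xb b1 ea eb; apply: (@rect_glue2 a b r s t) => //; try lra.
  - by apply: h1 => //; lra.
  - by apply: h2 => //; lra.
by [].
Qed.
End LocalSystem.
Arguments unit_square {R} w.

(** * Lifting squares along a covering map *)
Section Continuity.
Variable R : realType.

(** Continuity within A with an explicit radius, which the local systems above ask for. *)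
Definition cont_on (Y : topologicalType) (A : set (R * R)) (f : R * R -> Y) :=
  forall w, A w -> forall O : set Y, open O -> O (f w) ->
    exists2 d, 0 < d & forall w', A w' -> close w w' d -> O (f w').

Lemma close_ball (w w' : R * R) (d : R) : close w w' d <-> ball w d w'.
Proof.
case: w w' => [a b] [a' b']; rewrite /close /ball /= /prod_ball /= /ball /=.
by rewrite (distrC a') (distrC b').
Qed.

Lemma cont_onP (Y : topologicalType) (A : set (R * R)) (f : R * R -> Y) :
  cont_on A f <-> {within A, continuous f}.
Proof.
split=> [h|/subspace_continuousP h].
  apply/subspace_continuousP => w Aw U /=; rewrite nbhsE; case=> O [oO Ow] OU.
  have [d d0 hd] := h w Aw O oO Ow.
  change (nbhs w [set x | A x -> U (f x)]); apply/nbhs_ballP; exists d => //= w' /close_ball cl Aw'.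
  by apply: OU; exact: hd.
move=> w Aw O oO Ow; have : nbhs (f w) O by rewrite nbhsE; exists O.
move/(h w Aw); change (nbhs w [set x | A x -> O (f x)] -> exists2 d : R, 0 < d & forall w', A w' ->
    close w w' d -> O (f w')).
move=> /nbhs_ballP [d /= d0 hd].
by exists d => // w' Aw' /close_ball cl; exact: hd.
Qed.

Definition cont_unit (Y : topologicalType) (g : R -> Y) :=
  forall x, 0 <= x <= 1 -> forall O : set Y, open O -> O (g x) ->
    exists2 d, 0 < d & forall s, 0 <= s <= 1 -> `|s - x| < d -> O (g s).

Lemma cont_unitP (Y : topologicalType) (g : R -> Y) :
  cont_unit g <-> {within `[0, 1], continuous g}.
Proof.
split=> [h|/subspace_continuousP h].
  apply/subspace_continuousP => x; rewrite /= in_itv /= => xi U; rewrite nbhsE; case=> O [oO Ox] OU.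
  have [d d0 hd] := h x xi O oO Ox.
  change (nbhs x [set y | `[0, 1]%classic y -> U (g y)]); apply/nbhs_ballP; exists d => //= y;
      rewrite /ball /= distrC => cl.
  by rewrite in_itv /= => yi; apply: OU; exact: hd.
move=> x xi O oO Ox; have : nbhs (g x) O by rewrite nbhsE; exists O.
have xi' : `[0, 1]%classic x by rewrite /= in_itv.
move/(h x xi'); change (nbhs x [set y | `[0, 1]%classic y -> O (g y)] ->
    exists2 d : R, 0 < d & forall s, 0 <= s <= 1 -> `|s - x| < d -> O (g s)).
move=> /nbhs_ballP [d /= d0 hd].
exists d => // s si cl; apply: hd; last by rewrite in_itv.
by rewrite /ball /= distrC.
Qed.

Lemma cont_on_sub (Y : topologicalType) (A B : set (R * R)) (f : R * R -> Y) :
  B `<=` A -> cont_on A f -> cont_on B f.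
Proof.
move=> BA h w /BA Aw O oO Ow; have [d d0 hd] := h w Aw O oO Ow.
by exists d => // w' /BA; exact: hd.
Qed.

Definition plane_cont (A : set (R * R)) (h : R * R -> R * R) := forall w, A w ->
  forall d, 0 < d -> exists2 d', 0 < d' & forall w', A w' -> close w w' d' -> close (h w) (h w') d.

Lemma cont_on_comp (Y : topologicalType) (A B : set (R * R)) (f : R * R -> Y) h :
  plane_cont A h -> (forall w, A w -> B (h w)) -> cont_on B f -> cont_on A (f \o h).
Proof.
move=> hc AB fc w Aw O oO Ow; have [d d0 hd] := fc _ (AB _ Aw) O oO Ow.
have [d' d'0 hd'] := hc w Aw d d0; exists d' => // w' Aw' cl.
by apply: hd; [exact: AB|exact: hd'].
Qed.

Lemma plane_lip (A : set (R * R)) h (k : R) : 0 < k ->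
  (forall w w' (d : R), 0 < d -> close w w' d -> close (h w) (h w') (k * d)) -> plane_cont A h.
Proof.
move=> k0 hk w Aw d d0; exists (d / k); first by rewrite divr_gt0.
by move=> w' _ /(hk _ _ _ (divr_gt0 d0 k0)); rewrite mulrC divfK // gt_eqF.
Qed.

Lemma affine_plane_cont (A : set (R * R)) (k l : R * R) :
  plane_cont A (fun z => (k.1 + z.1 * (l.1 - k.1), k.2 + z.1 * (l.2 - k.2))).
Proof.
pose M := 1 + `|l.1 - k.1| + `|l.2 - k.2|.
have [g1 g2] := conj (normr_ge0 (l.1 - k.1)) (normr_ge0 (l.2 - k.2)).
have [M1 M2] : `|l.1 - k.1| <= M /\ `|l.2 - k.2| <= M by rewrite /M; lra.
have M0 : 0 < M by rewrite /M; lra.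
apply: (@plane_lip _ _ M) => // z z' d d0 [h1 _]; split=> /=.
- rewrite (_ : _ - _ = (l.1 - k.1) * (z'.1 - z.1)); last by ring.
  by rewrite normrM; apply: le_lt_trans (ler_wpM2r (normr_ge0 _) M1) _; rewrite ltr_pM2l.
- rewrite (_ : _ - _ = (l.2 - k.2) * (z'.1 - z.1)); last by ring.
  by rewrite normrM; apply: le_lt_trans (ler_wpM2r (normr_ge0 _) M2) _; rewrite ltr_pM2l.
Qed.
End Continuity.

Section Lifting.
Variables (R : realType) (E X : topologicalType) (p : E -> X).
Hypothesis p_cov : covering_map p.

Definition evenly (U : set X) (S : set (set E)) :=
  [/\ open U, p @^-1` U = \bigcup_(W in S) W, trivIset S id &
    forall W, S W -> open W /\
      exists q : X -> E,
        [/\ {within U, continuous q},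
            forall y, U y -> W (q y) /\ p (q y) = y &
            forall z, W z -> q (p z) = z]].

Lemma evenly_ex x : exists US : set X * set (set E), evenly US.1 US.2 /\ US.1 x.
Proof. by have [_ /(_ x) [U [S [oU Ux pU tS hS]]]] := p_cov; exists (U, S). Qed.

Lemma p_cont (O : set X) : open O -> open (p @^-1` O).
Proof. by have [/continuousP h _] := p_cov; exact: h. Qed.

Definition sheet (S : set (set E)) (t : E) : set E := xget set0 [set W | S W /\ W t].

Lemma sheetP U S t : evenly U S -> U (p t) -> S (sheet S t) /\ sheet S t t.
Proof.
move=> [oU pU tS hS] Ut; rewrite /sheet; case: xgetP => [W _ [h1 h2] //|h].
have : (p @^-1` U) t by [].
by rewrite pU; case=> W SW Wt; case: (h W).
Qed.

Lemma sheet_eq U S t W : evenly U S -> U (p t) -> S W -> W t -> sheet S t = W.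
Proof.
move=> ev Ut SW Wt; have [S1 W1] := sheetP ev Ut; case: ev => _ _ tS _.
by apply: tS => //; exists t.
Qed.

Lemma sheet_inj U S W t t' : evenly U S -> S W -> W t -> W t' -> p t = p t' -> t = t'.
Proof.
move=> [_ _ _ hS] SW Wt Wt' E0; have [_ [q [_ _ qp]]] := hS W SW.
by rewrite -(qp _ Wt) E0 qp.
Qed.

Section LiftSquare.
Variable F : R * R -> X.
Hypothesis F_cont : cont_on unit_square F.

Let fib (w : R * R) t := p t = F w.

(** The lifts of F form a locally constant system over the square, whose charts name a point by its
sheet over an evenly covered set. *)
Lemma chart_choice : exists (eps : R * R -> R) (U : R * R -> set X) (S : R * R -> set (set E)),
  forall w, unit_square w -> [/\ 0 < eps w, evenly (U w) (S w) &
    forall w', unit_square w' -> close w w' (eps w) -> U w (F w')].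
Proof.
have ex w : exists z : R * (set X * set (set E)), unit_square w -> [/\ 0 < z.1, evenly z.2.1 z.2.2 &
    forall w', unit_square w' -> close w w' z.1 -> z.2.1 (F w')].
  have [qw|nq] := pselect (unit_square w); last by exists (0, (set0, set0)).
  have [[U S] [/= ev Uw]] := evenly_ex (F w); have [oU _ _ _] := ev.
  by have [d d0 hd] := F_cont qw oU Uw; exists (d, (U, S)).
by have [f fP] := choice ex; exists (fun w => (f w).1), (fun w => (f w).2.1), (fun w => (f w).2.2).
Qed.

Variables (eps : R * R -> R) (U : R * R -> set X) (S : R * R -> set (set E)).
Hypothesis chartP : forall w, unit_square w -> [/\ 0 < eps w, evenly (U w) (S w) &
    forall w', unit_square w' -> close w w' (eps w) -> U w (F w')].

Let chi w t := sheet (S w) t.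

Let eps_gt0 w : unit_square w -> 0 < eps w.
Proof. by case/chartP. Qed.

(** The points over w2 on the same sheet as t converge to t as w2 tends to w. *)
Lemma local_section w t : unit_square w -> fib w t -> forall w0, unit_square w0 -> close w0 w (eps w0) ->
  forall O, open O -> O t -> exists2 d, 0 < d & forall w2 t2, unit_square w2 -> close w w2 d ->
    fib w2 t2 -> chi w0 t2 = chi w0 t -> O t2.
Proof.
move=> qw ft w0 qw0 cl O oO Ot; have [e0 ev UF] := chartP qw0; have [oU _ _ hS] := ev.
have Uw : U w0 (F w) by exact: UF.
have Ut : U w0 (p t) by rewrite ft.
have [SW Wt] := sheetP ev Ut; have [oW [q [qc q1 q2]]] := hS _ SW.
have qw' : q (F w) = t by rewrite -ft q2.
have oq : open (U w0 `&` q @^-1` O).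
  move/continuousP/(_ O oO): qc => /open_subspaceP [G oG hG].
  by rewrite setIC -hG; exact: openI.
have hw : (U w0 `&` q @^-1` O) (F w) by split=> //=; rewrite qw'.
have [d d0 hd] := F_cont qw oq hw; exists d => // w2 t2 qw2 cl2 f2 c2.
have [U2 O2] := hd _ qw2 cl2.
have U2t : U w0 (p t2) by rewrite f2.
have [_ Wt2] := sheetP ev U2t.
have <- : q (p t2) = t2 by apply: q2; rewrite -/(chi w0 t) -c2.
by rewrite f2.
Qed.

Let chart_ex w w1 w2 t1 : unit_square w -> unit_square w1 -> unit_square w2 ->
  close w w1 (eps w) -> close w w2 (eps w) -> fib w1 t1 -> exists2 t2, fib w2 t2 & chi w t2 = chi w t1.
Proof.
move=> qw qw1 qw2 c1 c2 f1; have [e0 ev UF] := chartP qw; have [oU _ _ hS] := ev.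
have U1 : U w (p t1) by rewrite f1; exact: UF.
have [SW Wt] := sheetP ev U1; have [oW [q [qc q1 q2]]] := hS _ SW.
have [h1 h2] := q1 (F w2) (UF _ qw2 c2).
by exists (q (F w2)) => //; apply: (sheet_eq ev _ SW h1); rewrite h2; exact: UF.
Qed.

Let chart_inj w w1 t t' : unit_square w -> unit_square w1 -> close w w1 (eps w) ->
  fib w1 t -> fib w1 t' -> chi w t = chi w t' -> t = t'.
Proof.
move=> qw qw1 c1 f1 f2 h; have [e0 ev UF] := chartP qw.
have U1 : U w (p t) by rewrite f1; exact: UF.
have U2 : U w (p t') by rewrite f2; exact: UF.
have [S1 W1] := sheetP ev U1; have [S2 W2] := sheetP ev U2.
rewrite -/(chi w t') -h in W2.
by apply: (sheet_inj ev S1 W1 W2); rewrite f1 f2.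
Qed.

Let chart_compat w w' w1 t1 : unit_square w -> unit_square w' -> unit_square w1 ->
  close w w1 (eps w) -> close w' w1 (eps w') -> fib w1 t1 ->
  exists2 d, 0 < d & forall w2 t2, unit_square w2 -> close w1 w2 d -> fib w2 t2 ->
    chi w t2 = chi w t1 -> chi w' t2 = chi w' t1.
Proof.
move=> qw qw' qw1 c1 c1' f1; have [e0 ev UF] := chartP qw'; have [oU _ _ hS] := ev.
have U1 : U w' (p t1) by rewrite f1; exact: UF.
have [SW Wt] := sheetP ev U1; have [oW _] := hS _ SW.
have [d d0 hd] := local_section qw1 f1 qw c1 oW Wt.
exists d => // w2 t2 qw2 c2 f2 h; have W2 := hd _ _ qw2 c2 f2 h.
apply: (sheet_eq ev _ SW W2); have [_ pU _ _] := ev.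
suff : (p @^-1` (U w')) t2 by [].
by rewrite pU; exists (sheet (S w') t1).
Qed.

Lemma lift_sect (A : set (R * R)) sg : A `<=` unit_square -> cont_on A sg ->
  (forall w, A w -> p (sg w) = F w) -> sect fib chi A sg.
Proof.
move=> Aq sc sF w Aw; split; first exact: sF.
have [e0 ev UF] := chartP (Aq _ Aw).
have Ut : U w (p (sg w)) by rewrite sF //; apply: UF; [exact: Aq|exact: close_refl].
have [SW Wt] := sheetP ev Ut; have [_ _ _ /(_ _ SW) [oW _]] := ev.
have [d d0 hd] := sc w Aw _ oW Wt; have [m m0 [dd1 dd2]] := min_gt0 d0 e0; exists m => //.
move=> w' Aw' cl; apply: (sheet_eq ev _ SW _).
  by rewrite sF //; apply: UF; [exact: Aq|exact: close_le cl].
by apply: hd => //; exact: close_le cl.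
Qed.

Lemma square_lift_aux w t : unit_square w -> p t = F w ->
  exists2 sg, cont_on unit_square sg & (forall w', unit_square w' -> p (sg w') = F w') /\ sg w = t.
Proof.
move=> qw ft.
have [sg hs sw] := solvable_square eps_gt0 chart_ex chart_inj chart_compat qw ft.
exists sg; last by split=> // w' qw'; case: (hs _ qw').
move=> w1 qw1 O oO Ow; have [f1 [d1 d10 h1]] := hs _ qw1.
have cl1 : close w1 w1 (eps w1) by apply: close_refl; exact: eps_gt0.
have [d d0 hd] := local_section qw1 f1 qw1 cl1 oO Ow.
have [m m0 [dd1 dd2]] := min_gt0 d0 d10; exists m => //.
move=> w2 qw2 cl; apply: (hd w2) => //; first exact: close_le cl.
  by have [] := hs _ qw2.
by apply: h1 => //; exact: close_le cl.
Qed.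

Lemma lift_unique_aux (A : set (R * R)) sg sg' w w' : convex_in A -> cont_on A sg -> cont_on A sg' ->
  (forall w, A w -> p (sg w) = F w) -> (forall w, A w -> p (sg' w) = F w) ->
  A w -> A w' -> sg w = sg' w -> sg w' = sg' w'.
Proof.
move=> cA c c' f f' Aw Aw'; have Aq : A `<=` unit_square by case: cA.
exact: (sect_agree eps_gt0 chart_inj cA (lift_sect Aq c f) (lift_sect Aq c' f') Aw Aw').
Qed.
End LiftSquare.

Lemma square_lift (F : R * R -> X) w t : cont_on unit_square F -> unit_square w -> p t = F w ->
  exists2 sg, cont_on unit_square sg & (forall w', unit_square w' -> p (sg w') = F w') /\ sg w = t.
Proof.
by move=> Fc; have [eps [U [S h]]] := chart_choice Fc; exact: (square_lift_aux Fc h).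
Qed.

Lemma lift_unique (F : R * R -> X) (A : set (R * R)) sg sg' w w' : cont_on unit_square F ->
  convex_in A -> cont_on A sg -> cont_on A sg' ->
  (forall w, A w -> p (sg w) = F w) -> (forall w, A w -> p (sg' w) = F w) ->
  A w -> A w' -> sg w = sg' w -> sg w' = sg' w'.
Proof.
by move=> Fc; have [eps [U [S h]]] := chart_choice Fc; exact: (lift_unique_aux h).
Qed.
End Lifting.

(** * Lifted cells and lifted edges *)
Section Cells.
Variables (R : realType) (V : Type) (e : rel V).
Hypotheses (e_sym : symmetric e) (e_irr : irreflexive e).
Local Notation X := (ts_complex R e).
Local Notation vp := (@vertex_point R V).

Lemma vp1 v : vp v v = 1.
Proof. by rewrite /vertex_point; case: asboolP. Qed.
Lemma vp0 v w : w <> v -> vp v w = 0.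
Proof. by rewrite /vertex_point; case: asboolP. Qed.
Lemma vp_inj u v : vp u = vp v -> u = v.
Proof.
move=> /(congr1 (@^~ u)); rewrite vp1; have [//|n] := pselect (u = v).
by rewrite vp0 // => /eqP; rewrite oner_eq0.
Qed.

(** All model cells are retracts of the unit square, so that only squares need to be lifted. *)
Definition cell_retr (c : cell V) (z : R * R) : R * R :=
  match c with
  | CVertex _ => (0, 0)
  | CEdge _ _ => (z.1, 0)
  | CTriangle _ _ _ => (Num.min z.1 (1 - z.2), z.2)
  | CSquare _ _ _ _ => z
  end.

Lemma cell_retr_id c z : cell_dom c z -> cell_retr c z = z.
Proof.
case: z => s t; case: c => [u|u v|u v w|u1 u2 u3 u4] //=.
- by move=> [_ ->].
- by move=> [_ _ h]; rewrite min_l //; lra.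
Qed.

Lemma cell_retr_dom c z : unit_square z -> cell_dom c (cell_retr c z).
Proof.
case: z => s t [/= h1 h2]; case: c => [u|u v|u v w|u1 u2 u3 u4] //=.
by case: (lerP s (1 - t)) => h; split; lra.
Qed.

Lemma dom_square (c : cell V) (z : R * R) : cell_dom c z -> unit_square (z : R * R).
Proof.
by case: z => s t; case: c => [u|u v|u v w|u1 u2 u3 u4] //= => [[-> ->]|[? ->]|[? ? ?]]; split => /=;
    lra.
Qed.

Lemma dom_convex c : convex_in (@cell_dom R V c).
Proof.
split=> [w|[s t] [s' t'] r]; first exact: dom_square.
case: c => [u|u v|u v w|u1 u2 u3 u4] /=.
- by move=> [-> ->] [-> ->] _; rewrite subrr mulr0 addr0.
- by move=> [/andP[? ?] ->] [/andP[? ?] ->] /andP[? ?]; split; [nra|ring].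
- by move=> [? ? ?] [? ? ?] /andP[? ?]; split; nra.
- by move=> [/andP[? ?] /andP[? ?]] [/andP[? ?] /andP[? ?]] /andP[? ?]; split; nra.
Qed.

Lemma cell_retr_cont c : plane_cont unit_square (cell_retr c).
Proof.
apply: (@plane_lip _ _ _ 1) => // -[s t] [s' t'] d d0; rewrite /close /= mul1r => -[h1 h2].
case: c => [u|u v|u v w|u1 u2 u3 u4] //=; rewrite ?subrr ?normr0 //; split=> //.
move: h1 h2; rewrite !ltr_norml.
by case: (lerP s (1 - t)); case: (lerP s' (1 - t')); lra.
Qed.

Lemma cell_point c : is_cell e c -> exists f : R * R -> X,
  forall z, cell_dom c z -> Defs.coord (f z) = cell_map c z.
Proof.
move=> hc; have d0 : cell_dom c ((0, 0) : R * R).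
  by case: c {hc} => [u|u v|u v w|u1 u2 u3 u4] //=; repeat split; lra.
have pt z : cell_dom c z -> exists x : X, Defs.coord x = cell_map c z.
  move=> dz; have h : exists2 c', is_cell e c' & (cell_map c' @` cell_dom c') (cell_map c z).
    by exists c => //; exists z.
  by exists (TSComplex h).
have ex z : exists x : X, cell_dom c z -> Defs.coord x = cell_map c z.
  have [dz|nz] := pselect (cell_dom c z); last by have [x _] := pt _ d0; exists x.
  by have [x hx] := pt _ dz; exists x.
by have [f hf] := choice ex; exists f.
Qed.

Lemma cell_cont c (f : R * R -> X) : is_cell e c ->
  (forall z, cell_dom c z -> Defs.coord (f z) = cell_map c z) -> cont_on (@cell_dom R V c) f.
Proof.
move=> hc fc w dw O oO Ow; have tO : ts_open O := oO.
have /open_subspaceP [G oG hG] := tO c hc.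
have Gw : G w.
  suff : (G `&` cell_dom c) w by case.
  by rewrite hG; split=> //=; exists (f w) => //; rewrite fc.
have : nbhs w G by apply: open_nbhs_nbhs.
move/nbhs_ballP => [d /= d0 hd]; exists d => // w' dw' /close_ball /hd Gw'.
have : (G `&` cell_dom c) w' by [].
rewrite hG => -[[x Ox xE] _].
by rewrite (_ : f w' = x) //; apply: Defs.coord_inj; rewrite fc // xE.
Qed.

Section Lifts.
Variables (E : topologicalType) (p : E -> X).
Hypothesis p_cov : covering_map p.

Definition is_lift (c : cell V) (phi : R * R -> E) :=
  cont_on (@cell_dom R V c) phi /\ forall z, cell_dom c z -> Defs.coord (p (phi z)) = cell_map c z.

Lemma lift_cell c w z : is_cell e c -> cell_dom c w -> Defs.coord (p z) = cell_map c w ->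
  exists2 phi, is_lift c phi & phi w = z.
Proof.
move=> hc dw zw; have [f fc] := cell_point hc.
have Fc : cont_on unit_square (f \o cell_retr c).
  by apply: cont_on_comp (cell_cont hc fc); [exact: cell_retr_cont|exact: cell_retr_dom].
have pz : p z = (f \o cell_retr c) w by apply: Defs.coord_inj; rewrite zw /comp cell_retr_id // fc.
have [sg sc [sF sw]] := square_lift p_cov Fc (dom_square dw) pz.
exists sg => //; split; first by apply: cont_on_sub sc => u; exact: dom_square.
by move=> u du; rewrite sF; [rewrite /comp cell_retr_id // fc|exact: dom_square du].
Qed.

Lemma lift_cell_unique c phi phi' w w' : is_cell e c -> is_lift c phi -> is_lift c phi' ->
  cell_dom c w -> cell_dom c w' -> phi w = phi' w -> phi w' = phi' w'.
Proof.
move=> hc [c1 l1] [c2 l2] dw dw'; have [f fc] := cell_point hc.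
have Fc : cont_on unit_square (f \o cell_retr c).
  by apply: cont_on_comp (cell_cont hc fc); [exact: cell_retr_cont|exact: cell_retr_dom].
apply: (lift_unique p_cov Fc (dom_convex c) c1 c2) => // u du;
  by apply: Defs.coord_inj; rewrite ?l1 ?l2 // /comp cell_retr_id // fc.
Qed.

Lemma is_lift_comp c c' phi (h : R * R -> R * R) : is_lift c phi -> plane_cont (cell_dom c') h ->
  (forall z, cell_dom c' z -> cell_dom c (h z)) ->
  (forall z, cell_dom c' z -> cell_map c (h z) = cell_map c' z) -> is_lift c' (phi \o h).
Proof.
move=> [c1 l1] hc hd hm; split; first exact: cont_on_comp c1.
by move=> z dz /=; rewrite l1 ?hm //; exact: hd.
Qed.

Definition over (y : E) v := Defs.coord (p y) = vp v.
Definition lifted_edge (y y' : E) a b := exists phi, [/\ is_lift (CEdge a b) phi, phi (0,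
    0) = y & phi (1, 0) = y'].

Lemma over_inj y u v : over y u -> over y v -> u = v.
Proof. by rewrite /over => -> /vp_inj. Qed.

Lemma dom_edge0 (a b : V) : cell_dom (CEdge a b) ((0, 0) : R * R). Proof. by split=> //=; lra. Qed.
Lemma dom_edge1 (a b : V) : cell_dom (CEdge a b) ((1, 0) : R * R). Proof. by split=> //=; lra. Qed.
Lemma edge0 (a b : V) : cell_map (CEdge a b) ((0, 0) : R * R) = vp a.
Proof. by apply/funext => w /=; ring. Qed.
Lemma edge1 (a b : V) : cell_map (CEdge a b) ((1, 0) : R * R) = vp b.
Proof. by apply/funext => w /=; ring. Qed.

Lemma lifted_edge_over y y' a b : lifted_edge y y' a b -> over y a /\ over y' b.
Proof.
case=> phi [[_ l] <- <-]; rewrite /over !l; try exact: dom_edge0; try exact: dom_edge1.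
by rewrite edge0 edge1.
Qed.

Lemma lifted_edge_ex y a b : e a b -> over y a -> exists y', lifted_edge y y' a b.
Proof.
move=> ab ya; have [||phi l h] := @lift_cell (CEdge a b) (0, 0) y ab.
- exact: dom_edge0.
- by rewrite edge0.
by exists (phi (1, 0)), phi.
Qed.

Lemma lifted_edge_fun y y1 y2 a b : e a b -> lifted_edge y y1 a b -> lifted_edge y y2 a b -> y1 = y2.
Proof.
move=> ab [f [lf f0 <-]] [g [lg g0 <-]].
apply: (@lift_cell_unique (CEdge a b) f g (0, 0)) => //; rewrite ?f0 ?g0 //.
- exact: dom_edge0.
- exact: dom_edge1.
Qed.

(** Segments inside a lifted cell that parametrize an edge of the complex are lifted edges; this is
applied to the boundaries of triangles and squares. *)
Lemma lifted_edge_sub c phi a b (k l : R * R) : is_lift c phi -> cell_dom c k -> cell_dom c l ->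
  (forall s, 0 <= s <= 1 -> cell_map c (k.1 + s * (l.1 - k.1), k.2 + s * (l.2 - k.2)) =
     cell_map (CEdge a b) (s, 0)) -> lifted_edge (phi k) (phi l) a b.
Proof.
move=> L dk dl hm; pose h (z : R * R) := (k.1 + z.1 * (l.1 - k.1), k.2 + z.1 * (l.2 - k.2)).
exists (phi \o h); split.
- apply: is_lift_comp L _ _ _.
  + exact: affine_plane_cont.
  + by move=> z [z1 z2]; apply: (proj2 (dom_convex c)).
  + by move=> [s t] [/= z1 _]; exact: hm.
- by rewrite /h /= !mul0r !addr0 -surjective_pairing.
- by rewrite /h /= !mul1r !subrKC -surjective_pairing.
Qed.

Lemma lifted_edge_sym y y' a b : lifted_edge y y' a b -> lifted_edge y' y b a.
Proof.
case=> phi [l <- <-]; apply: (lifted_edge_sub l); [exact: dom_edge1|exact: dom_edge0|].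
by move=> s _; apply/funext => w /=; ring.
Qed.

Lemma lifted_edge_triangle y y1 y2 a b c : is_triangle e a b c -> lifted_edge y y1 a b ->
    lifted_edge y1 y2 b c -> lifted_edge y y2 a c.
Proof.
move=> tr h1 h2; have [ab bc ca] := tr; have [oy _] := lifted_edge_over h1.
have k0 : cell_dom (CTriangle a b c) ((0, 0) : R * R) by split=> //=; lra.
have k1 : cell_dom (CTriangle a b c) ((1, 0) : R * R) by split=> //=; lra.
have k2 : cell_dom (CTriangle a b c) ((0, 1) : R * R) by split=> //=; lra.
have [||phi L f0] := @lift_cell (CTriangle a b c) (0, 0) y tr; first exact: k0.
  by rewrite oy; apply/funext => w /=; ring.
have g1 : lifted_edge y (phi (1, 0)) a b.
  by rewrite -f0; apply: (lifted_edge_sub L k0 k1) => s _; apply/funext => w /=; ring.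
have g2 : lifted_edge (phi (1, 0)) (phi (0, 1)) b c.
  by apply: (lifted_edge_sub L k1 k2) => s _; apply/funext => w /=; ring.
rewrite -(lifted_edge_fun ab h1 g1) in g2; rewrite (lifted_edge_fun bc h2 g2) -f0.
by apply: (lifted_edge_sub L k0 k2) => s _; apply/funext => w /=; ring.
Qed.

Lemma lifted_edge_square y y1 y2 y3 y3' a b c d : is_square e a b c d -> lifted_edge y y1 a b ->
    lifted_edge y1 y3 b c ->
  lifted_edge y y2 a d -> lifted_edge y2 y3' d c -> y3 = y3'.
Proof.
move=> sq0 h1 h2 h3 h4; have [[ab bc cd da] _ _ _ _] := sq0; have [oy _] := lifted_edge_over h1.
have ad : e a d by rewrite e_sym.
have dc : e d c by rewrite e_sym.
have k0 : cell_dom (CSquare a b c d) ((0, 0) : R * R) by split=> //=; lra.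
have k1 : cell_dom (CSquare a b c d) ((1, 0) : R * R) by split=> //=; lra.
have k2 : cell_dom (CSquare a b c d) ((0, 1) : R * R) by split=> //=; lra.
have k3 : cell_dom (CSquare a b c d) ((1, 1) : R * R) by split=> //=; lra.
have [||phi L f0] := @lift_cell (CSquare a b c d) (0, 0) y sq0; first exact: k0.
  by rewrite oy; apply/funext => w /=; ring.
have g1 : lifted_edge y (phi (1, 0)) a b.
  by rewrite -f0; apply: (lifted_edge_sub L k0 k1) => s _; apply/funext => w /=; ring.
have g2 : lifted_edge (phi (1, 0)) (phi (1, 1)) b c.
  by apply: (lifted_edge_sub L k1 k3) => s _; apply/funext => w /=; ring.
have g3 : lifted_edge y (phi (0, 1)) a d.
  by rewrite -f0; apply: (lifted_edge_sub L k0 k2) => s _; apply/funext => w /=; ring.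
have g4 : lifted_edge (phi (0, 1)) (phi (1, 1)) d c.
  by apply: (lifted_edge_sub L k2 k3) => s _; apply/funext => w /=; ring.
rewrite -(lifted_edge_fun ab h1 g1) in g2; rewrite -(lifted_edge_fun ad h3 g3) in g4.
by rewrite (lifted_edge_fun bc h2 g2) (lifted_edge_fun dc h4 g4).
Qed.

Local Notation W := (skeleton_vertices p).

Lemma skeletonP y : skeleton_vertices p y <-> exists v, over y v.
Proof.
split=> [[c [phi [[hc dc] _ l E0]]]|[v yv]].
  case: c hc dc l E0 => // v _ _ l /= E0.
  have : [set y] y by [].
  rewrite E0 => -[z z0 zy]; exists v; rewrite /over -zy l // z0.
  by apply/funext => w.
exists (CVertex v), (fun=> y); split=> //.
- by apply/cont_onP => w dw O oO Oy; exists 1.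
- by move=> z z0; rewrite yv z0; apply/funext => w.
- by apply/seteqP; split=> z /=; [move=> ->; exists (0, 0)|case=> ? _ <-].
Qed.

Lemma base_ex : exists q : W -> V, forall y, over (val y) (q y).
Proof.
have ex (y : W) : exists v, over (val y) v.
  by apply/skeletonP; apply: set_mem; exact: valP.
by have [q hq] := choice ex; exists q.
Qed.

Definition base : W -> V := sval (cid base_ex).
Lemma baseP y : over (val y) (base y).
Proof. by rewrite /base; case: cid => q /= h; exact: h. Qed.
Lemma base_eq (y : W) v : over (val y) v -> base y = v.
Proof. exact: over_inj (baseP y). Qed.

Definition skeleton_vertex y v (h : over y v) : W := exist _ y (mem_set ((skeletonP y).2 (ex_intro _ v
    h))).

Lemma follow_ex : exists follow : W -> V -> W, forall y x, e (base y) x ->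
    lifted_edge (val y) (val (follow y x)) (base y) x.
Proof.
have ex (yx : W * V) : exists y' : W, e (base yx.1) yx.2 ->
    lifted_edge (val yx.1) (val y') (base yx.1) yx.2.
  have [h|n] := pselect (e (base yx.1) yx.2); last by exists yx.1.
  have [y' hy'] := lifted_edge_ex h (baseP yx.1); have [_ o] := lifted_edge_over hy'.
  by exists (skeleton_vertex o).
by have [f hf] := choice ex; exists (fun y x => f (y, x)) => y x h; exact: (hf (y, x)).
Qed.

(** The other end of the edge from the base of y to x, lifted from y. *)
Definition follow : W -> V -> W := sval (cid follow_ex).
Lemma followP y x : e (base y) x -> lifted_edge (val y) (val (follow y x)) (base y) x.
Proof. by rewrite /follow; case: cid => f /= h; exact: h. Qed.

Lemma base_follow y x : e (base y) x -> base (follow y x) = x.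
Proof. by move=> h; apply: base_eq; case: (lifted_edge_over (followP h)). Qed.

Lemma lifted_edge_follow y x y' : e (base y) x -> lifted_edge (val y) (val y') (base y) x ->
    follow y x = y'.
Proof. by move=> h hy; apply: val_inj; exact: lifted_edge_fun h (followP h) hy. Qed.

Lemma follow_system : transport_system e base follow.
Proof.
split=> [y x|y x h|y a b ya ab yb|y a b c s]; first exact: base_follow.
- have h' : e (base (follow y x)) (base y) by rewrite base_follow // e_sym.
  by apply: lifted_edge_follow => //; rewrite base_follow //; apply: lifted_edge_sym; exact: followP.
- have h : e (base (follow y a)) b by rewrite base_follow.
  symmetry; apply: lifted_edge_follow => //; apply: (lifted_edge_triangle _ (followP ya)).
    by split=> //; rewrite e_sym.
  by have := followP h; rewrite base_follow.
- have [ya ab bc cy _] := s; have yc : e (base y) c by rewrite e_sym.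
  have h1 : e (base (follow y a)) b by rewrite base_follow.
  have h2 : e (base (follow y c)) b by rewrite base_follow // e_sym.
  apply: val_inj; apply: (lifted_edge_square (sq_is_square s) (followP ya) _ (followP yc)).
  + by have := followP h1; rewrite base_follow.
  + by have := followP h2; rewrite base_follow.
Qed.

Lemma lifted_cellsP n S : lifted_cells p n S <-> exists c phi,
  [/\ is_cell e c, cell_dim c = n, is_lift c phi & S = phi @` cell_dom c].
Proof.
split=> [[c [phi [[hc dc] /cont_onP cc l E0]]]|[c [phi [hc dc [/cont_onP cc l] E0]]]].
  by exists c, phi.
by exists c, phi.
Qed.

(** The only vertices on a lifted edge are its two ends. *)
Lemma skeleton_graphP (y y' : W) : skeleton_graph y y' <-> e (base y) (base y') /\
    follow y (base y') = y'.
Proof.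
split=> [/asboolP [ny [S /lifted_cellsP [c [phi [hc dc L ->]]] [[z dz zy] [z' dz' zy']]]]|[h hy]].
  case: c hc dc L dz dz' => // a b hab _ L dz dz'; have ab : e a b := hab.
  have ends u (t : R * R) (v : V) : cell_dom (CEdge a b) t -> phi t = u -> over u v ->
      (t = (0, 0) /\ v = a) \/ (t = (1, 0) /\ v = b).
    case: t => s t dt tu; rewrite /over -tu; have [_ l] := L; rewrite l //.
    case: dt => /= s01 -> hm.
    have ab' : a <> b by move=> ?; subst; rewrite e_irr in ab.
    have [av|av] := pselect (a = v).
      subst v; left; split=> //; move/(congr1 (@^~ a)): hm; rewrite !vp1 vp0 //.
      by move=> h; congr pair; lra.
    have [bv|bv] := pselect (b = v).
      subst v; right; split=> //; move/(congr1 (@^~ a)): hm; rewrite vp1 !vp0 //.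
      by move=> h; congr pair; lra.
    move/(congr1 (@^~ v)): hm; rewrite vp1 !vp0 //; try exact: nesym.
    by rewrite !mulr0 addr0 => /eqP; rewrite eq_sym oner_eq0.
  have egf : lifted_edge (phi (0, 0)) (phi (1, 0)) a b by exists phi.
  have [[zE va]|[zE va]] := ends _ _ _ dz zy (baseP y);
      have [[zE' va']|[zE' va']] := ends _ _ _ dz' zy' (baseP y').
  - by case: ny; rewrite -zy -zy' zE zE'.
  - rewrite va va'; split=> //; apply: lifted_edge_follow; rewrite va //.
    by rewrite -zy -zy' zE zE'.
  - rewrite va va' e_sym; split=> //; apply: lifted_edge_follow; rewrite va; first by rewrite e_sym.
    by rewrite -zy -zy' zE zE'; exact: lifted_edge_sym.
  - by case: ny; rewrite -zy -zy' zE zE'.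
apply/asboolP; have h' := followP h; rewrite hy in h'; split.
  move=> E0; have := baseP y'; rewrite -E0 => /base_eq E1.
  by rewrite E1 e_irr in h.
have [phi [L f0 f1]] := h'; exists (phi @` cell_dom (CEdge (base y) (base y'))).
  by apply/lifted_cellsP; exists (CEdge (base y) (base y')), phi.
split; [exists (0, 0); [exact: dom_edge0|exact: f0]|exists (1, 0); [exact: dom_edge1|exact: f1]].
Qed.
End Lifts.
End Cells.

(** * Segments from a point of the complex to the corners of its cell *)
Section Corners.
Variables (R : realType) (V : Type) (e : rel V).
Hypotheses (e_sym : symmetric e) (e_irr : irreflexive e).
Local Notation X := (ts_complex R e).
Local Notation vp := (@vertex_point R V).

Definition corner (c : cell V) (k : R * R) (u : V) : Prop :=
  match c with
  | CVertex a => k = (0, 0) /\ u = a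
  | CEdge a b => (k = (0, 0) /\ u = a) \/ (k = (1, 0) /\ u = b)
  | CTriangle a b d => [\/ k = (0, 0) /\ u = a, k = (1, 0) /\ u = b | k = (0, 1) /\ u = d]
  | CSquare a b d f => [\/ k = (0, 0) /\ u = a, k = (1, 0) /\ u = b,
                           k = (1, 1) /\ u = d | k = (0, 1) /\ u = f]
  end.

Lemma corner_dom c k u : corner c k u -> cell_dom c k /\ cell_map c k = vp u.
Proof.
case: c => [a|a b|a b d|a b d f] /=.
- by move=> [-> ->]; split=> //; apply/funext => w.
- by move=> [[-> ->]|[-> ->]]; (split; [split=> //=; lra|apply/funext => w /=; ring]).
- by move=> [[-> ->]|[-> ->]|[-> ->]]; (split; [split=> //=; lra|apply/funext => w /=; ring]).
- by move=> [[-> ->]|[-> ->]|[-> ->]|[-> ->]]; (split; [split=> //=; lra|apply/funext => w /=; ring]).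
Qed.

Definition cell_vertices (c : cell V) : seq V :=
  match c with
  | CVertex a => [:: a] | CEdge a b => [:: a; b]
  | CTriangle a b d => [:: a; b; d] | CSquare a b d f => [:: a; b; d; f]
  end.

Lemma cell_map_vertices c (w : R * R) v : cell_map c w v <> 0 -> List.In v (cell_vertices c).
Proof.
case: w => s t h; apply: contrapT => n; apply: h; move: n.
by case: c => [a|a b|a b d|a b d f] /= n; rewrite !vp0 ?mulr0 ?addr0 // => E; apply: n; rewrite E; tauto.
Qed.

Lemma corner0 c : exists u, corner c (0, 0) u.
Proof.
by case: c => [a|a b|a b d|a b d f]; exists a => //=; [left|constructor 1|constructor 1].
Qed.

Lemma vp_ge0 u v : 0 <= vp u v.
Proof. by rewrite /vertex_point; case: asboolP. Qed.

Lemma cell_support (c : cell V) (w : R * R) : cell_dom c w ->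
    exists2 u, cell_map c w u != 0 & exists k, corner c k u.
Proof.
case: w => s t; case: c => [a|a b|a b d|a b d f] /=.
- by move=> _; exists a; [rewrite vp1 oner_eq0|exists (0, 0)].
- move=> [/andP[? ?] _]; have := vp_ge0 a b; have := vp_ge0 b a => ? ?.
  case: (ltrP s 1) => h.
    by exists a; [rewrite vp1 gt_eqF //; nra|exists (0, 0); left].
  by exists b; [rewrite vp1 gt_eqF //; nra|exists (1, 0); right].
- move=> [? ? ?]; have := vp_ge0 a b; have := vp_ge0 b a; have := vp_ge0 a d;
    have := vp_ge0 d a => ? ? ? ?.
  have := vp_ge0 b d; have := vp_ge0 d b => ? ?.
  case: (ltrP 0 s) => h1; first by exists b; [rewrite vp1 gt_eqF //; nra|exists (1, 0); constructor 2].
  case: (ltrP 0 t) => h2; first by exists d; [rewrite vp1 gt_eqF //; nra|exists (0, 1); constructor 3].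
  by exists a; [rewrite vp1 gt_eqF //; nra|exists (0, 0); constructor 1].
- move=> [/andP[s0 s1] /andP[t0 t1]].
  have pos (x1 x2 x3 x4 y2 y3 y4 : R) : 0 < x1 -> 0 <= x2 -> 0 <= x3 -> 0 <= x4 ->
      0 <= y2 -> 0 <= y3 -> 0 <= y4 -> x1 + x2 * y2 + x3 * y3 + x4 * y4 != 0.
    move=> ? ? ? ? ? ? ?; have ? := mulr_ge0 (x := x2) (y := y2); have ? := mulr_ge0 (x := x3) (y := y3).
    have ? := mulr_ge0 (x := x4) (y := y4); rewrite gt_eqF // -!addrA ltr_wpDr //.
    by rewrite addr_ge0 ?addr_ge0 //; auto.
  have w1 : 0 <= (1 - s) * (1 - t) by apply: mulr_ge0; lra.
  have w2 : 0 <= s * (1 - t) by apply: mulr_ge0; lra.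
  have w3 : 0 <= s * t by apply: mulr_ge0; lra.
  have w4 : 0 <= (1 - s) * t by apply: mulr_ge0; lra.
  have g := vp_ge0.
  case: (ltrP s 1) => h1; case: (ltrP t 1) => h2.
  + exists a; last by exists (0, 0); constructor 1.
    by rewrite vp1 mulr1; apply: pos => //; apply: mulr_gt0; lra.
  + exists f; last by exists (0, 1); constructor 4.
    rewrite vp1 mulr1 addrC !addrA; apply: pos => //; apply: mulr_gt0; lra.
  + exists b; last by exists (1, 0); constructor 2.
    rewrite vp1 mulr1 [_ + s * (1 - t)]addrC; apply: pos => //; apply: mulr_gt0; lra.
  + exists d; last by exists (1, 1); constructor 3.
    rewrite vp1 mulr1 [_ + s * t]addrC !addrA; apply: pos => //; apply: mulr_gt0; lra.
Qed.

(** On a square this is the coordinate of the corner opposite to u, and 0 on the other cells. *)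
Definition opp_coord (x : V -> R) (u : V) : R :=
  xget 0 [set r | exists v, [/\ v <> u, ~~ e u v, x v <> 0 & r = x v]].

(** The segment from x to the corner u of its cell, computed from the coordinates of x alone.  So the
segments in all cells that contain x project to the same path, which is what makes their lifts
comparable. *)
Definition segment_coord (x : V -> R) (u : V) (tau : R) : V -> R := fun v =>
  let o := opp_coord x u in
  if `[< v = u >] then 1 - (1 - tau) * (1 - x u + o) + (1 - tau) ^+ 2 * o
  else if `[< x v = 0 >] then 0
  else if e u v then (1 - tau) * (x v + o) - (1 - tau) ^+ 2 * o
  else (1 - tau) ^+ 2 * x v.

Lemma opp_coord0 x u : (forall v, v <> u -> ~~ e u v -> x v = 0) -> opp_coord x u = 0.
Proof.
move=> h; rewrite /opp_coord; case: xgetP => // r _ [v [vu uv xv ->]].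
exact: h.
Qed.

Lemma opp_coord1 x u o : o <> u -> ~~ e u o ->
  (forall v, v <> u -> ~~ e u v -> v <> o -> x v = 0) -> opp_coord x u = x o.
Proof.
move=> ou uo h; rewrite /opp_coord; case: xgetP => [r _ [v [vu uv xv ->]]|nx].
  by have [->//|vo] := pselect (v = o); case: xv; exact: h.
have [//|xo] := pselect (x o = 0).
by case: (nx (x o)); exists o.
Qed.

Lemma segment_clique x u tau : (forall v, v <> u -> x v <> 0 -> e u v) ->
  segment_coord x u tau = fun v => (1 - tau) * x v + tau * vp u v.
Proof.
move=> h; apply/funext => v; rewrite /segment_coord opp_coord0.
  case: asboolP => [->|vu]; first by rewrite vp1; ring.
  rewrite vp0 //; case: asboolP => [->|xv]; first by ring.
  by rewrite h //; ring.
move=> w wu uw; have [//|xw] := pselect (x w = 0).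
by case/negP: uw; exact: h.
Qed.

(** The polynomials in segment_coord recover (1 - tau) s and (1 - tau) t from the bilinear
coordinates: with a in the corner (0, 0) the values at the other corners are s (1 - t), s t and
(1 - s) t. *)
Lemma segment_square a b c d (s t tau : R) : is_square e a b c d -> s != 1 -> t != 1 ->
  segment_coord (cell_map (CSquare a b c d) (s, t)) a tau =
  cell_map (CSquare a b c d) ((1 - tau) * s, (1 - tau) * t).
Proof.
move=> [[ab bc cd da] ac bd nac nbd] s1 t1.
have ne x y : e x y -> x <> y by move=> xy E; rewrite E e_irr in xy.
have nab := ne _ _ ab; have nbc := ne _ _ bc; have ncd := ne _ _ cd; have nda := ne _ _ da.
have ca := nesym ac; have db := nesym bd; have nba := nesym nab; have ncb := nesym nbc.
have ndc := nesym ncd; have nad := nesym nda.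
have ad : e a d by rewrite e_sym.
have s1' : 1 - s != 0 by rewrite subr_eq0 eq_sym.
have t1' : 1 - t != 0 by rewrite subr_eq0 eq_sym.
set x := cell_map _ (s, t).
have xa : x a = (1 - s) * (1 - t) by rewrite /x /= vp1 !vp0 //; ring.
have xb : x b = s * (1 - t) by rewrite /x /= vp1 !vp0 //; ring.
have xc : x c = s * t by rewrite /x /= vp1 !vp0 //; ring.
have xd : x d = (1 - s) * t by rewrite /x /= vp1 !vp0 //; ring.
have x0 v : v <> a -> v <> b -> v <> c -> v <> d -> x v = 0.
  by move=> *; rewrite /x /= !vp0 //; ring.
apply/funext => v; rewrite /segment_coord (@opp_coord1 _ a c) //; last first.
  move=> w wa aw wc; apply: x0 => // E; first by rewrite E ab in aw.
  by rewrite E ad in aw.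
have [?|va] := pselect (v = a).
  by subst v; case: asboolP => // _; rewrite xa xc /= vp1 !vp0 //; ring.
case: asboolP => // _.
have [?|vb] := pselect (v = b).
  subst v; rewrite ab xb xc /= vp1 !vp0 //; case: asboolP => [/eqP|_]; last by ring.
  by rewrite mulf_eq0 (negPf t1') orbF => /eqP ->; ring.
have [?|vc] := pselect (v = c).
  subst v; rewrite (negPf nac) xc /= vp1 !vp0 //; case: asboolP => [h|_]; last by ring.
  by transitivity ((1 - tau) ^+ 2 * (s * t)); [rewrite h; ring|ring].
have [?|vd] := pselect (v = d).
  subst v; rewrite ad xd xc /= vp1 !vp0 //; case: asboolP => [/eqP|_]; last by ring.
  by rewrite mulf_eq0 (negPf s1') /= => /eqP ->; ring.
by rewrite x0 // /= !vp0 //; case: asboolP => // _; ring.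
Qed.

Lemma corner_segment c (w : R * R) u : is_cell e c -> cell_dom c w -> cell_map c w u != 0 ->
  exists2 k, corner c k u & forall tau, 0 <= tau <= 1 ->
    cell_map c (w.1 + tau * (k.1 - w.1), w.2 + tau * (k.2 - w.2)) =
    segment_coord (cell_map c w) u tau.
Proof.
have ne x y : e x y -> x <> y by move=> xy E; rewrite E e_irr in xy.
case: w => s t; case: c => [a|a b|a b d|a b d f].
- move=> _ h; case: h => E1 E2; subst s t.
  have [->|ua] := pselect (u = a); last by rewrite /= vp0 // eqxx.
  move=> _; exists (0, 0) => // tau _; rewrite segment_clique /=; first by apply/funext => v; ring.
  by move=> v va; rewrite /= vp0.
- move=> /= ab [s01 _]; have nab := ne _ _ ab; have nba := nesym nab.
  have other v : v <> a -> v <> b -> (1 - s) * vp a v + s * vp b v = 0 by move=> *; rewrite !vp0 //;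
      ring.
  have [ua|ua] := pselect (u = a); [|have [ub|ub] := pselect (u = b)]; last by rewrite other // eqxx.
  + move=> _; exists (0, 0); [by left|] => tau _; rewrite ua segment_clique;
      first by apply/funext => v /=; ring.
    by move=> v va xv; have [->//|vb] := pselect (v = b); case: xv; exact: other.
  + move=> _; exists (1, 0); [by right|] => tau _; rewrite ub segment_clique;
      first by apply/funext => v /=; ring.
    by move=> v vb xv; have [->|va] := pselect (v = a); [rewrite e_sym|case: xv; exact: other].
- move=> /= [ab bd da] [s0 t0 st]; have [nab nbd nda] := And3 (ne _ _ ab) (ne _ _ bd) (ne _ _ da).
  have other v : v <> a -> v <> b -> v <> d -> (1 - s - t) * vp a v + s * vp b v + t * vp d v = 0.
    by move=> *; rewrite !vp0 //; ring.
  have [ba [db ad]] : e b a /\ e d b /\ e a d by split; [|split]; rewrite e_sym.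
  have clq x : x = a \/ x = b \/ x = d -> forall v, v <> x ->
      (1 - s - t) * vp a v + s * vp b v + t * vp d v <> 0 -> e x v.
    move=> hx v vx xv.
    have [va|va] := pselect (v = a); [|have [vb|vb] := pselect (v = b);
        [|have [vd|vd] := pselect (v = d)]];
      last (by case: xv; exact: other); by move: hx vx => [->|[->|->]]; rewrite ?va ?vb ?vd.
  have [ua|ua] := pselect (u = a); [|have [ub|ub] := pselect (u = b);
      [|have [ud|ud] := pselect (u = d)]];
    last by rewrite other // eqxx.
  + move=> _; exists (0, 0); [by constructor 1|] => tau _; rewrite ua segment_clique;
      first by apply/funext => v /=; ring.
    by apply: clq; left.
  + move=> _; exists (1, 0); [by constructor 2|] => tau _; rewrite ub segment_clique;
      first by apply/funext => v /=; ring.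
    by apply: clq; right; left.
  + move=> _; exists (0, 1); [by constructor 3|] => tau _; rewrite ud segment_clique;
      first by apply/funext => v /=; ring.
    by apply: clq; right; right.
- move=> sq0 _; have [[ab bd df fa] ad bf nad nbf] := sq0.
  have [nab nbd ndf nfa] := And4 (ne _ _ ab) (ne _ _ bd) (ne _ _ df) (ne _ _ fa).
  have [da fb nba ndb] := And4 (nesym ad) (nesym bf) (nesym nab) (nesym nbd).
  have [nfd naf] := conj (nesym ndf) (nesym nfa).
  have rot (x1 x2 x3 x4 : V) (s' t' : R) : cell_map (CSquare x1 x2 x3 x4) (s',
      t') = cell_map (CSquare x2 x3 x4 x1) (t', 1 - s').
    by apply/funext => v /=; ring.
  have sq1 := is_square_rot e_sym sq0; have sq2 := is_square_rot e_sym sq1;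
      have sq3 := is_square_rot e_sym sq2.
  have first (x1 x2 x3 x4 : V) (s' t' : R) : x1 <> x2 -> x1 <> x3 -> x1 <> x4 ->
      cell_map (CSquare x1 x2 x3 x4) (s', t') x1 != 0 -> s' != 1 /\ t' != 1.
    move=> n2 n3 n4; rewrite /= vp1 !vp0 // !mulr0 !addr0 mulr1 mulf_eq0 !subr_eq0 !(eq_sym 1).
    by rewrite negb_or => /andP.
  have [->|ua] := pselect (u = a).
    move=> hx; have [s1 t1] := first _ _ _ _ _ _ nab ad naf hx; exists (0, 0);
        [by constructor 1|] => tau _.
    rewrite segment_square //; congr (cell_map _ (_, _)); rewrite /=; ring.
  have [->|ub] := pselect (u = b).
    rewrite rot; move=> hx; have [s1 t1] := first _ _ _ _ _ _ nbd bf nba hx; exists (1, 0);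
        [by constructor 2|] => tau _.
    rewrite segment_square // rot; congr (cell_map _ (_, _)); rewrite /=; ring.
  have [->|ud] := pselect (u = d).
    rewrite rot rot; move=> hx; have [s1 t1] := first _ _ _ _ _ _ ndf da ndb hx; exists (1, 1);
        [by constructor 3|] => tau _.
    rewrite segment_square // rot rot; congr (cell_map _ (_, _)); rewrite /=; ring.
  have [->|uf] := pselect (u = f).
    rewrite rot rot rot; move=> hx; have [s1 t1] := first _ _ _ _ _ _ nfa fb nfd hx; exists (0, 1);
        [by constructor 4|] => tau _.
    rewrite segment_square // rot rot rot; congr (cell_map _ (_, _)); rewrite /=; ring.
  by rewrite /= !vp0 // !mulr0 !addr0 eqxx.
Qed.
End Corners.

(** * Connectedness of the 1-skeleton of the cover *)
Section Connected.
Variables (R : realType) (V : Type) (e : rel V).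
Hypotheses (e_sym : symmetric e) (e_irr : irreflexive e).
Local Notation X := (ts_complex R e).
Variables (E : topologicalType) (p : E -> X).
Hypothesis p_cov : covering_map p.
Local Notation W := (skeleton_vertices p).
Local Notation is_lift := (@is_lift R V e E p).
Local Notation follow := (follow p_cov).

Lemma unit_square_convex : convex_in (@unit_square R).
Proof. by apply: (@rect_convex R 0 1 0 1); lra. Qed.

(** Take a vertex u in the support of the point.  The segments to u in the two cells lie over the
same path and start at the same point, so they have the same end. *)
Lemma common_corner c c' phi phi' w w' : is_cell e c -> is_cell e c' -> is_lift c phi ->
    is_lift c' phi' ->
  cell_dom c w -> cell_dom c' w' -> phi w = phi' w' ->
  exists k k' u, [/\ corner c k u, corner c' k' u & phi k = phi' k'].
Proof.
move=> hc hc' L L' dw dw' E0.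
have xE : cell_map c w = cell_map c' w' by have [_ <- //] := L; have [_ <- //] := L'; rewrite E0.
have [u xu _] := cell_support dw.
have [k ck hk] := corner_segment e_sym e_irr hc dw xu.
have [|k' ck' hk'] := corner_segment e_sym e_irr (u := u) hc' dw'; first by rewrite -xE.
exists k, k', u; split=> //.
have [dk _] := corner_dom ck; have [dk' _] := corner_dom ck'.
pose h (z : R * R) := (w.1 + z.1 * (k.1 - w.1), w.2 + z.1 * (k.2 - w.2)).
pose h' (z : R * R) := (w'.1 + z.1 * (k'.1 - w'.1), w'.2 + z.1 * (k'.2 - w'.2)).
have hd z : unit_square z -> cell_dom c (h z).
  by move=> [z1 _]; exact: (proj2 (@dom_convex R V c) w k z.1).
have hd' z : unit_square z -> cell_dom c' (h' z).
  by move=> [z1 _]; exact: (proj2 (@dom_convex R V c') w' k' z.1).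
have c1 : cont_on unit_square (phi \o h).
  by apply: cont_on_comp (proj1 L); [exact: affine_plane_cont|exact: hd].
have c2 : cont_on unit_square (phi' \o h').
  by apply: cont_on_comp (proj1 L'); [exact: affine_plane_cont|exact: hd'].
have cF : cont_on unit_square (p \o (phi \o h)).
  by move=> z qz O oO Oz; apply: (c1 z qz (p @^-1` O)) => //; exact: p_cont.
have eqF z : unit_square z -> p ((phi' \o h') z) = p ((phi \o h) z).
  move=> qz; apply: Defs.coord_inj => /=.
  rewrite (proj2 L _ (hd _ qz)) (proj2 L' _ (hd' _ qz)).
  by case: qz => z1 _; rewrite /h /h' hk // hk' // xE.
have q0 : unit_square ((0, 0) : R * R) by split=> /=; lra.
have q1 : unit_square ((1, 0) : R * R) by split=> /=; lra.
have := lift_unique p_cov cF unit_square_convex c1 c2 (fun _ _ => erefl) eqF q0 q1.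
rewrite /= /h /h' /= !mul0r !addr0 !mul1r !subrKC -!surjective_pairing.
exact.
Qed.

(** Let q be the inverse of p on the sheet through a point of P.  Openness in the weak topology is
tested on each cell c: a point of c that q sends into P lies below a lift of c, which q follows
near this point, and P is constant on this lift. *)
Lemma lift_constant_open (P : set E) :
  (forall c phi w w', is_cell e c -> is_lift c phi -> cell_dom c w -> cell_dom c w' -> P (phi w) ->
      P (phi w')) ->
  open P.
Proof.
move=> Pc; rewrite openE => z Pz; rewrite /interior nbhsE.
have [[U S] [/= ev Uz]] := evenly_ex p_cov (p z); have [oU _ _ hS] := ev.
have [SW Wz] := sheetP ev Uz; set Wz' := sheet S z in SW Wz.
have [oW [q [qc q1 q2]]] := hS _ SW.
pose A : set X := [set x | U x /\ P (q x)].
have oA : open A.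
  suff : ts_open A by [].
  move=> c hc; have [f fc] := cell_point R hc; have fcont := cell_cont hc fc.
  set D := [set w | _].
  pose G := interior [set w : R * R | cell_dom c w -> D w].
  apply/open_subspaceP; exists G; first exact: open_interior.
  apply/seteqP; split=> w [h1 h2]; split=> //; first exact: (interior_subset h1).
  have [x [Ux Px] xE] := h1.
  have {}xE : x = f w by apply: Defs.coord_inj; rewrite xE fc.
  subst x; have [h3 h4] := q1 _ Ux.
  have [|phi L phiw] := lift_cell p_cov hc h2 (z := q (f w)); first by rewrite h4 fc.
  have Wphi : Wz' (phi w) by rewrite phiw.
  have [d1 d10 k1] := fcont w h2 U oU Ux.
  have [d2 d20 k2] := (proj1 L) w h2 Wz' oW Wphi.
  rewrite /G /interior /=; apply/nbhs_ballP; have [m m0 [dd1 dd2]] := min_gt0 d10 d20; exists m => //.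
  move=> w' /close_ball cl dw'; have U' := k1 _ dw' (close_le dd1 cl).
  have W' := k2 _ dw' (close_le dd2 cl).
  exists (f w'); last by rewrite fc.
  split=> //; have pE : p (phi w') = f w' by apply: Defs.coord_inj; rewrite (proj2 L) // fc.
  rewrite -pE q2 //; apply: (Pc c phi w) => //; by rewrite phiw.
exists (Wz' `&` p @^-1` A).
  split; first by apply: openI => //; exact: p_cont.
  by split=> //=; split=> //; rewrite q2.
by move=> t [Wt [_ Pt]]; rewrite q2 in Pt.
Qed.

Hypothesis E_path : path_connected R E.

Variable y0 : W.
Definition reach (y : E) := exists yw : W, val yw = y /\ exists2 s,
    path e (base y0) s & foldl follow y0 s = yw.

Lemma reach_eg y y' a b : e a b -> lifted_edge p y y' a b -> reach y -> reach y'.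
Proof.
move=> ab h [yw [ywE [s ps sE]]]; subst y.
have T := follow_system e_sym p_cov.
have [oa ob] := lifted_edge_over h; have bE : base yw = a by exact: base_eq.
have h' : e (base yw) b by rewrite bE.
exists (follow yw b); split.
  by have := followP p_cov h'; rewrite bE => /(lifted_edge_fun p_cov ab h).
exists (rcons s b); last by rewrite foldl_rcons sE.
by rewrite rcons_path ps -(pi_foldl T ps) sE.
Qed.

Lemma reach_corner c phi k u : is_cell e c -> is_lift c phi -> corner c k u ->
  reach (phi (0, 0)) <-> reach (phi k).
Proof.
move=> hc L ck.
have both a b k1 k2 : e a b -> lifted_edge p (phi k1) (phi k2) a b -> reach (phi k1) <-> reach (phi k2).
  move=> ab h; split; first exact: reach_eg ab h.
  by apply: (@reach_eg _ _ b a); [rewrite e_sym|exact: lifted_edge_sym].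
have sub a b k1 k2 u1 u2 : e a b -> corner c k1 u1 -> corner c k2 u2 ->
    (forall s, 0 <= s <= 1 -> cell_map c (k1.1 + s * (k2.1 - k1.1), k1.2 + s * (k2.2 - k1.2)) =
      cell_map (CEdge a b) (s, 0)) -> reach (phi k1) <-> reach (phi k2).
  move=> ab c1 c2 hm; apply: (both a b) => //; apply: (lifted_edge_sub L) hm.
  - by case: (corner_dom c1).
  - by case: (corner_dom c2).
case: c hc L ck sub => [a|a b|a b d|a b d f] hc L ck sub.
- by case: ck => -> _.
- case: ck => -[-> _] //; apply: (sub a b _ _ a b) => //; [by left|by right|].
  by move=> s _; apply/funext => v /=; ring.
- have [ab bd da] := hc.
  case: ck => -[-> _] //.
  + apply: (sub a b _ _ a b) => //; [by constructor 1|by constructor 2|].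
    by move=> s _; apply/funext => v /=; ring.
  + apply: (sub a d _ _ a d) => //; [by rewrite e_sym|by constructor 1|by constructor 3|].
    by move=> s _; apply/funext => v /=; ring.
- have [[ab bd df fa] _ _ _ _] := hc.
  have s1 : reach (phi (0, 0)) <-> reach (phi (1, 0)).
    apply: (sub a b _ _ a b) => //; [by constructor 1|by constructor 2|].
    by move=> s _; apply/funext => v /=; ring.
  have s2 : reach (phi (1, 0)) <-> reach (phi (1, 1)).
    apply: (sub b d _ _ b d) => //; [by constructor 2|by constructor 3|].
    by move=> s _; apply/funext => v /=; ring.
  have s3 : reach (phi (0, 0)) <-> reach (phi (0, 1)).
    apply: (sub a f _ _ a f) => //; [by rewrite e_sym|by constructor 1|by constructor 4|].
    by move=> s _; apply/funext => v /=; ring.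
  by case: ck => -[-> _] //; rewrite s1.
Qed.

(** The points on the lifted cells one of whose corners, hence all, can be reached. *)
Definition reach_cell (z : E) := exists c phi w,
  [/\ is_cell e c, is_lift c phi, cell_dom c w, phi w = z & reach (phi (0, 0))].

Lemma reach_cell_any c phi w : is_cell e c -> is_lift c phi -> cell_dom c w ->
  reach_cell (phi w) -> reach (phi (0, 0)).
Proof.
move=> hc L dw [c' [phi' [w' [hc' L' dw' E0 r]]]].
have [k [k' [u [ck ck' kE]]]] := common_corner hc hc' L L' dw dw' (esym E0).
by rewrite (reach_corner hc L ck) kE -(reach_corner hc' L' ck').
Qed.

Lemma reach_cell_const c phi w w' : is_cell e c -> is_lift c phi -> cell_dom c w -> cell_dom c w' ->
  reach_cell (phi w) -> reach_cell (phi w').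
Proof. by move=> hc L dw dw' /(reach_cell_any hc L dw) r; exists c, phi, w'. Qed.

Lemma vertex_lift y v : over p y v -> is_lift (CVertex v) (fun=> y).
Proof.
move=> yv; split; first by move=> w _ O oO Oy; exists 1.
by move=> z z0; rewrite yv z0; apply/funext => w.
Qed.

(** Since reach_cell is constant on lifted cells, it and its complement are open, and a path in E
that starts at y0 stays in it. *)
Lemma skeleton_connected (y : W) : exists2 s, path e (base y0) s & foldl follow y0 s = y.
Proof.
have [g [/cont_unitP gc g0 g1]] := E_path (val y0) (val y).
have o1 : open reach_cell by apply: lift_constant_open; exact: reach_cell_const.
have o2 : open (~` reach_cell).
  apply: lift_constant_open => c phi w w' hc L dw dw' n r; apply: n.
  exact: (reach_cell_const hc L dw' dw r).
have : reach_cell (g 1).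
  apply: (@cousin_const _ (fun s => reach_cell (g s))) => [x xi|].
    have [r|r] := pselect (reach_cell (g x)).
      by have [d d0 h] := gc x xi _ o1 r; exists d => // s si cl; split=> // _; exact: h.
    by have [d d0 h] := gc x xi _ o2 r; exists d => // s si cl; split=> // r'; case: (h s si cl).
  rewrite g0; exists (CVertex (base y0)), (fun=> val y0), (0, 0); split=> //.
    by apply: vertex_lift; exact: baseP.
  by exists y0; split=> //; exists [::].
rewrite g1 => r; have [|yw [/val_inj <- h]] // := @reach_cell_any (CVertex (base y)) (fun=> val y) (0,
    0) I _ erefl r.
by apply: vertex_lift; exact: baseP.
Qed.
End Connected.

(** * States on the support of a point *)
Section Supports.
Variables (R : realType) (V : Type) (e : rel V).
Hypotheses (e_sym : symmetric e) (e_irr : irreflexive e).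
Local Notation X := (ts_complex R e).
Local Notation vp := (@vertex_point R V).

Definition supp (x : X) (v : V) := Defs.coord x v <> 0.

Lemma supp_ex x : exists v, supp x v.
Proof.
case: x => x hx; have [c hc [w dw wx]] := hx.
by have [u ux _] := cell_support dw; exists u; apply/eqP; rewrite /= -wx.
Qed.

Lemma supp_list x : exists s : seq V, forall v, supp x v -> List.In v s.
Proof.
case: x => x [c hc [w dw wx]]; exists (cell_vertices c) => v; rewrite /supp /= -wx.
exact: cell_map_vertices.
Qed.

(** The support is that of the smallest cell of x; the faces of cells are again cells. *)
Lemma supp_cases x : (forall u v, supp x u -> supp x v -> u = v \/ e u v) \/
  (exists a b c d, is_square e a b c d /\ forall v, supp x v <-> [\/ v = a, v = b, v = c | v = d]).
Proof.
have two a b (h : forall v, supp x v -> v = a \/ v = b) : e a b ->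
    forall u v, supp x u -> supp x v -> u = v \/ e u v.
  by move=> ab u v /h [->|->] /h [->|->]; [left|right|right; rewrite e_sym|left].
have [c [hc [[s t] [dw suppE]]]] : exists c, is_cell e c /\ exists w : R * R, cell_dom c w /\
    forall v, supp x v <-> cell_map c w v <> 0.
  by case: x {two} => x [c hc [w dw wx]]; exists c; split=> //; exists w; split=> // v;
      rewrite /supp /= -wx.
have ins v : supp x v -> List.In v (cell_vertices c) by move/suppE; exact: cell_map_vertices.
case: c hc dw suppE ins => [a|a b|a b d|a b d f] hc dw suppE ins.
- by left=> u v /ins [<-|//] /ins [<-|//]; left.
- by left; apply: (two a b) hc => v /ins [<-|[<-|//]]; [left|right].
- have [ab bd da] := hc; left=> u v /ins [<-|[<-|[<-|//]]] /ins [<-|[<-|[<-|//]]];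
    try (by left); try (by right); by right; rewrite e_sym.
have [[ab bd df fa] ad bf nad nbf] := hc.
have edge a' b' r : e a' b' -> cell_map (CSquare a b d f) (s, t) = cell_map (CEdge a' b') (r, 0) ->
    (forall u v, supp x u -> supp x v -> u = v \/ e u v) \/
    (exists a b c d, is_square e a b c d /\ forall v, supp x v <-> [\/ v = a, v = b, v = c | v = d]).
  move=> ab' E; left; apply: (two a' b') ab' => v /suppE; rewrite E => h.
  by case: (cell_map_vertices h) => [<-|[<-|//]]; [left|right].
have [|t0|t1|[s0|s1]] : [\/ [/\ t != 0, t != 1, s != 0 & s != 1], t = 0, t = 1 | s = 0 \/ s = 1].
- have [?|t0] := eqVneq t 0; first by constructor 2.
  have [?|t1] := eqVneq t 1; first by constructor 3.
  have [?|s0] := eqVneq s 0; first by constructor 4; left.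
  have [?|s1] := eqVneq s 1; first by constructor 4; right.
  by constructor 1.
- move=> [tn0 tn1 sn0 sn1]; right; exists a, b, d, f; split=> // v.
  split=> [/ins [<-|[<-|[<-|[<-|//]]]]|]; [by constructor 1|by constructor 2|by constructor 3|
      by constructor 4|].
  have [x1 x2] : 1 - t != 0 /\ 1 - s != 0 by rewrite !subr_eq0 !(eq_sym 1).
  have ne w y : e w y -> w <> y by move=> xy E; rewrite E e_irr in xy.
  have [nab nbd ndf nfa] := And4 (ne _ _ ab) (ne _ _ bd) (ne _ _ df) (ne _ _ fa).
  have [da fb nba ndb] := And4 (nesym ad) (nesym bf) (nesym nab) (nesym nbd).
  have [nfd naf] := conj (nesym ndf) (nesym nfa).
  by rewrite suppE; case=> ->; rewrite /= vp1 !vp0 // !mulr0 ?addr0 ?add0r mulr1; apply/eqP;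
      rewrite mulf_neq0.
- apply: (edge a b s) => //; rewrite t0; apply/funext => v /=; ring.
- apply: (edge f d s); rewrite ?t1; [by rewrite e_sym|apply/funext => v /=; ring].
- apply: (edge a f t); rewrite ?s0; [by rewrite e_sym|apply/funext => v /=; ring].
- apply: (edge b d t) => //; rewrite s1; apply/funext => v /=; ring.
Qed.

Lemma supp_linked x u v : supp x u -> supp x v ->
  [\/ u = v, e u v | exists m, [/\ supp x m, e u m & e m v]].
Proof.
case: (supp_cases x) => [h|[a [b [c [d [[[ab bc cd da] _ _ _ _] h]]]]]] hu hv.
  by case: (h u v hu hv); [constructor 1|constructor 2].
have [sa sb sc sd] : [/\ supp x a, supp x b, supp x c & supp x d].
  by split; apply/h; [constructor 1|constructor 2|constructor 3|constructor 4].
move/h: hu => hu; move/h: hv => hv.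
case: hu => ->; case: hv => ->; try (by constructor 1); try (by constructor 2);
  try (by constructor 2; rewrite e_sym).
- by constructor 3; exists b.
- by constructor 3; exists c.
- by constructor 3; exists d.
- by constructor 3; exists a.
Qed.

Lemma cell_map_continuous (c : cell V) v : continuous (fun w : R * R => cell_map c w v).
Proof.
have c1 : continuous (fun w : R * R => w.1) by move=> w; exact: cvg_fst.
have c2 : continuous (fun w : R * R => w.2) by move=> w; exact: cvg_snd.
have cst k : continuous (fun w : R * R => k : R) by move=> w; exact: cvg_cst.
have cD (f g : R * R -> R) : continuous f -> continuous g -> continuous (fun w => f w + g w).
  by move=> hf hg w; apply: cvgD; [exact: hf|exact: hg].
have cB (f g : R * R -> R) : continuous f -> continuous g -> continuous (fun w => f w - g w).
  by move=> hf hg w; apply: cvgB; [exact: hf|exact: hg].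
have cM (f g : R * R -> R) : continuous f -> continuous g -> continuous (fun w => f w * g w).
  by move=> hf hg w; apply: cvgM; [exact: hf|exact: hg].
case: c => [a|a b|a b d|a b d f].
- rewrite (_ : (fun _ => _) = fun w : R * R => vp a v); first exact: cst.
  by apply/funext => -[s t].
- rewrite (_ : (fun _ => _) = fun w : R * R => (1 - w.1) * vp a v + w.1 * vp b v);
    last by apply/funext => -[s t].
  exact: (cD _ _ (cM _ _ (cB _ _ (cst 1) c1) (cst _)) (cM _ _ c1 (cst _))).
- rewrite (_ : (fun _ => _) = fun w : R * R => (1 - w.1 - w.2) * vp a v + w.1 * vp b v + w.2 * vp d
    v); last by apply/funext => -[s t].
  exact: (cD _ _ (cD _ _ (cM _ _ (cB _ _ (cB _ _ (cst 1) c1) c2) (cst _)) (cM _ _ c1 (cst _))) (cM _ _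
      c2 (cst _))).
- rewrite (_ : (fun _ => _) = fun w : R * R => (1 - w.1) * (1 - w.2) * vp a v + w.1 * (1 - w.2) * vp b
    v + w.1 * w.2 * vp d v + (1 - w.1) * w.2 * vp f v); last by apply/funext => -[s t].
  exact: (cD _ _ (cD _ _ (cD _ _ (cM _ _ (cM _ _ (cB _ _ (cst 1) c1) (cB _ _ (cst 1) c2)) (cst _)) (cM
      _ _ (cM _ _ c1 (cB _ _ (cst 1) c2)) (cst _))) (cM _ _ (cM _ _ c1 c2) (cst _))) (cM _ _ (cM _ _
      (cB _ _ (cst 1) c1) c2) (cst _))).
Qed.

(** The open star of v: its preimage in each cell is where one coordinate does not vanish. *)
Lemma supp_open v : open [set x : X | supp x v].
Proof.
suff : ts_open [set x : X | supp x v] by [].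
move=> c hc; have [f fc] := cell_point R hc.
apply/open_subspaceP; exists [set w : R * R | cell_map c w v != 0].
  have /continuousP h := @cell_map_continuous c v.
  apply: (h [set r | r != 0]); exact: open_neq.
apply/seteqP; split=> w [h dw]; split=> //.
  by exists (f w); rewrite /= ?fc // /supp fc //; apply/eqP.
by case: h => x sx xE; rewrite /= -xE; apply/eqP.
Qed.

(** Supports are finite, so they can only grow in a neighbourhood. *)
Lemma supp_near (F : R * R -> X) w : cont_on unit_square F -> unit_square w ->
  exists2 d, 0 < d & forall w', unit_square w' -> close w w' d -> forall v, supp (F w) v ->
      supp (F w') v.
Proof.
move=> Fc qw; have [s hs] := supp_list (F w).
suff [d d0 hd] : exists2 d, 0 < d & forall w', unit_square w' -> close w w' d ->
    forall v, List.In v s -> supp (F w) v -> supp (F w') v.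
  by exists d => // w' qw' cl v sv; apply: hd => //; exact: hs.
elim: s {hs} => [|a s [d d0 hd]]; first by exists 1.
have [sa|na] := pselect (supp (F w) a).
  have [d1 d10 h1] := Fc w qw _ (@supp_open a) sa.
  have [m m0 [dd1 dd2]] := min_gt0 d0 d10; exists m => //.
  move=> w' qw' cl v [<- _|vs]; first by apply: h1 => //; exact: close_le cl.
  by apply: hd => //; exact: close_le cl.
by exists d => // w' qw' cl v [<- //|vs]; exact: hd.
Qed.

Section System.
Variables (Z : Type) (pi : Z -> V) (step : Z -> V -> Z).
Hypothesis T : transport_system e pi step.
Variable zd : Z.

(** A state over each vertex of P, such that the edges within P carry these states to each other. *)
Definition compat (P : V -> Prop) (phi : V -> Z) :=
  (forall v, P v -> pi (phi v) = v) /\ forall u v, P u -> P v -> e u v -> phi v = step (phi u) v.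

Lemma compat_sub (P Q : V -> Prop) phi : (forall v, Q v -> P v) -> compat P phi -> compat Q phi.
Proof. by move=> QP [h1 h2]; split=> [v /QP/h1|u v /QP hu /QP hv]; last exact: h2. Qed.

Lemma compat_uniq x phi psi v : compat (supp x) phi -> compat (supp x) psi -> supp x v ->
    phi v = psi v ->
  forall u, supp x u -> phi u = psi u.
Proof.
move=> [_ h1] [_ h2] sv E0 u su; case: (supp_linked sv su) => [<- //|vu|[m [sm vm mu]]].
  by rewrite (h1 v) // (h2 v) // E0.
by rewrite (h1 m) // (h2 m) // (h1 v m) // (h2 v m) // E0.
Qed.

(** On a clique one step from v gives all states.  On a square the opposite corner is reached by two
steps, in two ways that agree.  The value zd outside the support makes families with the same
values on the support equal. *)
Lemma compat_ex x v z : supp x v -> pi z = v -> exists phi, [/\ compat (supp x) phi,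
  forall u, ~ supp x u -> phi u = zd & phi v = z].
Proof.
have [T1 T2 T3 T4] := T; move=> sv zv.
case: (supp_cases x) => [cl|[a [b [c [d [sq0 hs]]]]]].
  pose phi u := if pselect (u = v) then z else if pselect (supp x u) then step z u else zd.
  have phv : phi v = z by rewrite /phi; case: (pselect (v = v)).
  have phu u : supp x u -> u <> v -> phi u = step z u.
    by rewrite /phi => su n; case: (pselect (u = v)) => [/n //|?]; case: (pselect (supp x u)).
  have adj u : supp x u -> u <> v -> e v u.
    by move=> su n; case: (cl v u sv su) => // E; case: n.
  exists phi; split=> //; last first.
    by move=> u nu; rewrite /phi; case: (pselect (u = v)) => [E|?];
        [rewrite E in nu|case: (pselect (supp x u))].
  split=> [u su|u u' su su' uu'].
    have [->|n] := pselect (u = v); first by rewrite phv.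
    by rewrite phu // T1 // zv; exact: adj.
  have [E|n] := pselect (u = v).
    subst u; rewrite phv phu // => E; by rewrite E e_irr in uu'.
  have vu := adj _ su n.
  have [E|n'] := pselect (u' = v).
    by subst u'; rewrite phv phu // -zv T2 // zv.
  by rewrite !phu // T3 // zv //; exact: adj.
have main a' b' c' d' : is_square e a' b' c' d' -> v = a' ->
    (forall u, supp x u <-> [\/ u = a', u = b', u = c' | u = d']) ->
    exists phi, [/\ compat (supp x) phi, forall u, ~ supp x u -> phi u = zd & phi v = z].
  move=> sq1 va hs1; have [[ab bc cd da] nac nbd ac bd] := sq1; subst a'.
  have vd : e v d' by rewrite e_sym.
  have dc : e d' c' by rewrite e_sym.
  have ne w y : e w y -> w <> y by move=> xy E; rewrite E e_irr in xy.
  have [nab nbc ncd nda] := And4 (ne _ _ ab) (ne _ _ bc) (ne _ _ cd) (ne _ _ da).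
  pose phi u := if pselect (supp x u) then if pselect (u = v) then z else
    if pselect (u = c') then step (step z b') c' else step z u else zd.
  have phv : phi v = z by rewrite /phi; case: (pselect (supp x v)) => // ?; case: (pselect (v = v)).
  have sb : supp x b' by apply/hs1; constructor 2.
  have sc : supp x c' by apply/hs1; constructor 3.
  have sd : supp x d' by apply/hs1; constructor 4.
  have phb : phi b' = step z b'.
    by rewrite /phi; case: (pselect (supp x b')) => // ?; case: (pselect (b' = v)) => [E|?];
        [by case: nab|case: (pselect (b' = c'))].
  have phd : phi d' = step z d'.
    by rewrite /phi; case: (pselect (supp x d')) => // ?; case: (pselect (d' = v)) => [E|?];
        [by case: nda|case: (pselect (d' = c')) => // E; case: ncd].
  have phc : phi c' = step (step z b') c'.
    by rewrite /phi; case: (pselect (supp x c')) => // ?; case: (pselect (c' = v)) => [E|?];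
        [by case: nac|case: (pselect (c' = c'))].
  have zb : e (pi z) b' by rewrite zv.
  have zd' : e (pi z) d' by rewrite zv.
  have pb : pi (phi b') = b' by rewrite phb T1.
  have pd : pi (phi d') = d' by rewrite phd T1.
  have pc : pi (phi c') = c' by rewrite phc T1 // T1.
  have phc' : phi c' = step (phi d') c'.
    by rewrite phc phd; apply: T4; rewrite zv; exact: is_square_sq.
  have back u w : pi (phi u) = u -> e u w -> phi w = step (phi u) w -> phi u = step (phi w) u.
    by move=> pu uw ->; rewrite -{3}pu T2 // pu.
  exists phi; split=> //; last by move=> u nu; rewrite /phi; case: (pselect (supp x u)).
  split=> [u /hs1 [] -> //|u w /hs1 hu /hs1 hw]; first by rewrite phv.
  case: hu => ->; case: hw => -> uw; try (by rewrite e_irr in uw); try (by rewrite uw in ac);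
    try (by rewrite uw in bd); try (by rewrite e_sym uw in ac); try (by rewrite e_sym uw in bd).
  + by rewrite phv phb.
  + by rewrite phv phd.
  + by apply: back; rewrite ?phv // phb.
  + by rewrite phb phc.
  + by apply: back; rewrite // phb phc.
  + by apply: (back d' c').
  + by apply: back; rewrite ?phv // phd.
  + by [].
have sq1 := is_square_rot e_sym sq0; have sq2 := is_square_rot e_sym sq1;
    have sq3 := is_square_rot e_sym sq2.
case/hs: (sv) => E0.
- exact: main sq0 E0 hs.
- apply: (main _ _ _ _ sq1 E0) => u; rewrite hs; split; case;
    by [constructor 1|constructor 2|constructor 3|constructor 4].
- apply: (main _ _ _ _ sq2 E0) => u; rewrite hs; split; case;
    by [constructor 1|constructor 2|constructor 3|constructor 4].
- apply: (main _ _ _ _ sq3 E0) => u; rewrite hs; split; case;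
    by [constructor 1|constructor 2|constructor 3|constructor 4].
Qed.
End System.
End Supports.

(** * Null-homotopic walks have no holonomy *)
Section Holonomy.
Variables (R : realType) (V : Type) (e : rel V).
Hypotheses (e_sym : symmetric e) (e_irr : irreflexive e).
Local Notation X := (ts_complex R e).
Variables (Z : Type) (pi : Z -> V) (step : Z -> V -> Z).
Hypothesis T : transport_system e pi step.
Local Notation compat := (@compat V e Z pi step).

(** The fibre over w consists of the compatible families on the support of F w, and the chart at w
names a family by its value at one vertex of the support of F w: this vertex stays in the
support nearby, and by compat_uniq the value determines the family. *)
Lemma square_section (F : R * R -> X) v0 z : cont_on unit_square F -> supp (F (0, 0)) v0 -> pi z = v0 ->
  exists sg : R * R -> V -> Z, [/\ forall w, unit_square w -> compat (supp (F w)) (sg w),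
    forall w v, unit_square w -> supp (F w) v -> exists2 d, 0 < d &
      forall w', unit_square w' -> close w w' d -> sg w' v = sg w v
    & sg (0, 0) v0 = z].
Proof.
move=> Fc s0 pz.
pose fib (w : R * R) (phi : V -> Z) := compat (supp (F w)) phi /\ forall v, ~ supp (F w) v -> phi v = z.
have [vw vwP] : exists vw : R * R -> V, forall w, supp (F w) (vw w).
  have ex w : exists v, supp (F w) v by exact: supp_ex.
  by have [f hf] := choice ex; exists f.
have [eps epsP] : exists eps : R * R -> R, forall w, unit_square w -> 0 < eps w /\
    forall w', unit_square w' -> close w w' (eps w) -> forall v, supp (F w) v -> supp (F w') v.
  have ex w : exists r : R, unit_square w -> 0 < r /\
      forall w', unit_square w' -> close w w' r -> forall v, supp (F w) v -> supp (F w') v.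
    have [qw|nq] := pselect (unit_square w); last by exists 0.
    by have [d d0 h] := supp_near Fc qw; exists d.
  by have [f hf] := choice ex; exists f.
pose chi (w : R * R) (phi : V -> Z) := phi (vw w).
have uniq w1 phi psi v : fib w1 phi -> fib w1 psi -> supp (F w1) v -> phi v = psi v -> phi = psi.
  move=> [c1 o1] [c2 o2] sv E0; apply/funext => u.
  have [su|nu] := pselect (supp (F w1) u); last by rewrite o1 // o2.
  exact: (compat_uniq e_sym e_irr c1 c2 sv E0).
have spread w v w2 phi psi : unit_square w -> compat (supp (F w)) phi -> supp (F w) v ->
    compat (supp (F w2)) psi -> (forall u, supp (F w) u -> supp (F w2) u) -> psi v = phi v ->
    forall u, supp (F w) u -> psi u = phi u.
  move=> qw c1 sv c2 sub E0; apply: (compat_uniq e_sym e_irr _ c1 sv E0).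
  exact: compat_sub c2.
have eps_gt0 w : unit_square w -> 0 < eps w by case/epsP.
have chart_ex w w1 w2 t1 : unit_square w -> unit_square w1 -> unit_square w2 ->
    close w w1 (eps w) -> close w w2 (eps w) -> fib w1 t1 -> exists2 t2, fib w2 t2 & chi w t2 = chi w t1.
  move=> qw qw1 qw2 c1 c2 [[f1 _] _]; have [_ h] := epsP w qw.
  have s1 := h _ qw1 c1 _ (vwP w); have s2 := h _ qw2 c2 _ (vwP w).
  by have [phi [h1 h2 h3]] := compat_ex e_sym e_irr T z s2 (f1 _ s1); exists phi.
have chart_inj w w1 t t' : unit_square w -> unit_square w1 -> close w w1 (eps w) ->
    fib w1 t -> fib w1 t' -> chi w t = chi w t' -> t = t'.
  move=> qw qw1 c1 f1 f2; have [_ h] := epsP w qw.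
  by apply: (uniq w1) => //; exact: h.
have chart_compat w w' w1 t1 : unit_square w -> unit_square w' -> unit_square w1 ->
    close w w1 (eps w) -> close w' w1 (eps w') -> fib w1 t1 ->
    exists2 d, 0 < d & forall w2 t2, unit_square w2 -> close w1 w2 d -> fib w2 t2 ->
      chi w t2 = chi w t1 -> chi w' t2 = chi w' t1.
  move=> qw qw' qw1 c1 c1' [f1 _]; have [_ h] := epsP w qw; have [_ h'] := epsP w' qw'.
  have s1 := h _ qw1 c1 _ (vwP w); have s1' := h' _ qw1 c1' _ (vwP w').
  have [d0 hd] := epsP w1 qw1; exists (eps w1) => // w2 t2 qw2 c2 [f2 _] E0.
  by apply: (spread w1 (vw w) w2) => //; exact: hd.
have q0 : unit_square ((0, 0) : R * R) by split=> /=; lra.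
have [phi0 [h1 h2 h3]] := compat_ex e_sym e_irr T z s0 pz.
have f0 : fib (0, 0) phi0 by split.
have [sg hs E0] := solvable_square eps_gt0 chart_ex chart_inj chart_compat q0 f0.
exists sg; split=> [w qw|w v qw sv|]; last by rewrite E0.
  by have [[]] := hs w qw.
have [[f1 _] [d d0 hd]] := hs w qw; have [e0 he] := epsP w qw.
have [m m0 [dd1 dd2]] := min_gt0 d0 e0; exists m => //.
move=> w' qw' cl; have [[f2 _] _] := hs w' qw'.
apply: (spread w (vw w) w') => //.
- by apply: he => //; exact: close_le cl.
- by apply: hd => //; exact: close_le cl.
Qed.

Definition path_section (g : R -> X) (tau : R -> V -> Z) :=
  forall s, 0 <= s <= 1 -> compat (supp (g s)) (tau s) /\
    forall v, supp (g s) v -> exists2 d, 0 < d & forall s', 0 <= s' <= 1 -> `|s' - s| < d ->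
        tau s' v = tau s v.

Lemma path_section_const g tau v : path_section g tau -> (forall s, 0 <= s <= 1 -> supp (g s) v) ->
  tau 1 v = tau 0 v.
Proof.
move=> ps sv; apply: (@cousin_const _ (fun s => tau s v = tau 0 v)) => // x xi.
have [_ /(_ v (sv x xi)) [d d0 h]] := ps x xi.
by exists d => // s si cl; rewrite (h s si cl).
Qed.

(** Along the edge, the state at a is defined except at the end, and the state at b except at the
origin.  They determine each other in between, so that the function val below is constant. *)
Lemma path_section_edge g tau a b : e a b ->
  (forall s, 0 <= s <= 1 -> Defs.coord (g s) = cell_map (CEdge a b) (s, 0)) ->
  path_section g tau -> tau 1 b = step (tau 0 a) b.
Proof.
have [T1 T2 _ _] := T; move=> ab gE ps.
have ba : e b a by rewrite e_sym.
have nab : a <> b by move=> E; rewrite E e_irr in ab.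
have nba := nesym nab.
have sa s : 0 <= s <= 1 -> s < 1 -> supp (g s) a.
  by move=> si s1; rewrite /supp gE //= vp1 vp0 // mulr0 addr0 mulr1; apply/eqP;
      rewrite subr_eq0 eq_sym lt_eqF.
have sb s : 0 <= s <= 1 -> 0 < s -> supp (g s) b.
  by move=> si s1; rewrite /supp gE //= vp1 vp0 // mulr0 add0r mulr1; apply/eqP; rewrite gt_eqF.
have i1 : 0 <= (1 : R) <= 1 by lra.
have s1b : supp (g 1) b by apply: sb; lra.
(* at the end, the state at a is reconstructed from the state at b *)
pose val s := if s < 1 then tau s a else step (tau 1 b) a.
have v0 : val 0 = tau 0 a by rewrite /val ltr01.
have : val 1 = tau 0 a.
  apply: (@cousin_const _ (fun s => val s = tau 0 a)) => // x xi; rewrite /val.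
  case: (ltrP x 1) => x1.
    have [_ /(_ a (sa x xi x1)) [d d0 h]] := ps x xi.
    have [||m m0 [dd1 dd2]] := @min_gt0 R d (1 - x); [lra|lra|]; exists m => //.
    move=> s si cl; rewrite h //; last exact: lt_le_trans dd1.
    have -> // : s < 1.
    by have := lt_le_trans cl dd2; rewrite ltr_norml; lra.
  have {xi x1} -> : x = 1 by lra.
  have [c1 /(_ b s1b) [d d0 h]] := ps 1 i1.
  have [m m0 [dd1 dd2]] := min_gt0 d0 ltr01; exists m => //.
  move=> s si cl; case: (ltrP s 1) => // s1.
  have s0 : 0 < s by have := lt_le_trans cl dd2; rewrite ltr_norml; lra.
  have [[_ c2] _] := ps s si.
  by rewrite (c2 b a (sb s si s0) (sa s si s1) ba) h //; exact: lt_le_trans dd1.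
rewrite /val ltxx => <-.
have [[c1 _] _] := ps 1 i1; have pb := c1 b s1b.
by have := T2 (tau 1 b) a; rewrite pb => ->.
Qed.

Definition concat (Y : Type) (g1 g2 : R -> Y) (t : R) :=
    if t <= 2^-1 then g1 (2 * t) else g2 (2 * t - 1).

Lemma concat_cont (Y : topologicalType) (g1 g2 : R -> Y) : cont_unit g1 -> cont_unit g2 -> g1 1 = g2 0 ->
  cont_unit (concat g1 g2).
Proof.
move=> c1 c2 E0 x xi O oO; rewrite /concat.
case: (ltrgtP x (2^-1)) => hx Ox.
- have [|d d0 h] := c1 (2 * x) _ O oO Ox; first by lra.
  have [||m m0 [dd1 dd2]] := @min_gt0 R (d / 2) (2^-1 - x); [lra|lra|]; exists m => //.
  move=> s si; rewrite ltr_norml => cl.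
  have -> : s <= 2^-1 by lra.
  by apply: h; rewrite ?ltr_norml; lra.
- have [|d d0 h] := c2 (2 * x - 1) _ O oO Ox; first by lra.
  have [||m m0 [dd1 dd2]] := @min_gt0 R (d / 2) (x - 2^-1); [lra|lra|]; exists m => //.
  move=> s si; rewrite ltr_norml => cl.
  rewrite leNgt (_ : 2^-1 < s) /=; last by lra.
  by apply: h; rewrite ?ltr_norml; lra.
- have x1 : 2 * x = 1 by lra.
  rewrite x1 in Ox.
  have [|d1 d10 h1] := c1 1 _ O oO Ox; first by lra.
  have [||d2 d20 h2] := c2 0 _ O oO; [by lra|by rewrite -E0|].
  have [||m m0 [dd1 dd2]] := @min_gt0 R (d1 / 2) (d2 / 2); [lra|lra|]; exists m => //.
  move=> s si; rewrite ltr_norml => cl; case: (lerP s (2^-1)) => hs.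
  + by apply: h1; rewrite ?ltr_norml; lra.
  + by apply: h2; rewrite ?ltr_norml; lra.
Qed.

Lemma concat_section (g1 g2 : R -> X) tau : g1 1 = g2 0 -> path_section (concat g1 g2) tau ->
  path_section g1 (fun s => tau (s / 2)) /\ path_section g2 (fun s => tau ((s + 1) / 2)).
Proof.
move=> E0 ps.
have e1 s : 0 <= s <= 1 -> concat g1 g2 (s / 2) = g1 s.
  move=> si; rewrite /concat (_ : s / 2 <= 2^-1); last by lra.
  by congr g1; lra.
have e2 s : 0 <= s <= 1 -> concat g1 g2 ((s + 1) / 2) = g2 s.
  move=> si; rewrite /concat; case: (lerP ((s + 1) / 2) (2^-1)) => h; last by congr g2; lra.
  by rewrite (_ : 2 * ((s + 1) / 2) = 1) ?E0; [congr g2; lra|lra].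
split=> s si.
- have si' : 0 <= s / 2 <= 1 by lra.
  have [c h] := ps _ si'; rewrite e1 // in c h; split=> // v sv; have [d d0 hd] := h v sv.
  exists d => // s' si2 cl; apply: hd; first by lra.
  by move: cl; rewrite !ltr_norml; lra.
- have si' : 0 <= (s + 1) / 2 <= 1 by lra.
  have [c h] := ps _ si'; rewrite e2 // in c h; split=> // v sv; have [d d0 hd] := h v sv.
  exists d => // s' si2 cl; apply: hd; first by lra.
  by move: cl; rewrite !ltr_norml; lra.
Qed.

Variables (E : topologicalType) (p : E -> X).
Hypothesis p_cov : covering_map p.
Local Notation W := (skeleton_vertices p).
Local Notation follow := (follow p_cov).

(** The path is the concatenation of the lifted edges of the walk, and the states are carried along it
edge by edge. *)
Lemma realize (s : seq V) (y : W) : path e (base y) s -> exists g : R -> E,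
  [/\ cont_unit g, g 0 = val y, g 1 = val (foldl follow y s) &
    forall tau, path_section (p \o g) tau -> tau 1 (last (base y) s) = foldl step (tau 0 (base y)) s].
Proof.
elim: s y => [|x s IHs] y /=.
  move=> _; exists (fun=> val y); split=> //; first by move=> t ti O oO Oy; exists 1.
  move=> tau ps; apply: (path_section_const ps) => t _ /=.
  by rewrite /supp baseP vp1; apply/eqP; exact: oner_neq0.
move=> /andP[yx ps]; have bm := base_follow p_cov yx.
have [|g2 [c2 g20 g21 h2]] := IHs (follow y x); first by rewrite bm.
have [phi [L f0 f1]] := followP p_cov yx.
pose g1 (t : R) := phi (t, 0).
have d1 (t : R) : 0 <= t <= 1 -> cell_dom (CEdge (base y) x) (t, 0) by [].
have c1 : cont_unit g1.
  move=> t ti O oO Ot; have [d d0 h] := proj1 L _ (d1 _ ti) O oO Ot.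
  exists d => // t' ti' cl; apply: h; first exact: d1.
  by split; rewrite //= subrr normr0.
have E0 : g1 1 = g2 0 by rewrite /g1 f1 g20.
exists (concat g1 g2); split.
- exact: concat_cont.
- by rewrite /concat (_ : 0 <= 2^-1) ?mulr0 //; lra.
- rewrite /concat leNgt (_ : 2^-1 < 1) /=; last by lra.
  by rewrite (_ : 2 * 1 - 1 = 1) //; lra.
- move=> tau hps.
  have cE : p \o concat g1 g2 = concat (p \o g1) (p \o g2).
    by apply/funext => t; rewrite /concat /=; case: ifP.
  rewrite cE in hps; have [|h1 h3] := concat_section _ hps; first by rewrite /= E0.
  have r1 := path_section_edge yx _ h1; rewrite /= mul0r in r1.
  have {}r1 := r1 (fun t ti => proj2 L _ (d1 t ti)).
  have r2 := h2 _ h3; rewrite bm (_ : (1 + 1) / 2 = 1 :> R) in r2; last by lra.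
  by rewrite r2 -r1; congr (foldl step (tau _ _) s); lra.
Qed.

Hypothesis E_simple : simply_connected R E.

(** Apply square_section to the image of a null-homotopy.  On the three sides of the square where the
homotopy is constant the state is constant, and the fourth side carries z to its image by s. *)
Theorem trivial_holonomy (y : W) s z : path e (base y) s -> foldl follow y s = y -> pi z = base y ->
  foldl step z s = z.
Proof.
move=> ps sy zy; have [g [gc g0 g1 hg]] := realize ps.
have [_ _ null] := E_simple.
have [|H [Hc Hb Ht Hlr]] := null g (proj1 (cont_unitP g) gc); first by rewrite g0 g1 sy.
have qQ w : unit_square w -> (`[0, 1] `*` `[0, 1]) (w : R * R).
  by move=> [h1 h2]; split; rewrite /= in_itv.
have Hcont : cont_on unit_square H.
  by apply: cont_on_sub (proj2 (cont_onP _ _) Hc) => w /qQ.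
have Fc : cont_on unit_square (p \o H).
  by move=> w qw O oO Ow; apply: (Hcont w qw (p @^-1` O)) => //; exact: p_cont.
have I01 (t : R) : 0 <= t <= 1 -> t \in `[0, 1] by move=> ti; rewrite in_itv.
have supp_y v : v = base y -> supp (p (val y)) v.
  by move=> ->; rewrite /supp baseP vp1; apply/eqP; exact: oner_neq0.
have i0 : 0 <= (0 : R) <= 1 by lra.
have i1 : 0 <= (1 : R) <= 1 by lra.
have s0 : supp ((p \o H) (0, 0)) (base y).
  by rewrite /= Hb ?g0; [exact: supp_y|exact: I01].
have [sg [sc sl sg0]] := square_section Fc s0 zy.
have side (k : R -> R * R) : (forall t, 0 <= t <= 1 -> unit_square (k t)) ->
    (forall t t' d, `|t' - t| < d -> close (k t) (k t') d) ->
        path_section (fun t => p (H (k t))) (fun t => sg (k t)).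
  move=> kq kl t ti; split; first exact: (sc _ (kq t ti)).
  move=> v sv; have [d d0 h] := sl _ v (kq t ti) sv; exists d => // t' ti' cl.
  by apply: h; [exact: kq|exact: kl].
have bottom : path_section (fun t : R => p (H (t, 0))) (fun t => sg (t, 0)).
  apply: (side (fun t => (t, 0))) => [t ti|t t' d cl]; first by split.
  by split; rewrite //= subrr normr0; apply: le_lt_trans (normr_ge0 _) cl.
have left : path_section (fun t : R => p (H (0, t))) (fun t => sg (0, t)).
  apply: (side (fun t => (0, t))) => [t ti|t t' d cl]; first by split.
  by split; rewrite //= subrr normr0; apply: le_lt_trans (normr_ge0 _) cl.
have right : path_section (fun t : R => p (H (1, t))) (fun t => sg (1, t)).
  apply: (side (fun t => (1, t))) => [t ti|t t' d cl]; first by split.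
  by split; rewrite //= subrr normr0; apply: le_lt_trans (normr_ge0 _) cl.
have top : path_section (fun t : R => p (H (t, 1))) (fun t => sg (t, 1)).
  apply: (side (fun t => (t, 1))) => [t ti|t t' d cl]; first by split.
  by split; rewrite //= subrr normr0; apply: le_lt_trans (normr_ge0 _) cl.
have l1 : sg (0, 1) (base y) = sg (0, 0) (base y).
  apply: (path_section_const left) => t ti; have [-> _] := Hlr t (I01 t ti).
  by rewrite g0; exact: supp_y.
have r1 : sg (1, 1) (base y) = sg (1, 0) (base y).
  apply: (path_section_const right) => t ti; have [_ ->] := Hlr t (I01 t ti).
  by rewrite g0; exact: supp_y.
have t1 : sg (1, 1) (base y) = sg (0, 1) (base y).
  apply: (path_section_const top) => t ti; rewrite (Ht t (I01 t ti)).
  by rewrite g0; exact: supp_y.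
have bottom' : path_section (p \o g) (fun t => sg (t, 0)).
  by move=> t ti; have := bottom t ti; rewrite /= Hb // I01.
have := hg _ bottom'; rewrite sg0.
have -> : last (base y) s = base y.
  by rewrite -(pi_foldl (follow_system e_sym p_cov) ps) sy.
by rewrite -r1 t1 l1 sg0.
Qed.
End Holonomy.

(** * The basis graph *)
Lemma finite_injection (V : Type) (A : set V) : finite_set A ->
  exists (m : nat) (r : V -> 'I_m), forall x y, A x -> A y -> r x = r y -> x = y.
Proof.
move=> /finite_setP[n /card_set_bijP[f [fn inj _]]].
exists n.+1, (fun x => inord (f x)) => x y Ax Ay /(congr1 val).
have lt z : A z -> (f z < n.+1)%N by move=> /fn /= h; exact: leqW.
by rewrite /= !inordK ?lt // => E; apply: inj; rewrite ?inE.
Qed.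

Lemma matroid_of_image (W : Type) (I : finType) (f : W -> {set I}) (y0 : W) :
  (forall x y a, a \in (f x :\: f y)%SET ->
     exists2 b, b \in (f y :\: f x)%SET & exists z, f z = (b |: (f x :\ a))%SET) ->
  matroid [set X | `[<exists y, f y = X>]]%SET.
Proof.
move=> exch; split=> [|X Y].
  by apply/finset.set0Pn; exists (f y0); rewrite inE; apply/asboolP; exists y0.
rewrite [X \in _]inE [Y \in _]inE => /asboolP [x <-] /asboolP [y <-] a /exch [b bin bE].
by exists b => //; rewrite inE; apply/asboolP.
Qed.

Lemma iso_of_image (W : Type) (d : rel W) (I : finType) (f : W -> {set I}) :
  (forall x y, f x = f y -> x = y) -> (forall x y, d x y = adj2 (f x) (f y)) ->
  graph_iso d (basis_graph (B := [set X | `[<exists y, f y = X>]]%SET)).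
Proof.
move=> inj dE.
have fB y : f y \in [set X | `[<exists y, f y = X>]]%SET by rewrite inE; apply/asboolP; exists y.
exists (fun y => exist _ (f y) (fB y)) => [|x y]; last by rewrite dE.
have ex (X : {X : {set I} | X \in [set X | `[<exists y, f y = X>]]%SET}) : exists y, f y = val X.
  by case: X => X /= h; move: (h); rewrite inE => /asboolP.
have [g hg] := boolp.choice ex.
by exists g => [y|X]; [apply: inj; rewrite hg|apply: val_inj; rewrite /= hg].
Qed.

Section Finiteness.
Variables (R : realType) (V : Type) (e : rel V).
Variables (E : topologicalType) (p : E -> ts_complex R e).
Hypothesis p_cov : covering_map p.

(** A lifted cell is determined by the cell below it and by the lift of its corner (0, 0), and there
are finitely many cells and finitely many vertices over the graph. *)
Lemma finite_cells (I : finType) (g : I -> V) (k : I -> E) : (forall v, exists i, g i = v) ->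
  (forall y v, over p y v -> exists i, k i = y) -> finite_complex p.
Proof.
move=> gs ks.
pose cl (j : I * I * I * I * 'I_4) : cell V :=
  let: (a, b, c, d, i) := j in
  match val i with
  | 0 => CVertex (g a) | 1 => CEdge (g a) (g b) | 2 => CTriangle (g a) (g b) (g c)
  | _ => CSquare (g a) (g b) (g c) (g d) end%N.
have cls c : exists j, cl j = c.
  case: c => [a|a b|a b c|a b c d].
  - by have [i <-] := gs a; exists (i, i, i, i, inord 0); rewrite /cl /= inordK.
  - by have [i <-] := gs a; have [i2 <-] := gs b; exists (i, i2, i, i, inord 1); rewrite /cl /= inordK.
  - have [i <-] := gs a; have [i2 <-] := gs b; have [i3 <-] := gs c.
    by exists (i, i2, i3, i, inord 2); rewrite /cl /= inordK.
  - have [i <-] := gs a; have [i2 <-] := gs b; have [i3 <-] := gs c; have [i4 <-] := gs d.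
    by exists (i, i2, i3, i4, inord 3); rewrite /cl /= inordK.
pose lifted j (y : E) (S : set E) := exists phi : R * R -> E,
  [/\ is_cell e (cl j), is_lift p (cl j) phi, phi (0, 0) = y & S = phi @` cell_dom (cl j)].
have [F hF] : exists F : (I * I * I * I * 'I_4) * I -> set E,
    forall w S, lifted w.1 (k w.2) S -> F w = S.
  have ex w : exists S0, forall S, lifted w.1 (k w.2) S -> S0 = S.
    have [[S hS]|n] := pselect (exists S, lifted w.1 (k w.2) S); last first.
      by exists set0 => S hS; case: n; exists S.
    exists S => S' [phi' [hc L' E' ->]]; have [phi [_ L E0 ->]] := hS.
    have [u cu] := corner0 R (cl w.1); have [d0 _] := corner_dom cu.
    have same z : cell_dom (cl w.1) z -> phi z = phi' z.
      by move=> dz; apply: (lift_cell_unique p_cov hc L L' d0 dz); rewrite E0.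
    apply/seteqP; split=> x [z dz <-]; exists z => //; first by rewrite same.
    exact: same.
  have [F hF] := boolp.choice ex; by exists F.
apply: (@sub_finite_set _ _ (F @` setT)); last first.
  by apply: finite_image; rewrite -[setT]set_true; exact: finite_finpred.
move=> S [n _] /lifted_cellsP[c [phi [hc _ L SE]]]; have [j jc] := cls c; subst c.
have [u cu] := corner0 R (cl j); have [d0 c0] := corner_dom cu.
have [i hi] : exists i, k i = phi (0, 0).
  by apply: (ks _ u); rewrite /over; have [_ ->] := L.
by exists (j, i) => //; apply: hF; exists phi.
Qed.

(** Any point lies on the lift of a cell, which has a corner. *)
Lemma lifted_vertex (x : E) : exists (y : E) (v : V), over p y v.
Proof.
case Ex : (p x) => [f [c hc [w dw wE]]].
have [|phi [_ L] _] := lift_cell p_cov hc dw (z := x); first by rewrite Ex wE.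
have [u cu] := corner0 R c; have [d0 c0] := corner_dom cu.
by exists (phi (0, 0)), u; rewrite /over L.
Qed.

End Finiteness.

Theorem corollary1 (R : realType) (V : Type) (e : rel V)
    (e_sym : symmetric e) (e_irr : irreflexive e)
    (e_conn : connected_graph e)
    (IC : interval_condition e)
    (LPC : local_positioning_condition e)
    (e_locfin : exists v : V, finite_set [set w | e v w]%classic)
    (E : topologicalType) (p : E -> ts_complex R e)
    (p_univ : universal_cover p) :
  (exists (I : finType) (B : {set {set I}}),
      matroid B /\ graph_iso (skeleton_graph (p := p)) (basis_graph (B := B))) /\
  finite_complex p.
Proof.
have [p_cov E_simple] := p_univ; have [[x0 _] E_path _] := E_simple.
have [v0 /finite_injection[m [r r_inj]]] := e_locfin.
have [y1 [v1 o1]] := lifted_vertex p_cov x0.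
have T := follow_system e_sym p_cov.
have fiber v : exists y : skeleton_vertices p, base y = v.
  have [s ps <-] := e_conn (base (skeleton_vertex o1)) v.
  by exists (foldl (follow p_cov) (skeleton_vertex o1) s); rewrite (pi_foldl T).
have [y0 y0E] := fiber v0.
have ri x y : e (base y0) x -> e (base y0) y -> r x = r y -> x = y by rewrite y0E; exact: r_inj.
have [f [f_inj fE f_exch]] := cover_labelling e_sym e_irr
  (ic_opp_ex e_sym e_irr e_conn IC) (ic_opp_uniq e_sym e_irr e_conn IC)
  (ic_trifree e_sym e_irr e_conn IC) (lpc_corner_far e_sym e_irr e_conn LPC) (lpc_corner_adj e_conn LPC)
  T (skeleton_graphP e_sym e_irr p_cov) (skeleton_connected e_sym e_irr p_cov E_path)
  (fun Z pi step T' => @trivial_holonomy R V e e_sym e_irr Z pi step T' E p p_cov E_simple)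
  ri.
split.
  exists ('I_m + 'I_m)%type, [set X | `[<exists y, f y = X>]]%SET.
  by split; [exact: matroid_of_image|exact: iso_of_image].
have [h hf] : exists h : {set 'I_m + 'I_m} -> skeleton_vertices p, forall y, h (f y) = y.
  have ex X : exists y, forall y', f y' = X -> y = y'.
    have [[y <-]|n] := pselect (exists y, f y = X); first by exists y => y' /f_inj.
    by exists y0 => y' fy; case: n; exists y'.
  by have [h hh] := boolp.choice ex; exists h => y; exact: hh.
have := @finite_cells R V e E p p_cov {set 'I_m + 'I_m} (fun X => base (h X)) (fun X => val (h X)).
apply=> [v|y v o].
  by have [y <-] := fiber v; exists (f y); rewrite /= hf.
by exists (f (skeleton_vertex o)); rewrite /= hf.
Qed.
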